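(* Let $U$ be a left bialgebroid over $A$ and let $N$ be a braided commutative Yetter-Drinfel'd algebra over $U$. Then the cohomology groups $H^\bullet(U,N)$ carry the structure of a Gerstenhaber algebra (with the cup product and bracket specified in the context). In particular, if $U_\triangleleft$ is projective as an $A^{\mathrm{op}}$-module (i.e. as a right $A$-module), then $\mathrm{Ext}^\bullet_U(A,N)\simeq H^\bullet(U,N)$ is a Gerstenhaber algebra.
   Context: **Bialgebroids.** $k$ is a commutative ring, unadorned tensor products are over $k$, algebras are unital associative. Let $A,U$ be $k$-algebras with a $k$-algebra map $\eta:A\otimes A^{\mathrm{op}}\to U$; put $s(a)=\eta(a\otimes1)$, $t(a)=\eta(1\otimes a)$. A left $U$-module $N$ is an $A$-bimodule via $a\triangleright n\triangleleft b:=s(a)t(b)n$, a right $U$-module $M$ via $a\blacktriangleright m\blacktriangleleft b:=m\,t(a)s(b)$; both apply to $U$ (so $u\triangleleft a=t(a)u$). $U\otimes_A U:=U_\triangleleft\otimes_A{}_\triangleright U$ (so $t(a)u\otimes v=u\otimes s(a)v$) and $U\otimes_{A^{\mathrm{op}}}U:={}_\blacktriangleright U\otimes_{A^{\mathrm{op}}}U_\triangleleft$ (so $ut(a)\otimes v=u\otimes t(a)v$). $U$ is a left bialgebroid over $A$ if it carries $A$-bimodule maps (for $\triangleright,\triangleleft$) $\Delta:U\to U\otimes_AU$, $u\mapsto u_{(1)}\otimes_Au_{(2)}$, and $\varepsilon:U\to A$ making it a coassociative counital coalgebra in $A$-bimodules, such that $\Delta$ takes values in $\{\sum u_i\otimes_Av_i:\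 \sum u_it(a)\otimes_A v_i=\sum u_i\otimes_A v_is(a)\ \forall a\in A\}$ and is a unital algebra map into it, $\varepsilon(1)=1$, and $\varepsilon(uv)=\varepsilon(us(\varepsilon(v)))=\varepsilon(ut(\varepsilon(v)))$. $A$ is a left $U$-module via $ua:=\varepsilon(us(a))$. **Yetter-Drinfel'd algebras.** A left $U$-comodule is a left $A$-module $N$ with a coassociative counital left $A$-linear map $\Delta_N:N\to U_\triangleleft\otimes_AN$, $n\mapsto n_{(-1)}\otimes_An_{(0)}$; induced right $A$-action $na:=\varepsilon(n_{(-1)}t(a))n_{(0)}$. A Yetter-Drinfel'd module is a left $U$-module and left $U$-comodule whose two $A$-bimodule structures coincide and with $(u_{(1)}n)_{(-1)}u_{(2)}\otimes_A(u_{(1)}n)_{(0)}=u_{(1)}n_{(-1)}\otimes_Au_{(2)}n_{(0)}$. A Yetter-Drinfel'd algebra is such an $N$ that is also an $A$-ring (product $\cdot_N$, unit $1_N$) with $u(n\cdot_Nn')=(u_{(1)}n)\cdot_N(u_{(2)}n')$, $u1_N=\varepsilon(u)\triangleright1_N=1_N\triangleleft\varepsilon(u)$, $\Delta_N(1_N)=1_U\otimes_A1_N$, $\Delta_N(n\cdot_Nn')=n_{(-1)}n'_{(-1)}\otimes_An_{(0)}\cdot_Nn'_{(0)}$; it is braided commutative if $n\cdot_Nn'=(n_{(-1)}n')\cdot_Nn_{(0)}$. **The complex and its operations.** $C^p(U,N)$ consists of $k$-linear $\varphi:U^{\otimes_{A^{\mathrm{op}}}p}\to N$ with $\varphi(t(a)u^1,\dots,u^p)=\varphi(u^1,\dots,u^p)\triangleleft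 a$; $C^0(U,N)=N$. $H^\bullet(U,N)$ is its cohomology for $$\delta\varphi(u^1,\dots,u^{p+1})=u^1\varphi(u^2,\dots,u^{p+1})+\sum_{i=1}^p(-1)^i\varphi(u^1,\dots,u^iu^{i+1},\dots,u^{p+1})+(-1)^{p+1}\varphi(u^1,\dots,\varepsilon(u^{p+1})\blacktriangleright u^p)$$ ($\delta n(u)=un-n\triangleleft\varepsilon(u)$ for $p=0$). Write $D_\psi(u^1,\dots,u^q)_{(-1)}\otimes_AD_\psi(u^1,\dots,u^q)_{(0)}:=\psi(u^1_{(1)},\dots,u^q_{(1)})_{(-1)}u^1_{(2)}\cdots u^q_{(2)}\otimes_A\psi(u^1_{(1)},\dots,u^q_{(1)})_{(0)}$ (for $q=0$ this is $\Delta_N(\psi)$), and for $i=1,\dots,p$ $$(\varphi\circ_i\psi)(u^1,\dots,u^{p+q-1}):=\varphi\big(u^1_{(1)},\dots,u^{i-1}_{(1)},D_\psi(u^i,\dots,u^{i+q-1})_{(-1)},u^{i+q},\dots,u^{p+q-1}\big)\cdot_N\big(u^1_{(2)}\cdots u^{i-1}_{(2)}D_\psi(u^i,\dots,u^{i+q-1})_{(0)}\big),$$ $n\circ_i\psi=0$ for $n\in N$. With $|n|:=n-1$: $\varphi\bar\circ\psi=(-1)^{|p||q|}\sum_{i=1}^p(-1)^{|q||i|}\varphi\circ_i\psi$, $\{\varphi,\psi\}=\varphi\bar\circ\psi-(-1)^{|p||q|}\psi\bar\circ\varphi$, and $(\varphi\smile\psi)(u^1,\dots,u^{p+q})=\varphi(u^1_{(1)},\dots,u^p_{(1)})\cdot_N\big(u^1_{(2)}\cdots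 u^p_{(2)}\psi(u^{p+1},\dots,u^{p+q})\big)$. **Gerstenhaber algebra.** A graded commutative $k$-algebra $V=\bigoplus_{p\ge0}V^p$ with a graded Lie bracket $V^{p+1}\otimes V^{q+1}\to V^{p+q+1}$ on $V[1]=\bigoplus_pV^{p+1}$ satisfying $\{\gamma,\alpha\smile\beta\}=\{\gamma,\alpha\}\smile\beta+(-1)^{pq}\alpha\smile\{\gamma,\beta\}$ for $\gamma\in V^{p+1},\alpha\in V^q$. *)

(* Defs.v *)
From HB Require Import structures.
From mathcomp Require Import all_boot all_order all_algebra.
From mathcomp Require Import boolp functions.

Set Implicit Arguments.
Unset Strict Implicit.
Unset Printing Implicit Defensive.

Import GRing.Theory.
Local Open Scope ring_scope.
Local Open Scope quotient_scope.

(* A formal sum [:: (c_1, x_1); ...; (c_n, x_n)] stands for c_1 x_1 + ... +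
   c_n x_n.  [presmod R] is the k-module generated by X subject to the
   relations s = t for R s t. *)
Section Presmod.
Variables (k : comNzRingType) (X : choiceType).
Implicit Types (s t : seq (k * X)) (c d : k).

Definition fscale c s := [seq (c * p.1, p.2) | p <- s].

Variable R : seq (k * X) -> seq (k * X) -> Prop.

Inductive pm_eq : seq (k * X) -> seq (k * X) -> Prop :=
| pm_eq_rel s t : R s t -> pm_eq s t
| pm_eq_add x c d : pm_eq [:: (c, x); (d, x)] [:: (c + d, x)]
| pm_eq_0 x : pm_eq [:: (0, x)] [::]
| pm_eq_comm s t : pm_eq (s ++ t) (t ++ s)
| pm_eq_cat s s' t t' : pm_eq s s' -> pm_eq t t' -> pm_eq (s ++ t) (s' ++ t')
| pm_eq_scale c s t : pm_eq s t -> pm_eq (fscale c s) (fscale c t)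
| pm_eq_refl s : pm_eq s s
| pm_eq_sym s t : pm_eq s t -> pm_eq t s
| pm_eq_trans s t r : pm_eq s t -> pm_eq t r -> pm_eq s r.

Definition pm_eqb s t := `[< pm_eq s t >].

Lemma pm_eqb_equiv : equiv_class_of pm_eqb.
Proof.
split=> [s|s t|t s r].
- by apply/asboolP/pm_eq_refl.
- by apply/asboolP/asboolP; apply: pm_eq_sym.
- by move=> /asboolP st /asboolP tr; apply/asboolP/(pm_eq_trans st tr).
Qed.

Canonical pm_eqb_rel := EquivRelPack pm_eqb_equiv.

Definition presmod : Type := {eq_quot pm_eqb}.
HB.instance Definition _ := Choice.on presmod.
HB.instance Definition _ := EqQuotient.on presmod.

Lemma pm_piP s t : reflect (pm_eq s t) (\pi_presmod s == \pi_presmod t).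
Proof. by rewrite eqmodE; apply: asboolP. Qed.

Lemma pm_repr s : pm_eq (repr (\pi_presmod s)) s.
Proof. by apply/pm_piP; rewrite reprK. Qed.

Lemma pmW (P : presmod -> Prop) :
  (forall s, P (\pi_presmod s)) -> forall x, P x.
Proof. by move=> H x; rewrite -[x]reprK. Qed.

Definition pm_zero : presmod := \pi_presmod [::].
Definition pm_add (x y : presmod) : presmod := \pi_presmod (repr x ++ repr y).
Definition pm_smul c (x : presmod) : presmod := \pi_presmod (fscale c (repr x)).
Definition pm_opp := pm_smul (-1).

Lemma fscale_cat c s t : fscale c (s ++ t) = fscale c s ++ fscale c t.
Proof. exact: map_cat. Qed.

Lemma pm_addE s t : pm_add (\pi_presmod s) (\pi_presmod t) = \pi_presmod (s ++ t).
Proof. by apply/eqP/pm_piP; apply: pm_eq_cat; apply: pm_repr. Qed.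

Lemma pm_smulE c s : pm_smul c (\pi_presmod s) = \pi_presmod (fscale c s).
Proof. by apply/eqP/pm_piP; apply: pm_eq_scale; apply: pm_repr. Qed.

Lemma pm_addA : associative pm_add.
Proof.
by move=> x y z; elim/pmW: x => x; elim/pmW: y => y; elim/pmW: z => z; rewrite !pm_addE catA.
Qed.

Lemma pm_addC : commutative pm_add.
Proof.
move=> x y; elim/pmW: x => x; elim/pmW: y => y; rewrite !pm_addE.
by apply/eqP/pm_piP/pm_eq_comm.
Qed.

Lemma pm_add0 : left_id pm_zero pm_add.
Proof. by move=> x; elim/pmW: x => x; rewrite pm_addE. Qed.

Lemma pm_eq_scaleD c d s : pm_eq (fscale (c + d) s) (fscale c s ++ fscale d s).
Proof.
elim: s => [|[e x] s IHs] /=; first exact: pm_eq_refl.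
rewrite mulrDl -cat1s -[(c * e, x) :: _]cat1s -[(d * e, x) :: _]cat1s.
apply: (@pm_eq_trans _ ([:: (c * e, x); (d * e, x)] ++ (fscale c s ++ fscale d s))).
  by apply: pm_eq_cat IHs; apply/pm_eq_sym/pm_eq_add.
rewrite -[[:: _; _]]/([:: (c * e, x)] ++ [:: (d * e, x)]) -!catA.
apply: pm_eq_cat; first exact: pm_eq_refl.
by rewrite !catA; apply: pm_eq_cat (pm_eq_refl _); apply: pm_eq_comm.
Qed.

Lemma pm_eq_scale0 s : pm_eq (fscale 0 s) [::].
Proof.
elim: s => [|[e x] s IHs] /=; first exact: pm_eq_refl.
rewrite mul0r -[[::]]/([::] ++ [::]) -cat1s.
by apply: pm_eq_cat IHs; apply: pm_eq_0.
Qed.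

Lemma fscale1 s : fscale 1 s = s.
Proof. by rewrite -[RHS]map_id; apply: eq_map => -[c x]; rewrite mul1r. Qed.

Lemma pm_addN : left_inverse pm_zero pm_opp pm_add.
Proof.
move=> s; elim/pmW: s => s; rewrite /pm_opp pm_smulE pm_addE; apply/eqP/pm_piP.
rewrite -[X in _ ++ X]fscale1.
apply: pm_eq_trans (pm_eq_scale0 s).
by rewrite -(addNr 1); apply/pm_eq_sym/pm_eq_scaleD.
Qed.

HB.instance Definition _ :=
  GRing.isZmodule.Build presmod pm_addA pm_addC pm_add0 pm_addN.

Lemma pm_smulA c d (x : presmod) : pm_smul c (pm_smul d x) = pm_smul (c * d) x.
Proof.
elim/pmW: x => s; rewrite !pm_smulE /fscale -map_comp.
by congr \pi_presmod; apply: eq_map => p /=; rewrite mulrA.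
Qed.

Lemma pm_smul1 : left_id 1 pm_smul.
Proof. by move=> s; elim/pmW: s => s; rewrite pm_smulE fscale1. Qed.

Lemma pm_smulDr : right_distributive pm_smul +%R.
Proof.
move=> c s t; elim/pmW: s => s; elim/pmW: t => t.
by rewrite -[LHS]/(pm_smul c (pm_add _ _)) -[RHS]/(pm_add _ _)
   !(pm_addE, pm_smulE) fscale_cat.
Qed.

Lemma pm_smulDl (x : presmod) : {morph pm_smul^~ x : c d / c + d}.
Proof.
elim/pmW: x => s c d; rewrite -[RHS]/(pm_add _ _) !pm_smulE pm_addE.
by apply/eqP/pm_piP/pm_eq_scaleD.
Qed.

HB.instance Definition _ := GRing.Zmodule_isLmodule.Build k presmod
  pm_smulA pm_smul1 pm_smulDr pm_smulDl.

Definition pm_gen (x : X) : presmod := \pi_presmod [:: (1, x)].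

Definition fsum (V : lmodType k) (f : X -> V) s : V :=
  \sum_(p <- s) p.1 *: f p.2.

(* [pm_sum f x] evaluates sum_i c_i f(x_i) on one chosen formal sum
   sum_i c_i x_i representing x; see [fsum_pm_eq] and [pm_sum_pi] for the
   independence of this choice when f respects the relations. *)
Definition pm_sum (V : lmodType k) (f : X -> V) (x : presmod) : V :=
  fsum f (repr x).

Lemma fsum_pm_eq (V : lmodType k) (f : X -> V) :
  (forall s t, R s t -> fsum f s = fsum f t) ->
  forall s t, pm_eq s t -> fsum f s = fsum f t.
Proof.
move=> fR s t; rewrite /fsum; elim=> {s t}.
- exact: fR.
- by move=> x c d; rewrite !big_cons !big_nil /= !addr0 scalerDl.
- by move=> x; rewrite big_cons !big_nil /= scale0r addr0.
- by move=> s t; rewrite !big_cat /= addrC.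
- by move=> s s' t t' _ e _ e'; rewrite !big_cat /= e e'.
- move=> c s t _ e; rewrite !big_map /=.
  under eq_bigr do rewrite -scalerA.
  under [RHS]eq_bigr do rewrite -scalerA.
  by rewrite -!scaler_sumr e.
- by [].
- by [].
- by move=> s t r _ -> _ ->.
Qed.

Lemma pm_sum_pi (V : lmodType k) (f : X -> V) :
  (forall s t, R s t -> fsum f s = fsum f t) ->
  forall s, pm_sum f (\pi_presmod s) = fsum f s.
Proof. by move=> fR s; apply: (fsum_pm_eq fR); apply: pm_repr. Qed.

Lemma pm_gen_sum (x : presmod) : x = pm_sum pm_gen x.
Proof.
rewrite /pm_sum -[LHS]reprK; elim: (repr x) => [|[c y] s IHs].
  by rewrite /fsum big_nil.
rewrite /fsum big_cons -/(fsum _ s) -IHs /= -[RHS]/(pm_add (pm_smul c _) _).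
by rewrite /pm_gen pm_smulE pm_addE /= mulr1.
Qed.

End Presmod.

(* [tens rM lN] is the tensor product over A of M, with right A-action rM,
   and N, with left A-action lN. *)
Section Tens.
Variables (k : comNzRingType) (A : Type) (M N : lmodType k).
Variables (rM : M -> A -> M) (lN : A -> N -> N).

Inductive tens_rel : seq (k * (M * N)) -> seq (k * (M * N)) -> Prop :=
| tens_relDl m m' n :
    tens_rel [:: (1, (m + m', n))] [:: (1, (m, n)); (1, (m', n))]
| tens_relDr m n n' :
    tens_rel [:: (1, (m, n + n'))] [:: (1, (m, n)); (1, (m, n'))]
| tens_relZl c m n : tens_rel [:: (1, (c *: m, n))] [:: (c, (m, n))]
| tens_relZr c m n : tens_rel [:: (1, (m, c *: n))] [:: (c, (m, n))]
| tens_rel_bal m a n : tens_rel [:: (1, (rM m a, n))] [:: (1, (m, lN a n))].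

Definition tens : lmodType k := presmod tens_rel.
Definition tensor (m : M) (n : N) : tens := pm_gen tens_rel (m, n).
Definition tens_sum (V : lmodType k) (x : tens) (F : M -> N -> V) : V :=
  pm_sum (fun mn => F mn.1 mn.2) x.

End Tens.

Arguments tensor {k A M N rM lN} m n.
Arguments tens_sum {k A M N rM lN V} x F.

(* Sweedler notation: if x = sum_i c_i (m_i ⊗ n_i) is the chosen
   representation of x, this is sum_i c_i E[m_i, n_i].  The expressions E used
   below are the Sweedler formulas of the theory of bialgebroids; that they do
   not depend on the representation is due to the axioms (e.g. to
   [Delta_takeuchi] in the case of [DeltaM]) and is not needed to state them. *)
Notation "\tsum_ ( m ; n <- x ) E" := (tens_sum x (fun m n => E))
  (at level 36, E at level 36, m, n, x at level 50,
   format "'[' \tsum_ ( m ;  n  <-  x ) '/  '  E ']'") : ring_scope.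

Section Resk.
Variables (k : comNzRingType) (U : algType k) (N : lmodType U).

Definition resk : Type := N.
HB.instance Definition _ := GRing.Zmodule.copy resk N.

Definition resk_scale (c : k) (n : resk) : resk := (c%:A : U) *: (n : N).

Lemma resk_scaleA c d n : resk_scale c (resk_scale d n) = resk_scale (c * d) n.
Proof. by rewrite /resk_scale scalerA -scalerAl mul1r scalerA. Qed.
Lemma resk_scale1 : left_id 1 resk_scale.
Proof. by move=> n; rewrite /resk_scale !scale1r. Qed.
Lemma resk_scaleDr : right_distributive resk_scale +%R.
Proof. by move=> c n m; rewrite /resk_scale -scalerDr. Qed.
Lemma resk_scaleDl n : {morph resk_scale^~ n : c d / c + d}.
Proof. by move=> c d; rewrite /resk_scale !scalerDl. Qed.

HB.instance Definition _ := GRing.Zmodule_isLmodule.Build k resk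
  resk_scaleA resk_scale1 resk_scaleDr resk_scaleDl.
End Resk.

(* A k-algebra map eta : A ⊗ A^op -> U, given by its restrictions
   s(a) = eta(a ⊗ 1) and t(a) = eta(1 ⊗ a). *)
Record aering (k : comNzRingType) (A U : algType k) := AeRing {
  src : {lrmorphism A -> U};
  tgt : {linear A -> U};
  tgt1 : tgt 1 = 1;
  tgtM : forall a b, tgt (a * b) = tgt b * tgt a;
  src_tgtC : forall a b, src a * tgt b = tgt b * src a }.

Section TensorOverA.
Variables (k : comNzRingType) (A U : algType k) (E : aering A U).

(* U_◁ ⊗_A N for a left A-module (N, lN) *)
Definition tensA (N : lmodType k) (lN : A -> N -> N) : lmodType k :=
  @tens k A U N (fun u a => tgt E a * u) lN.

(* the left A-module structure of U_◁ ⊗_A N, a(u ⊗ n) = s(a)u ⊗ n *)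
Definition tensA_lact N lN (a : A) (x : @tensA N lN) : @tensA N lN :=
  \tsum_(u ; n <- x) tensor (src E a * u) n.

Definition lactU (a : A) (u : U) : U := src E a * u.
Definition tensUU := tensA lactU.
Definition tensUUU := tensA (@tensA_lact U lactU).

Definition lactN (N : lmodType U) (a : A) (n : resk N) : resk N :=
  src E a *: (n : N).
Definition tensUN (N : lmodType U) := tensA (@lactN N).
Definition tensUUN (N : lmodType U) := tensA (@tensA_lact _ (@lactN N)).
End TensorOverA.

Record left_bialgebroid (k : comNzRingType) (A U : algType k) := LeftBialgebroid {
  lb_aering :> aering A U;
  Delta : {linear U -> tensUU lb_aering};
  eps : {linear U -> A};
  Delta_bimod : forall a b u,
    Delta (src lb_aering a * tgt lb_aering b * u) =
    \tsum_(u1 ; u2 <- Delta u)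
      tensor (src lb_aering a * u1) (tgt lb_aering b * u2);
  eps_bimod : forall a b u,
    eps (src lb_aering a * tgt lb_aering b * u) = a * eps u * b;
  Delta_coassoc : forall u,
    \tsum_(u1 ; u2 <- Delta u) \tsum_(u11 ; u12 <- Delta u1)
      tensor u11 (tensor u12 u2) =
    \tsum_(u1 ; u2 <- Delta u) tensor u1 (Delta u2)
    :> tensUUU lb_aering;
  Delta_counitl : forall u,
    \tsum_(u1 ; u2 <- Delta u) (src lb_aering (eps u1) * u2) = u;
  Delta_counitr : forall u,
    \tsum_(u1 ; u2 <- Delta u) (tgt lb_aering (eps u2) * u1) = u;
  Delta_takeuchi : forall u a,
    \tsum_(u1 ; u2 <- Delta u) tensor (u1 * tgt lb_aering a) u2 =
    \tsum_(u1 ; u2 <- Delta u) tensor u1 (u2 * src lb_aering a)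
    :> tensUU lb_aering;
  Delta1 : Delta 1 = tensor 1 1;
  DeltaM : forall u v,
    Delta (u * v) =
    \tsum_(u1 ; u2 <- Delta u) \tsum_(v1 ; v2 <- Delta v)
      tensor (u1 * v1) (u2 * v2);
  eps1 : eps 1 = 1;
  epsMs : forall u v, eps (u * v) = eps (u * src lb_aering (eps v));
  epsMt : forall u v, eps (u * v) = eps (u * tgt lb_aering (eps v)) }.

(* A with the left U-action ua = eps(u s(a)) *)
Definition base_mod (k : comNzRingType) (A U : algType k)
  (B : left_bialgebroid A U) : Type := A.

(* U_◁, i.e. U with the A^op-action a.u = t(a)u *)
Definition U_tri (k : comNzRingType) (A U : algType k)
  (B : left_bialgebroid A U) : Type := U.

Section BaseModules.
Variables (k : comNzRingType) (A U : algType k) (B : left_bialgebroid A U).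

Lemma eps_src a : eps B (src B a) = a.
Proof.
have := @eps_bimod _ _ _ B a 1 1.
by rewrite tgt1 !mulr1 eps1 mulr1.
Qed.

Local Notation base_mod := (base_mod B).
Local Notation U_tri := (U_tri B).

HB.instance Definition _ := GRing.Zmodule.copy base_mod A.
Definition base_scale (u : U) (a : base_mod) : base_mod := eps B (u * src B a).
Lemma base_scaleA u v a : base_scale u (base_scale v a) = base_scale (u * v) a.
Proof. by rewrite /base_scale -mulrA [RHS]epsMs. Qed.
Lemma base_scale1 : left_id 1 base_scale.
Proof. by move=> a; rewrite /base_scale mul1r eps_src. Qed.
Lemma base_scaleDr : right_distributive base_scale +%R.
Proof.
by move=> u a b; rewrite /base_scale [src B (a + b)]raddfD mulrDr raddfD.
Qed.
Lemma base_scaleDl a : {morph base_scale^~ a : u v / u + v}.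
Proof. by move=> u v; rewrite /base_scale mulrDl raddfD. Qed.
HB.instance Definition _ := GRing.Zmodule_isLmodule.Build U base_mod
  base_scaleA base_scale1 base_scaleDr base_scaleDl.

HB.instance Definition _ := GRing.Zmodule.copy U_tri U.
Definition U_tri_scale (a : A^c) (u : U_tri) : U_tri := tgt B (a : A) * (u : U).
Lemma U_tri_scaleA a b u : U_tri_scale a (U_tri_scale b u) = U_tri_scale (a * b) u.
Proof. by rewrite /U_tri_scale mulrA -tgtM. Qed.
Lemma U_tri_scale1 : left_id 1 U_tri_scale.
Proof. by move=> u; rewrite /U_tri_scale tgt1 mul1r. Qed.
Lemma U_tri_scaleDr : right_distributive U_tri_scale +%R.
Proof. by move=> a u v; rewrite /U_tri_scale -mulrDr. Qed.
Lemma U_tri_scaleDl u : {morph U_tri_scale^~ u : a b / a + b}.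
Proof. by move=> a b; rewrite /U_tri_scale [tgt B (a + b)]raddfD mulrDl. Qed.
HB.instance Definition _ := GRing.Zmodule_isLmodule.Build A^c U_tri
  U_tri_scaleA U_tri_scale1 U_tri_scaleDr U_tri_scaleDl.
End BaseModules.

(* N is a left U-module; the left A-module underlying its comodule structure
   is a ▷ n = s(a)n, so that only the two right A-actions are left to be
   identified ([yd_ract]). *)
Record yd_algebra (k : comNzRingType) (A U : algType k)
    (B : left_bialgebroid A U) (N : lmodType U) := YDAlgebra {
  coact : {linear resk N -> tensUN B N};
  coact_lact : forall a (n : N),
    coact (src B a *: n) =
    \tsum_(m ; n0 <- coact n) tensor (src B a * m) n0;
  coact_coassoc : forall n : N,
    \tsum_(m ; n0 <- coact n) \tsum_(m1 ; m2 <- Delta B m)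
      tensor m1 (tensor m2 n0) =
    \tsum_(m ; n0 <- coact n) tensor m (coact n0)
    :> tensUUN B N;
  coact_counit : forall n : N,
    \tsum_(m ; n0 <- coact n) (src B (eps B m) *: (n0 : N) : resk N) = n;
  yd_ract : forall (n : N) a,
    \tsum_(m ; n0 <- coact n)
      (src B (eps B (m * tgt B a)) *: (n0 : N) : resk N) = tgt B a *: n;
  yd_compat : forall u (n : N),
    \tsum_(u1 ; u2 <- Delta B u) \tsum_(m ; n0 <- coact (u1 *: n))
      tensor (m * u2) n0 =
    \tsum_(u1 ; u2 <- Delta B u) \tsum_(m ; n0 <- coact n)
      tensor (u1 * m) (u2 *: (n0 : N) : resk N)
    :> tensUN B N;
  ydmul : N -> N -> N;
  ydone : N;
  ydmulDl : forall n n' m, ydmul (n + n') m = ydmul n m + ydmul n' m;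
  ydmulDr : forall n m m', ydmul n (m + m') = ydmul n m + ydmul n m';
  ydmulA : associative ydmul;
  ydmul1l : left_id ydone ydmul;
  ydmul1r : right_id ydone ydmul;
  ydmul_lact : forall a n m, ydmul (src B a *: n) m = src B a *: ydmul n m;
  ydmul_ract : forall a n m, ydmul n (tgt B a *: m) = tgt B a *: ydmul n m;
  ydmul_bal : forall a n m, ydmul (tgt B a *: n) m = ydmul n (src B a *: m);
  yd_actM : forall u n m,
    u *: ydmul n m =
    \tsum_(u1 ; u2 <- Delta B u) (ydmul (u1 *: n) (u2 *: m) : resk N);
  yd_act1l : forall u, u *: ydone = src B (eps B u) *: ydone;
  yd_act1r : forall u, u *: ydone = tgt B (eps B u) *: ydone;
  coact1 : coact ydone = tensor 1 (ydone : resk N);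
  coactM : forall n n' : N,
    coact (ydmul n n') =
    \tsum_(m ; n0 <- coact n) \tsum_(m' ; n0' <- coact n')
      tensor (m * m') (ydmul n0 n0' : resk N) }.

Definition braided_commutative (k : comNzRingType) (A U : algType k)
    (B : left_bialgebroid A U) (N : lmodType U) (Y : yd_algebra B N) :=
  forall n n' : N,
    ydmul Y n n' =
    \tsum_(m ; n0 <- coact Y n) (ydmul Y (m *: n') n0 : resk N).

Record submodule (k : comNzRingType) (V : lmodType k) := Submodule {
  sm_pred :> V -> Prop;
  sm_0 : sm_pred 0;
  sm_lin : forall c x y, sm_pred x -> sm_pred y -> sm_pred (c *: x + y) }.

(* Z / (Z ∩ B) for submodules Z and B of V *)
Section Subquotient.
Variables (k : comNzRingType) (V : lmodType k) (Z B : submodule V).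

Definition sqZ : Type := {x : V | Z x}.
HB.instance Definition _ := gen_eqMixin sqZ.
HB.instance Definition _ := gen_choiceMixin sqZ.

Lemma sqZ_inj (x y : sqZ) : sval x = sval y -> x = y.
Proof.
by case: x y => [x hx] [y hy] /= e; subst y; rewrite (Prop_irrelevance hx hy).
Qed.

Definition sq_eq (x y : sqZ) := `[< B (sval x - sval y) >].

Lemma sm_scale (S : submodule V) c x : S x -> S (c *: x).
Proof. by move=> Sx; rewrite -[_ *: _]addr0; apply/sm_lin/sm_0. Qed.
Lemma sm_add (S : submodule V) x y : S x -> S y -> S (x + y).
Proof. by move=> Sx Sy; rewrite -[x]scale1r; apply: sm_lin. Qed.
Lemma sm_opp (S : submodule V) x : S x -> S (- x).
Proof. by move=> Sx; rewrite -scaleN1r; apply: sm_scale. Qed.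

Lemma sq_eq_equiv : equiv_class_of sq_eq.
Proof.
split=> [x|x y|y x z].
- by apply/asboolP; rewrite subrr; apply: sm_0.
- by apply/asboolP/asboolP => /(@sm_opp _ _); rewrite opprB.
- move=> /asboolP xy /asboolP yz; apply/asboolP.
  by have := sm_add xy yz; rewrite addrA subrK.
Qed.

Canonical sq_eq_rel := EquivRelPack sq_eq_equiv.

Definition subquotient : Type := {eq_quot sq_eq}.
HB.instance Definition _ := Choice.on subquotient.
HB.instance Definition _ := EqQuotient.on subquotient.

Definition sq_class (x : V) (hx : Z x) : subquotient := \pi_subquotient (exist _ x hx : sqZ).

Definition sq_rep (h : subquotient) : V := sval (repr h : sqZ).

Lemma sq_repZ h : Z (sq_rep h). Proof. exact: svalP (repr h : sqZ). Qed.

Lemma sq_classP x y (hx : Z x) (hy : Z y) :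
  sq_class hx = sq_class hy <-> B (x - y).
Proof.
split=> [/eqP|Bxy]; last by apply/eqP; rewrite eqmodE; apply/asboolP.
by rewrite eqmodE => /asboolP.
Qed.

Lemma sq_repK h : sq_class (sq_repZ h) = h.
Proof.
by rewrite -[RHS]reprK /sq_class; congr \pi; apply: sqZ_inj.
Qed.

Lemma sq_classK x (hx : Z x) : B (sq_rep (sq_class hx) - x).
Proof. by rewrite -(sq_classP (sq_repZ _) hx) sq_repK. Qed.

Lemma sqW (P : subquotient -> Prop) :
  (forall x (hx : Z x), P (sq_class hx)) -> forall h, P h.
Proof. by move=> H h; rewrite -(sq_repK h). Qed.

Definition sq_add h h' := sq_class (sm_add (sq_repZ h) (sq_repZ h')).
Definition sq_scale c h := sq_class (sm_scale c (sq_repZ h)).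
Definition sq_zero := sq_class (sm_0 Z).
Definition sq_opp := sq_scale (-1).

Lemma sq_addE x y (hx : Z x) (hy : Z y) :
  sq_add (sq_class hx) (sq_class hy) = sq_class (sm_add hx hy).
Proof.
by apply/sq_classP; rewrite opprD addrACA; apply: sm_add; apply: sq_classK.
Qed.

Lemma sq_scaleE c x (hx : Z x) :
  sq_scale c (sq_class hx) = sq_class (sm_scale c hx).
Proof. by apply/sq_classP; rewrite -scalerBr; apply/sm_scale/sq_classK. Qed.

Lemma sq_class_eq x y (hx : Z x) (hy : Z y) : x = y -> sq_class hx = sq_class hy.
Proof. by move=> e; apply/sq_classP; rewrite e subrr; apply: sm_0. Qed.

Lemma sq_addA : associative sq_add.
Proof.
move=> x y z; elim/sqW: x => x hx; elim/sqW: y => y hy; elim/sqW: z => z hz; rewrite !sq_addE.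
exact/sq_class_eq/addrA.
Qed.
Lemma sq_addC : commutative sq_add.
Proof.
by move=> x y; elim/sqW: x => x hx; elim/sqW: y => y hy; rewrite !sq_addE; apply/sq_class_eq/addrC.
Qed.
Lemma sq_add0 : left_id sq_zero sq_add.
Proof. by move=> x; elim/sqW: x => x hx; rewrite sq_addE; apply/sq_class_eq/add0r. Qed.
Lemma sq_addN : left_inverse sq_zero sq_opp sq_add.
Proof.
move=> x; elim/sqW: x => x hx; rewrite /sq_opp sq_scaleE sq_addE; apply: sq_class_eq.
by rewrite scaleN1r addNr.
Qed.

HB.instance Definition _ :=
  GRing.isZmodule.Build subquotient sq_addA sq_addC sq_add0 sq_addN.

Lemma sq_scaleA c d h : sq_scale c (sq_scale d h) = sq_scale (c * d) h.
Proof. by elim/sqW: h => x hx; rewrite !sq_scaleE; apply/sq_class_eq/scalerA. Qed.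
Lemma sq_scale1 : left_id 1 sq_scale.
Proof. by move=> x; elim/sqW: x => x hx; rewrite sq_scaleE; apply/sq_class_eq/scale1r. Qed.
Lemma sq_scaleDr : right_distributive sq_scale +%R.
Proof.
move=> c x y; elim/sqW: x => x hx; elim/sqW: y => y hy.
rewrite -[LHS]/(sq_scale c (sq_add _ _)) -[RHS]/(sq_add _ _).
rewrite !(sq_addE, sq_scaleE).
exact/sq_class_eq/scalerDr.
Qed.
Lemma sq_scaleDl h : {morph sq_scale^~ h : c d / c + d}.
Proof.
elim/sqW: h => x hx c d; rewrite -[RHS]/(sq_add _ _) !(sq_addE, sq_scaleE).
exact/sq_class_eq/scalerDl.
Qed.

HB.instance Definition _ := GRing.Zmodule_isLmodule.Build k subquotient
  sq_scaleA sq_scale1 sq_scaleDr sq_scaleDl.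
End Subquotient.

Section DirectSum.
Variables (k : comNzRingType) (V : nat -> lmodType k).

Definition dsum : Type :=
  {f : forall p, V p | exists n, forall p, (n <= p)%N -> f p = 0}.
HB.instance Definition _ := gen_eqMixin dsum.
HB.instance Definition _ := gen_choiceMixin dsum.

Lemma dsumP (f g : dsum) : (forall p, sval f p = sval g p) -> f = g.
Proof.
case: f g => [f hf] [g hg] /= e.
have {}e : f = g by apply: functional_extensionality_dep.
by subst g; rewrite (Prop_irrelevance hf hg).
Qed.

Definition dsum_zero : dsum.
Proof. by exists (fun p => 0); exists 0%N. Defined.

Definition dsum_add (f g : dsum) : dsum.
Proof.
exists (fun p => sval f p + sval g p).
case: f g => [f [n fn]] [g [m gm]] /=; exists (maxn n m) => p.
by rewrite geq_max => /andP[/fn-> /gm->]; rewrite addr0.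
Defined.

Definition dsum_scale (c : k) (f : dsum) : dsum.
Proof.
exists (fun p => c *: sval f p).
by case: f => [f [n fn]] /=; exists n => p /fn ->; rewrite scaler0.
Defined.

Definition dsum_opp := dsum_scale (-1).

Lemma dsum_addA : associative dsum_add.
Proof. by move=> f g h; apply: dsumP => p /=; rewrite addrA. Qed.
Lemma dsum_addC : commutative dsum_add.
Proof. by move=> f g; apply: dsumP => p /=; rewrite addrC. Qed.
Lemma dsum_add0 : left_id dsum_zero dsum_add.
Proof. by move=> f; apply: dsumP => p /=; rewrite add0r. Qed.
Lemma dsum_addN : left_inverse dsum_zero dsum_opp dsum_add.
Proof. by move=> f; apply: dsumP => p /=; rewrite scaleN1r addNr. Qed.
HB.instance Definition _ :=
  GRing.isZmodule.Build dsum dsum_addA dsum_addC dsum_add0 dsum_addN.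

Lemma dsum_scaleA c d f : dsum_scale c (dsum_scale d f) = dsum_scale (c * d) f.
Proof. by apply: dsumP => p /=; rewrite scalerA. Qed.
Lemma dsum_scale1 : left_id 1 dsum_scale.
Proof. by move=> f; apply: dsumP => p /=; rewrite scale1r. Qed.
Lemma dsum_scaleDr : right_distributive dsum_scale +%R.
Proof. by move=> c f g; apply: dsumP => p /=; rewrite scalerDr. Qed.
Lemma dsum_scaleDl f : {morph dsum_scale^~ f : c d / c + d}.
Proof. by move=> c d; apply: dsumP => p /=; rewrite scalerDl. Qed.
HB.instance Definition _ := GRing.Zmodule_isLmodule.Build k dsum
  dsum_scaleA dsum_scale1 dsum_scaleDr dsum_scaleDl.

Definition dinj_fun p (x : V p) : forall q, V q := fun q =>
  if @eqP _ p q is ReflectT e then ecast q (V q) e x else 0.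

Definition dinj p (x : V p) : dsum.
Proof.
exists (dinj_fun x); exists p.+1 => q ltpq; rewrite /dinj_fun.
by case: eqP => // e; exfalso; move: ltpq; rewrite e ltnn.
Defined.

Lemma dinj_funE p (x : V p) : dinj_fun x p = x.
Proof. by rewrite /dinj_fun; case: eqP => // e; rewrite eq_axiomK. Qed.

Lemma dinj_fun0 p q (x : V p) : p <> q -> dinj_fun x q = 0.
Proof. by rewrite /dinj_fun; case: eqP. Qed.
End DirectSum.

(* Elements of V p have degree |x| = p - 1 in V[1], with V p = 0 for p < 0;
   parities are computed with p + 1 in place of p - 1. *)
Record gerstenhaber (k : comNzRingType) (V : nat -> lmodType k) := Gerstenhaber {
  g_cup : dsum V -> dsum V -> dsum V;
  g_one : V 0%N;
  g_br : dsum V -> dsum V -> dsum V;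
  g_cup_linl : forall y, linear (g_cup^~ y);
  g_cup_linr : forall x, linear (g_cup x);
  g_cup_deg : forall p q (x : V p) (y : V q),
    exists z : V (p + q)%N, g_cup (dinj x) (dinj y) = dinj z;
  g_cupA : associative g_cup;
  g_cup1l : left_id (dinj g_one) g_cup;
  g_cup1r : right_id (dinj g_one) g_cup;
  g_cupC : forall p q (x : V p) (y : V q),
    g_cup (dinj x) (dinj y) = (-1) ^+ (p * q) *: g_cup (dinj y) (dinj x);
  g_br_linl : forall y, linear (g_br^~ y);
  g_br_linr : forall x, linear (g_br x);
  g_br_deg : forall p q r (x : V p) (y : V q), (p + q)%N = r.+1 ->
    exists z : V r, g_br (dinj x) (dinj y) = dinj z;
  g_br_deg0 : forall x y : V 0%N, g_br (dinj x) (dinj y) = 0;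
  g_brC : forall p q (x : V p) (y : V q),
    g_br (dinj x) (dinj y) =
    - ((-1) ^+ (p.+1 * q.+1) *: g_br (dinj y) (dinj x));
  g_jacobi : forall p q r (x : V p) (y : V q) (z : V r),
    g_br (dinj x) (g_br (dinj y) (dinj z)) =
    g_br (g_br (dinj x) (dinj y)) (dinj z) +
    (-1) ^+ (p.+1 * q.+1) *: g_br (dinj y) (g_br (dinj x) (dinj z));
  g_leibniz : forall p q r (c : V p) (a : V q) (b : V r),
    g_br (dinj c) (g_cup (dinj a) (dinj b)) =
    g_cup (g_br (dinj c) (dinj a)) (dinj b) +
    (-1) ^+ (p.+1 * q) *: g_cup (dinj a) (g_br (dinj c) (dinj b)) }.

Definition dsum_map (k : comNzRingType) (V W : nat -> lmodType k)
  (f : forall p, {linear V p -> W p}) (x : dsum V) : dsum W.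
Proof.
exists (fun p => f p (sval x p)).
by case: x => [x [n xn]] /=; exists n => p /xn ->; rewrite linear0.
Defined.

Definition gerstenhaber_iso (k : comNzRingType) (V W : nat -> lmodType k)
    (GV : gerstenhaber V) (GW : gerstenhaber W)
    (f : forall p, {linear V p -> W p}) :=
  [/\ forall p, bijective (f p),
      f 0%N (g_one GV) = g_one GW,
      forall x y, dsum_map f (g_cup GV x y) =
                  g_cup GW (dsum_map f x) (dsum_map f y) &
      forall x y, dsum_map f (g_br GV x y) =
                  g_br GW (dsum_map f x) (dsum_map f y)].

Section Complex.
Variables (k : comNzRingType) (A U : algType k) (B : left_bialgebroid A U).
Local Notation s := (src B).
Local Notation t := (tgt B).

(* the first p entries of l, padded with 0; only used when size l = p *)
Definition tup p (l : seq U) : p.-tuple U := [tuple l`_i | i < p].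

(* the p-fold tensor product of U over A^op, where u t(a) ⊗ v = u ⊗ t(a) v *)
Inductive tpow_rel p : seq (k * p.-tuple U) -> seq (k * p.-tuple U) -> Prop :=
| tpow_relD l u v r : (size l + size r).+1 = p ->
    tpow_rel [:: (1, tup p (l ++ (u + v) :: r))]
             [:: (1, tup p (l ++ u :: r)); (1, tup p (l ++ v :: r))]
| tpow_relZ l c u r : (size l + size r).+1 = p ->
    tpow_rel [:: (1, tup p (l ++ (c *: u) :: r))] [:: (c, tup p (l ++ u :: r))]
| tpow_rel_bal l u a v r : (size l + size r).+2 = p ->
    tpow_rel [:: (1, tup p (l ++ (u * t a) :: v :: r))]
             [:: (1, tup p (l ++ u :: (t a * v) :: r))].

Definition tpow p : lmodType k := presmod (@tpow_rel p).

Variables (N : lmodType U) (Y : yd_algebra B N).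

(* C^p(U, N) is the set of the f : precochain p such that [cochain p f].  For
   p = 0, [tpow 0] is free of rank one on the empty tensor, which identifies f
   with an element of N. *)
Definition precochain p : lmodType k := tpow p -> resk N.

Definition ev p (f : precochain p) (us : seq U) : N :=
  f (pm_gen (@tpow_rel p) (tup p us)).

Definition cochain p (f : precochain p) :=
  linear f /\
  forall a u us, (size us).+1 = p ->
    ev f (t a * u :: us) = t a *: ev f (u :: us).

Definition cobd p (f : precochain p) (us : seq U) : N :=
  if p is 0 then us`_0 *: ev f [::] - t (eps B us`_0) *: ev f [::] else
  us`_0 *: ev f (behead us)
  + \sum_(i < p) (-1) ^+ i.+1 *:
      ev f (take i us ++ us`_i * us`_i.+1 :: drop i.+2 us)
  + (-1) ^+ p.+1 *:
      ev f (rcons (take p.-1 us) (us`_p.-1 * t (eps B us`_p))).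

Definition is_cocycle p (f : precochain p) :=
  cochain f /\ forall us, size us = p.+1 -> cobd f us = 0.

Definition is_coboundary p : precochain p -> Prop :=
  if p is q.+1 then fun f => cochain f /\
    exists g : precochain q, cochain g /\
      forall us, size us = q.+1 -> ev f us = cobd g us
  else fun f => f = 0.

Lemma ev_lin p c (f g : precochain p) us :
  ev (c *: f + g) us = (c%:A : U) *: ev f us + ev g us.
Proof. by []. Qed.

Lemma kU_comm (c : k) (u : U) : c%:A * u = u * c%:A.
Proof. by rewrite -scalerAl mul1r -scalerAr mulr1. Qed.

Lemma cobd_lin p c (f g : precochain p) us :
  cobd (c *: f + g) us = (c%:A : U) *: cobd f us + cobd g us.
Proof.
have cC (u : U) (n : N) : u *: ((c%:A : U) *: n) = (c%:A : U) *: (u *: n).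
  by rewrite !scalerA kU_comm.
have E (u : U) us' : u *: ev (c *: f + g) us' =
    (c%:A : U) *: (u *: ev f us') + u *: ev g us'.
  by rewrite ev_lin scalerDr cC.
rewrite /cobd; case: p f g E => [|p] f g E.
  by rewrite !E scalerBr opprD addrACA.
under eq_bigr do rewrite E.
by rewrite !E big_split /= -scaler_sumr !scalerDr [RHS]addrACA; congr (_ + _);
   rewrite addrACA.
Qed.

Lemma cochain0 p : cochain (0 : precochain p).
Proof.
split=> [c x y|a u us _]; first by rewrite /0 /= scaler0 addr0.
by rewrite /ev /= scaler0.
Qed.

Lemma cochain_lin p c (f g : precochain p) :
  cochain f -> cochain g -> cochain (c *: f + g).
Proof.
move=> [fl ft] [gl gt]; split=> [d x y|a u us e].
  rewrite -[LHS]/(c *: f (d *: x + y) + g (d *: x + y)).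
  rewrite -[X in _ = _ *: X + _]/(c *: f x + g x).
  rewrite -[X in _ = _ + X]/(c *: f y + g y).
  rewrite fl gl !scalerDr !scalerA mulrC.
  by rewrite addrACA.
by rewrite !ev_lin ft // gt // scalerDr !scalerA kU_comm.
Qed.

Lemma cobd0 p us : cobd (0 : precochain p) us = 0.
Proof.
have := cobd_lin (-1) (0 : precochain p) 0 us.
by rewrite scaler0 addr0 scaleNr scale1r scaleN1r addNr.
Qed.

Lemma cocycle0 p : is_cocycle (0 : precochain p).
Proof. by split; [apply: cochain0 | move=> us _; apply: cobd0]. Qed.

Lemma cocycle_lin p c (f g : precochain p) :
  is_cocycle f -> is_cocycle g -> is_cocycle (c *: f + g).
Proof.
move=> [fC f0] [gC g0]; split=> [|us e]; first exact: cochain_lin.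
by rewrite cobd_lin f0 // g0 // scaler0 addr0.
Qed.

Lemma coboundary0 p : is_coboundary (0 : precochain p).
Proof.
case: p => //= p; split; first exact: cochain0.
by exists 0; split=> [|us _]; [apply: cochain0 | rewrite cobd0].
Qed.

Lemma coboundary_lin p c (f g : precochain p) :
  is_coboundary f -> is_coboundary g -> is_coboundary (c *: f + g).
Proof.
case: p f g => [f g -> ->|p f g [fC [f' [f'C fE]]] [gC [g' [g'C gE]]]] /=.
  by rewrite scaler0 addr0.
split; first exact: cochain_lin.
exists (c *: f' + g'); split=> [|us e]; first exact: cochain_lin.
by rewrite ev_lin cobd_lin fE // gE.
Qed.

Definition cocycles p : submodule (precochain p) :=
  Submodule (@cocycle0 p) (@cocycle_lin p).
Definition coboundaries p : submodule (precochain p) :=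
  Submodule (@coboundary0 p) (@coboundary_lin p).

Definition HUN p : lmodType k := subquotient (cocycles p) (coboundaries p).
Definition HUN_class p (f : precochain p) (hf : is_cocycle f) : HUN p :=
  @sq_class k (precochain p) (cocycles p) (coboundaries p) f hf.

(* The operations below are given on sequences of arguments; those of cochains
   of degrees p and q are meaningful on sequences of length p + q for [cup]
   and p + q - 1 for [circ], [barcirc] and [bracket]. *)

(* the formal sum u^1_(1), ..., u^n_(1) ⊗ u^1_(2) ... u^n_(2) *)
Fixpoint sw_seq (us : seq U) : seq (k * (seq U * U)) :=
  if us is u :: us' then
    [seq (c.1 * d.1, (c.2.1 :: d.2.1, c.2.2 * d.2.2))
       | c <- repr (Delta B u), d <- sw_seq us']
  else [:: (1, ([::], 1))].

Definition sw_sum (V : lmodType k) (us : seq U) (F : seq U -> U -> V) : V :=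
  fsum (fun x => F x.1 x.2) (sw_seq us).

Definition Dmap q (g : precochain q) (us : seq U) : tensUN B N :=
  sw_sum us (fun us1 w =>
    \tsum_(m ; n <- coact Y (ev g us1)) tensor (m * w) n).

(* f ∘_i g, with i = j + 1 *)
Definition circ p q (f : precochain p) (j : nat) (g : precochain q)
    (us : seq U) : N :=
  sw_sum (take j us) (fun us1 w =>
    \tsum_(m ; n <- Dmap g (take q (drop j us)))
      (ydmul Y (ev f (us1 ++ m :: drop (j + q) us)) (w *: (n : N)) : resk N)).

Definition barcirc p q (f : precochain p) (g : precochain q) (us : seq U) : N :=
  (-1) ^+ (p.+1 * q.+1) *: \sum_(j < p) (-1) ^+ (q.+1 * j) *: circ f j g us.

Definition bracket p q (f : precochain p) (g : precochain q) (us : seq U) : N :=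
  barcirc f g us - (-1) ^+ (p.+1 * q.+1) *: barcirc g f us.

Definition cup p q (f : precochain p) (g : precochain q) (us : seq U) : N :=
  sw_sum (take p us) (fun us1 w =>
    ydmul Y (ev f us1) (w *: ev g (drop p us)) : resk N).

(* The operations of G are those induced by [cup] and [bracket]: the cup
   product and the bracket of two cocycles are again cocycles, and they
   represent the cup product and the bracket of the classes. *)
Definition induced_by_cup (G : gerstenhaber HUN) :=
  forall p q (f : precochain p) (g : precochain q)
    (hf : is_cocycle f) (hg : is_cocycle g),
  exists (h : precochain (p + q)) (hh : is_cocycle h),
    (forall us, size us = (p + q)%N -> ev h us = cup f g us) /\
    g_cup G (dinj (HUN_class hf)) (dinj (HUN_class hg)) = dinj (HUN_class hh).

Definition induced_by_bracket (G : gerstenhaber HUN) :=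
  forall p q r (f : precochain p) (g : precochain q)
    (hf : is_cocycle f) (hg : is_cocycle g), (p + q)%N = r.+1 ->
  exists (h : precochain r) (hh : is_cocycle h),
    (forall us, size us = r -> ev h us = bracket f g us) /\
    g_br G (dinj (HUN_class hf)) (dinj (HUN_class hg)) = dinj (HUN_class hh).

End Complex.

Definition projective (R : pzRingType) (P : lmodType R) :=
  forall (M M' : lmodType R) (g : {linear M -> M'}) (f : {linear P -> M'}),
    (forall y, exists x, g x = y) ->
    exists h : {linear P -> M}, forall x, g (h x) = f x.

Record proj_resolution (R : pzRingType) (M : lmodType R) := ProjResolution {
  pr_mod :> nat -> lmodType R;
  pr_d : forall n, {linear pr_mod n.+1 -> pr_mod n};
  pr_aug : {linear pr_mod 0%N -> M};
  pr_projective : forall n, projective (pr_mod n);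
  pr_aug_surj : forall y, exists x, pr_aug x = y;
  pr_exact0 : forall x, pr_aug x = 0 <-> exists y, pr_d 0 y = x;
  pr_exact : forall n x, pr_d n x = 0 <-> exists y, pr_d n.+1 y = x }.

Section Ext.
Variables (k : comNzRingType) (U : algType k) (M N : lmodType U).
Variable P : proj_resolution M.

Definition prehom p : lmodType k := P p -> resk N.
Definition is_Uhom p (f : prehom p) := linear (f : P p -> N).

Definition ext_cocycle p (f : prehom p) :=
  is_Uhom f /\ forall x, f (pr_d P p x) = 0.

Definition ext_coboundary p : prehom p -> Prop :=
  if p is q.+1 then fun f =>
    exists g : prehom q, is_Uhom g /\ forall x, f x = g (pr_d P q x)
  else fun f => f = 0.

Lemma Uhom0 p : is_Uhom (0 : prehom p).
Proof. by move=> u x y; rewrite /0 /= scaler0 addr0. Qed.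

Lemma Uhom_lin p c (f g : prehom p) :
  is_Uhom f -> is_Uhom g -> is_Uhom (c *: f + g).
Proof.
move=> fl gl u x y.
rewrite -[LHS]/((c%:A : U) *: (f (u *: x + y) : N) + g (u *: x + y)).
rewrite -[X in _ = _ *: X + _]/((c%:A : U) *: (f x : N) + g x).
rewrite -[X in _ = _ + X]/((c%:A : U) *: (f y : N) + g y).
by rewrite fl gl !scalerDr !scalerA kU_comm addrACA.
Qed.

Lemma ext_cocycle0 p : ext_cocycle (0 : prehom p).
Proof. by split; first exact: Uhom0. Qed.

Lemma ext_cocycle_lin p c (f g : prehom p) :
  ext_cocycle f -> ext_cocycle g -> ext_cocycle (c *: f + g).
Proof.
move=> [fl f0] [gl g0]; split=> [|x]; first exact: Uhom_lin.
by rewrite -[LHS]/(c *: f (pr_d P p x) + g (pr_d P p x)) f0 g0 scaler0 addr0.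
Qed.

Lemma ext_coboundary0 p : ext_coboundary (0 : prehom p).
Proof. by case: p => //= p; exists 0; split=> //; apply: Uhom0. Qed.

Lemma ext_coboundary_lin p c (f g : prehom p) :
  ext_coboundary f -> ext_coboundary g -> ext_coboundary (c *: f + g).
Proof.
case: p f g => [f g -> ->|p f g [f' [f'l fE]] [g' [g'l gE]]] /=.
  by rewrite scaler0 addr0.
exists (c *: f' + g'); split=> [|x]; first exact: Uhom_lin.
by rewrite -[LHS]/(c *: f x + g x) fE gE.
Qed.

Definition ext_cocycles p : submodule (prehom p) :=
  Submodule (@ext_cocycle0 p) (@ext_cocycle_lin p).
Definition ext_coboundaries p : submodule (prehom p) :=
  Submodule (@ext_coboundary0 p) (@ext_coboundary_lin p).

Definition Ext p : lmodType k :=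
  subquotient (ext_cocycles p) (ext_coboundaries p).
Definition Ext_class p (f : prehom p) (hf : ext_cocycle f) : Ext p :=
  @sq_class k (prehom p) (ext_cocycles p) (ext_coboundaries p) f hf.
End Ext.

Section ExtComparison.
Variables (k : comNzRingType) (A U : algType k) (B : left_bialgebroid A U).
Variables (N : lmodType U) (P : proj_resolution (base_mod B)).

(* A chain map over the identity of A from the bar resolution
   U ⊗ U^{⊗ p} (tensor products over A^op) to P; the U-linear maps out of
   U ⊗ U^{⊗ p} are given by their restrictions c p to 1 ⊗ U^{⊗ p}. *)
Definition bar_comparison (c : forall p, precochain B (P p) p) :=
  [/\ forall p, cochain (c p),
      pr_aug P (ev (c 0%N) [::]) = (1 : A) &
      forall p us, size us = p.+1 ->
        pr_d P p (ev (c p.+1) us) = cobd (c p) us].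

(* th is the map induced by f |-> f \o c for such a chain map c *)
Definition induced_by_comparison
    (th : forall p, {linear Ext N P p -> HUN B N p}) :=
  exists c : forall p, precochain B (P p) p, bar_comparison c /\
    forall p (f : prehom N P p) (hf : ext_cocycle f),
    exists hh : is_cocycle (fun x => f (c p x) : resk N),
      th p (Ext_class hf) = HUN_class hh.
End ExtComparison.

(* Main.v *)
(* The cochains on U with values in N, with the operations f ∘_i g, form a
   nonsymmetric operad with multiplication mu(u, v) = eps(u v) 1_N.  The Sweedler
   calculus reduces the sequential composition axiom to the coassociativity of
   the coaction and the Yetter-Drinfel'd condition; the parallel one is where
   braided commutativity is needed, since two disjoint insertions produce two
   values in N which have to be exchanged.  In any such operad, the pre-Lie
   identity gives the Jacobi identity, f ∘ g bounds the commutator of the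
   cocycles f and g for the cup product, and the second order brace h{f, g}
   bounds the failure of the Leibniz rule.

   For Ext, the bar construction U ⊗ U^{⊗ p} (over A^op) has a contracting
   homotopy, and it is projective because U-linear maps out of it are multilinear
   maps that can be lifted along a surjection one argument at a time, through
   Hom over A^op out of U_◁.  So it is a projective resolution of A that computes
   H(U, N), and the comparison theorem transports the structure to Ext. *)

(* The notation [\tsum] evaluates a summand on one chosen formal sum, so a Sweedler formula can be
   manipulated only once its summand is known to be balanced. This shapes the first half: for each
   pattern of arguments a predicate ([balanced], [balanced3], [mbal], [admissible], [admissible3])
   names the tensor product through which a summand factors, and the Takeuchi condition carries
   these predicates through iterated coproducts. The matching properties of the coaction are not
   axioms; they follow from the equality of the two right actions of [A] on [N]. For the operad,
   cochains become functions on all sequences, extended by zero. All arities then share one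
   [k]-module, and arities such as [(p + q).-1] need no casts. The price is truncated subtraction:
   where an arity 0 would spoil a degree or a sign, the operation concerned is an empty sum, and
   such cases are split off by hand. In the abstract operad the differential is the bracket with
   [mu], and the pre-Lie and brace identities are proved for sums over an interval of slots, a form
   that allows induction on its length. *)
From HB Require Import structures.
Require Import Defs.
From mathcomp Require Import all_boot all_algebra.
From mathcomp Require Import boolp functions.
From mathcomp Require Import zify ring.

Set Implicit Arguments.
Unset Strict Implicit.
Unset Printing Implicit Defensive.

Import GRing.Theory.
Local Open Scope ring_scope.
Local Open Scope quotient_scope.

(** * Formal sums and tensor products *)

Section FormalSums.
Variables (k : comNzRingType).
Implicit Types V W : lmodType k.

Lemma lin0 V W (F : V -> W) : linear F -> F 0 = 0.
Proof.
move=> /(_ (-1) 0 0); rewrite scaler0 addr0 => F0.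
by rewrite F0 scaleN1r addNr.
Qed.

Lemma linD V W (F : V -> W) : linear F -> {morph F : x y / x + y}.
Proof. by move=> Fl x y; rewrite -[x in LHS]scale1r Fl scale1r. Qed.

Lemma linZ V W (F : V -> W) : linear F -> forall c, {morph F : x / c *: x}.
Proof. by move=> Fl c x; rewrite -[c *: x in LHS]addr0 Fl (lin0 Fl) addr0. Qed.

Lemma lin_id V : linear (fun x : V => x). Proof. by []. Qed.

Lemma lin_comp V W V' (F : V -> W) (G : V' -> V) :
  linear F -> linear G -> linear (fun x => F (G x)).
Proof. by move=> Fl Gl c x y; rewrite Gl Fl. Qed.

Lemma lin_sum V W (F : V -> W) I (r : seq I) (G : I -> V) :
  linear F -> F (\sum_(i <- r) G i) = \sum_(i <- r) F (G i).
Proof. by move=> Fl; apply: big_morph => [x y|]; [apply: linD|apply: lin0]. Qed.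

Lemma lin_fsum (X : choiceType) V W (F : V -> W) (f : X -> V) s :
  linear F -> F (fsum f s) = fsum (fun x => F (f x)) s.
Proof.
by move=> Fl; rewrite /fsum lin_sum //; apply: eq_bigr => p _; rewrite (linZ Fl).
Qed.

Lemma fsum_family (X : choiceType) V W (F : X -> V -> W) s :
  (forall x, linear (F x)) -> linear (fun v => fsum (F^~ v) s).
Proof.
move=> Fl c v w; rewrite /fsum scaler_sumr -big_split; apply: eq_bigr => p _ /=.
by rewrite Fl scalerDr !scalerA mulrC.
Qed.

Lemma fsum_exchange (X Y : choiceType) V (F : X -> Y -> V) s t :
  fsum (fun x => fsum (F x) t) s = fsum (fun y => fsum (F^~ y) s) t.
Proof.
rewrite /fsum; under eq_bigr do rewrite scaler_sumr.
rewrite exchange_big; apply: eq_bigr => p _; rewrite scaler_sumr.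
by apply: eq_bigr => q _; rewrite !scalerA mulrC.
Qed.

Lemma eq_fsum (X : choiceType) V (f g : X -> V) s : f =1 g -> fsum f s = fsum g s.
Proof. by move=> fg; apply: eq_bigr => p _; rewrite fg. Qed.

Lemma pm_sum_linear (X : choiceType) (R : seq (k * X) -> seq (k * X) -> Prop) V (f : X -> V) :
  (forall s t, R s t -> fsum f s = fsum f t) ->
  linear (fun x : presmod R => pm_sum f x).
Proof.
move=> fR c x y; elim/pmW: x => s; elim/pmW: y => t.
rewrite -[X in pm_sum f X]/(pm_add (pm_smul c _) _) pm_smulE pm_addE !pm_sum_pi //.
rewrite /fsum big_cat big_map scaler_sumr; congr (_ + _).
by apply: eq_bigr => p _; rewrite scalerA.
Qed.

Lemma pm_sum_gen (X : choiceType) (R : seq (k * X) -> seq (k * X) -> Prop) V (f : X -> V) x :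
  (forall s t, R s t -> fsum f s = fsum f t) -> pm_sum f (pm_gen R x) = f x.
Proof. by move=> fR; rewrite pm_sum_pi // /fsum big_seq1 scale1r. Qed.

Lemma presmod_lin_ext (X : choiceType) (R : seq (k * X) -> seq (k * X) -> Prop) V
    (F G : presmod R -> V) :
  linear F -> linear G -> (forall x, F (pm_gen R x) = G (pm_gen R x)) -> F =1 G.
Proof.
move=> Fl Gl FG x; rewrite [x]pm_gen_sum !lin_fsum //.
exact: eq_fsum.
Qed.

Lemma pm_gen_rel (X : choiceType) (R : seq (k * X) -> seq (k * X) -> Prop) s t :
  R s t -> fsum (pm_gen R) s = fsum (pm_gen R) t.
Proof.
have fE u : fsum (pm_gen R) u = \pi_(presmod R) u.
  elim: u => [|[c x] u IHu]; first by rewrite /fsum big_nil.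
  rewrite /fsum big_cons -/(fsum _ u) IHu -[LHS]/(pm_add (pm_smul c _) _).
  by rewrite /pm_gen pm_smulE pm_addE /= mulr1.
by move=> Rst; rewrite !fE; apply/eqP/pm_piP/pm_eq_rel.
Qed.
End FormalSums.

Section TensorSums.
Variables (k : comNzRingType) (A : Type) (M N : lmodType k).
Variables (rM : M -> A -> M) (lN : A -> N -> N).
Implicit Types (V W : lmodType k) (x : tens rM lN).

Definition balanced V (F : M -> N -> V) :=
  [/\ forall n, linear (F^~ n), forall m, linear (F m) &
      forall m a n, F (rM m a) n = F m (lN a n)].

Lemma balanced_rel V (F : M -> N -> V) : balanced F ->
  forall s t, tens_rel rM lN s t ->
    fsum (fun mn => F mn.1 mn.2) s = fsum (fun mn => F mn.1 mn.2) t.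
Proof.
move=> [Fm Fn Fb] s t; rewrite /fsum; case=> *;
  rewrite !big_cons big_nil /= ?big_nil !addr0 !scale1r.
- exact: (linD (Fm _)).
- exact: (linD (Fn _)).
- exact: (linZ (Fm _)).
- exact: (linZ (Fn _)).
- exact: Fb.
Qed.

Lemma tsum_tensor V (F : M -> N -> V) m n :
  balanced F -> tens_sum (tensor m n : tens rM lN) F = F m n.
Proof. by move=> /balanced_rel FR; rewrite /tens_sum pm_sum_gen. Qed.

Lemma tsum_linear V (F : M -> N -> V) : balanced F -> linear (fun x => tens_sum x F).
Proof. by move=> /balanced_rel; apply: pm_sum_linear. Qed.

Lemma lin_tsum V W (h : V -> W) x (F : M -> N -> V) :
  linear h -> h (tens_sum x F) = tens_sum x (fun m n => h (F m n)).
Proof. by move=> hl; rewrite /tens_sum /pm_sum lin_fsum. Qed.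

Lemma tsum_family V W x (F : M -> N -> V -> W) :
  (forall m n, linear (F m n)) -> linear (fun v => tens_sum x (fun m n => F m n v)).
Proof. by move=> Fl; apply: fsum_family. Qed.

Lemma eq_tsum V x (F G : M -> N -> V) :
  (forall m n, F m n = G m n) -> tens_sum x F = tens_sum x G.
Proof. by move=> FG; apply: eq_fsum => -[m n]; apply: FG. Qed.

Lemma tensor_balanced : balanced (fun m n => tensor m n : tens rM lN).
Proof.
have E := @pm_gen_rel _ _ (tens_rel rM lN).
have E1 f (y : M * N) : fsum (k := k) f [:: (1, y)] = f y :> tens rM lN.
  by rewrite /fsum big_seq1 scale1r.
have E2 f (y z : M * N) : fsum (k := k) f [:: (1, y); (1, z)] = f y + f z :> tens rM lN.
  by rewrite /fsum big_cons big_seq1 !scale1r.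
have Ec c f (y : M * N) : fsum (k := k) f [:: (c, y)] = c *: f y :> tens rM lN.
  by rewrite /fsum big_seq1.
split=> [n c m m'|m c n n'|m a n].
- have /E := tens_relDl rM lN (c *: m) m' n; rewrite E1 E2 /tensor => ->.
  by have /E := tens_relZl rM lN c m n; rewrite E1 Ec => ->.
- have /E := tens_relDr rM lN m (c *: n) n'; rewrite E1 E2 /tensor => ->.
  by have /E := tens_relZr rM lN c m n; rewrite E1 Ec => ->.
- by have /E := tens_rel_bal rM lN m a n; rewrite !E1.
Qed.

End TensorSums.

(** Both sides are finite double sums over the two chosen formal sums, so this is plain Fubini. *)
Lemma tsum_exchange (k : comNzRingType) (A : Type) (M N : lmodType k)
  (rM : M -> A -> M) (lN : A -> N -> N) (A' : Type) (M' N' : lmodType k)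
  (rM' : M' -> A' -> M') (lN' : A' -> N' -> N') (V : lmodType k)
  (x : tens rM lN) (y : tens rM' lN') (F : M -> N -> M' -> N' -> V) :
  tens_sum x (fun m n => tens_sum y (F m n)) =
  tens_sum y (fun m' n' => tens_sum x (fun m n => F m n m' n')).
Proof. exact: fsum_exchange. Qed.

Section LinearClosure.
Variable k : comNzRingType.
Implicit Types V W : lmodType k.

Lemma lin_mull (U : algType k) V (G : V -> U) u :
  linear G -> linear (fun x => G x * u).
Proof. by move=> Gl c x y; rewrite Gl mulrDl scalerAl. Qed.

Lemma lin_mulr (U : algType k) V (G : V -> U) u :
  linear G -> linear (fun x => u * G x).
Proof. by move=> Gl c x y; rewrite Gl mulrDr scalerAr. Qed.

Lemma lin_ball (A : Type) (M N V W : lmodType k) rM lN (F : M -> N -> V) (G : W -> M) n :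
  @balanced k A M N rM lN V F -> linear G -> linear (fun x => F (G x) n).
Proof. by case=> Fl _ _; apply: (lin_comp (Fl n)). Qed.

Lemma lin_balr (A : Type) (M N V W : lmodType k) rM lN (F : M -> N -> V) (G : W -> N) m :
  @balanced k A M N rM lN V F -> linear G -> linear (fun x => F m (G x)).
Proof. by case=> _ Fl _; apply: (lin_comp (Fl m)). Qed.

Lemma lin_tsumarg (A : Type) (M N V W : lmodType k) rM lN (F : M -> N -> V)
    (G : W -> @tens k A M N rM lN) :
  linear G -> balanced rM lN F -> linear (fun x => tens_sum (G x) F).
Proof. by move=> Gl /tsum_linear Fl; apply: lin_comp Gl. Qed.

Lemma lin_tensorl (A : Type) (M N W : lmodType k) rM lN (G : W -> M) n :
  linear G -> linear (fun x => tensor (G x) n : @tens k A M N rM lN).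
Proof. by case: (tensor_balanced rM lN) => Fl _ _; apply: (@lin_comp _ _ _ _ (tensor^~ n)). Qed.

Lemma lin_tensorr (A : Type) (M N W : lmodType k) rM lN (G : W -> N) m :
  linear G -> linear (fun x => tensor m (G x) : @tens k A M N rM lN).
Proof. by case: (tensor_balanced rM lN) => _ Fl _; apply: lin_comp. Qed.

Lemma lin_linear (V W W' : lmodType k) (f : {linear V -> W}) (G : W' -> V) :
  linear G -> linear (fun x => f (G x)).
Proof. by move=> Gl c x y; rewrite Gl linearP. Qed.
End LinearClosure.

(** [act] and [ydm] give the operations of [N] a head symbol and the type [resk N], so that [lin]
    recognises them and scalars of [k] and of [U] stay apart. *)
Definition act (k : comNzRingType) (U : algType k) (N : lmodType U) (u : U) (n : resk N) :
  resk N := u *: (n : N).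
Definition ydm (k : comNzRingType) (A U : algType k) (B : left_bialgebroid A U) (N : lmodType U)
  (Y : yd_algebra B N) (n m : resk N) : resk N := ydmul Y n m.

Section Module.
Variables (k : comNzRingType) (U : algType k) (N : lmodType U).

Lemma actM u v n : @act k U N (u * v) n = act u (act v n).
Proof. by rewrite /act scalerA. Qed.

Lemma act1 n : @act k U N 1 n = n.
Proof. exact: (scale1r (n : N)). Qed.

Lemma lin_actl (V : lmodType k) (G : V -> U) n : linear G -> linear (fun x => @act k U N (G x) n).
Proof.
move=> Gl c x y; rewrite Gl /act scalerDl; congr (_ + _).
rewrite -[RHS]/((c%:A : U) *: (G x *: (n : N))).
by rewrite scalerA -scalerAl mul1r.
Qed.

Lemma lin_actr (V : lmodType k) (G : V -> resk N) u : linear G -> linear (fun x => @act k U N u (G x)).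
Proof.
move=> Gl c x y; rewrite Gl /act.
rewrite -[LHS]/(u *: ((c%:A : U) *: (G x : N) + (G y : N))) scalerDr; congr (_ + _).
rewrite -[RHS]/((c%:A : U) *: (u *: (G x : N))).
by rewrite !scalerA kU_comm.
Qed.
End Module.

Section YD.
Variables (k : comNzRingType) (A U : algType k) (B : left_bialgebroid A U).
Variables (N : lmodType U) (Y : yd_algebra B N).
Local Notation s := (src B).
Local Notation t := (tgt B).

Lemma ydm_lact a n m : ydm Y (act (s a) n) m = act (s a) (ydm Y n m).
Proof. exact: ydmul_lact. Qed.
Lemma ydm_ract a n m : ydm Y n (act (t a) m) = act (t a) (ydm Y n m).
Proof. exact: ydmul_ract. Qed.
Lemma ydm_bal a n m : ydm Y (act (t a) n) m = ydm Y n (act (s a) m).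
Proof. exact: ydmul_bal. Qed.
Lemma ydmA n m l : ydm Y n (ydm Y m l) = ydm Y (ydm Y n m) l.
Proof. exact: ydmulA. Qed.

(** The axioms give additivity and [A]-linearity. A scalar [c] of [k] acts on [N] as [s (c 1)] and
    also as [t (c 1)], so it leaves the left factor by [ydmul_lact] and the right one by
    [ydmul_ract]. *)
Lemma lin_ydl (V : lmodType k) (G : V -> resk N) n : linear G -> linear (fun x => ydm Y (G x) n).
Proof.
move=> Gl c x y; rewrite Gl /ydm -[X in ydmul Y X]/(_ + _ : N) ydmulDl; congr (_ + _).
have -> : c *: G x = s c%:A *: (G x : N) by rewrite linearZ /= rmorph1.
by rewrite ydmul_lact linearZ /= rmorph1.
Qed.

Lemma lin_ydr (V : lmodType k) (G : V -> resk N) n : linear G -> linear (fun x => ydm Y n (G x)).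
Proof.
move=> Gl c x y; rewrite Gl /ydm -[X in ydmul Y _ X]/(_ + _ : N) ydmulDr; congr (_ + _).
have -> : c *: G x = t c%:A *: (G x : N) by rewrite linearZ /= tgt1.
by rewrite ydmul_ract linearZ /= tgt1.
Qed.
End YD.

(** Linearity of a summand in one variable is read off its syntax; the cases that match a hypothesis
    cover the abstract balanced or multilinear maps of the context. *)
Ltac lin_step := cbv beta; match goal with
  | |- forall _, _ => intro
  | |- linear (fun x => x) => exact (@lin_id _ _)
  | |- linear (fun x => (@?G x) * ?uu) => refine (@lin_mull _ _ _ G _ _)
  | |- linear (fun x => ?uu * (@?G x)) => refine (@lin_mulr _ _ _ G _ _)
  | |- linear (fun x => act (@?G x) ?uu) => refine (@lin_actl _ _ _ _ G _ _)
  | |- linear (fun x => act ?uu (@?G x)) => refine (@lin_actr _ _ _ _ G _ _)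
  | |- linear (fun x => ydm ?yy (@?G x) ?uu) => refine (@lin_ydl _ _ _ _ _ _ _ G _ _)
  | |- linear (fun x => ydm ?yy ?uu (@?G x)) => refine (@lin_ydr _ _ _ _ _ _ _ G _ _)
  | |- linear (fun x => tensor (@?G x) ?uu) => refine (@lin_tensorl _ _ _ _ _ _ _ G _ _)
  | |- linear (fun x => tensor ?uu (@?G x)) => refine (@lin_tensorr _ _ _ _ _ _ _ G _ _)
  | |- linear (fun x => tens_sum ?uu (@?F x)) =>
      refine (@tsum_family _ _ _ _ _ _ _ _ _ (fun m n x => F x m n) _)
  | |- linear (fun x => tens_sum (@?G x) ?uu) => refine (@lin_tsumarg _ _ _ _ _ _ _ _ _ G _ _)
  | H : balanced _ _ ?F |- linear (fun x => ?F (@?G x) ?uu) => refine (@lin_ball _ _ _ _ _ _ _ _ F G _ H _)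
  | H : balanced _ _ ?F |- linear (fun x => ?F ?uu (@?G x)) => refine (@lin_balr _ _ _ _ _ _ _ _ F G _ H _)
  | H : balanced _ _ ?F |- linear (?F _) => refine (@lin_balr _ _ _ _ _ _ _ _ F (fun x => x) _ H _)
  | H : linear ?F |- linear (fun x => ?F (@?G x)) => refine (@lin_comp _ _ _ _ F G H _)
  | H : linear ?F |- linear ?F => exact H
  | H : forall y, linear (fun x => ?F x y) |- linear (fun x => ?F (@?G x) ?z) =>
      refine (@lin_comp _ _ _ _ (fun x => F x z) G (H z) _)
  | H : forall y, linear (?F y) |- linear (fun x => ?F ?z (@?G x)) =>
      refine (@lin_comp _ _ _ _ (F z) G (H z) _)
  | H : forall y z, linear (fun x => ?F x y z) |- linear (fun x => ?F (@?G x) ?y ?z) =>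
      refine (@lin_comp _ _ _ _ (fun x => F x y z) G (H y z) _)
  | H : forall y z, linear (fun x => ?F y x z) |- linear (fun x => ?F ?y (@?G x) ?z) =>
      refine (@lin_comp _ _ _ _ (fun x => F y x z) G (H y z) _)
  | H : forall y z, linear (?F y z) |- linear (fun x => ?F ?y ?z (@?G x)) =>
      refine (@lin_comp _ _ _ _ (F y z) G (H y z) _)
  | H : forall y z, linear (?F y z) |- linear (?F ?y ?z) => exact (H y z)
  | |- linear (GRing.mul ?u) => refine (@lin_mulr _ _ _ (fun x => x) u _)
  | |- linear (act ?u) => refine (@lin_actr _ _ _ _ (fun x => x) u _)
  | |- linear (ydm ?y ?u) => refine (@lin_ydr _ _ _ _ _ _ _ (fun x => x) u _)
  | |- linear (tensor ?u) => refine (@lin_tensorr _ _ _ _ _ _ _ (fun x => x) u _)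
  | |- linear (fun x => ?uu (@?G x)) => refine (@lin_linear _ _ _ _ _ G _)
  | |- linear _ => solve [exact: linearP]
  end.
Ltac lin := repeat lin_step.

(** * Coproduct sums in a left bialgebroid *)

Section BialgebroidSums.
Variables (k : comNzRingType) (A U : algType k) (B : left_bialgebroid A U).
Local Notation s := (src B).
Local Notation t := (tgt B).
Implicit Types (V : lmodType k) (u v : U) (a b : A).

Local Notation balU := (balanced (fun u a => t a * u) (lactU B)).

(** The maps that factor through [U ⊗_A (U ⊗_A Z)], where both coassociativity axioms live: [Z] is
    [U] for the coproduct and [N] for the coaction. *)
Definition balanced3 (Z V : lmodType k) (lZ : A -> Z -> Z) (F : U -> U -> Z -> V) :=
  [/\ forall y z, linear (fun x => F x y z), forall x z, linear (fun y => F x y z),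
      forall x y, linear (F x y),
      forall a x y z, F (t a * x) y z = F x (s a * y) z &
      forall a x y z, F x (t a * y) z = F x y (lZ a z)].

Lemma tsum_lact (Z V : lmodType k) (lZ : A -> Z -> Z) (F : U -> Z -> V) a
    (x : tensA B lZ) :
  balanced (fun u a => t a * u) lZ F ->
  tens_sum (tensA_lact a x) F = tens_sum x (fun y z => F (s a * y) z).
Proof.
move=> Fb; rewrite /tensA_lact (lin_tsum x _ (tsum_linear Fb)).
by apply: eq_tsum => y z; rewrite tsum_tensor.
Qed.

Lemma balanced3_l (Z V : lmodType k) (lZ : A -> Z -> Z) (F : U -> U -> Z -> V) x :
  balanced3 lZ F -> balanced (fun u a => t a * u) lZ (F x).
Proof. by case=> F1 F2 F3 _ F5; split=> // *; apply: F5. Qed.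

Lemma balanced3_tsum (Z V : lmodType k) (lZ : A -> Z -> Z) (F : U -> U -> Z -> V) :
  balanced3 lZ F ->
  balanced (fun u a => t a * u) (tensA_lact (E := B) (lN := lZ)) (fun x Y => tens_sum Y (F x)).
Proof.
move=> Fb; have F2 x := balanced3_l x Fb; case: Fb => F1 _ _ F4 _; split.
- by lin.
- by move=> m; apply: tsum_linear.
- move=> x a Y; rewrite tsum_lact //.
  by apply: eq_tsum => y z; rewrite F4.
Qed.

(** Here and below, axioms that are equations between tensors are turned into equations between sums
    of an arbitrary balanced summand. *)
Lemma DsumM V (F : U -> U -> V) u v : balU F ->
  \tsum_(w1 ; w2 <- Delta B (u * v)) F w1 w2 =
  \tsum_(u1 ; u2 <- Delta B u) \tsum_(v1 ; v2 <- Delta B v) F (u1 * v1) (u2 * v2).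
Proof.
move=> Fb; rewrite DeltaM (lin_tsum _ _ (tsum_linear Fb)); apply: eq_tsum => u1 u2.
rewrite (lin_tsum _ _ (tsum_linear Fb)); apply: eq_tsum => v1 v2.
by rewrite tsum_tensor.
Qed.

Lemma Dsum1 V (F : U -> U -> V) : balU F -> \tsum_(w1 ; w2 <- Delta B 1) F w1 w2 = F 1 1.
Proof. by move=> Fb; rewrite Delta1 tsum_tensor. Qed.

Lemma Dsum_st V (F : U -> U -> V) a b u : balU F ->
  \tsum_(w1 ; w2 <- Delta B (s a * t b * u)) F w1 w2 =
  \tsum_(u1 ; u2 <- Delta B u) F (s a * u1) (t b * u2).
Proof.
move=> Fb; rewrite Delta_bimod (lin_tsum _ _ (tsum_linear Fb)).
by apply: eq_tsum => u1 u2; rewrite tsum_tensor.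
Qed.

Lemma Dsum_s V (F : U -> U -> V) a u : balU F ->
  \tsum_(w1 ; w2 <- Delta B (s a * u)) F w1 w2 =
  \tsum_(u1 ; u2 <- Delta B u) F (s a * u1) u2.
Proof.
move=> Fb; have := @Dsum_st _ F a 1 u Fb; rewrite tgt1 mulr1 => ->.
by apply: eq_tsum => u1 u2; rewrite mul1r.
Qed.

Lemma Dsum_t V (F : U -> U -> V) a u : balU F ->
  \tsum_(w1 ; w2 <- Delta B (t a * u)) F w1 w2 =
  \tsum_(u1 ; u2 <- Delta B u) F u1 (t a * u2).
Proof.
move=> Fb; have := @Dsum_st _ F 1 a u Fb; rewrite rmorph1 mul1r => ->.
by apply: eq_tsum => u1 u2; rewrite mul1r.
Qed.

Lemma Dsum_s1 V (F : U -> U -> V) a : balU F ->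
  \tsum_(w1 ; w2 <- Delta B (s a)) F w1 w2 = F (s a) 1.
Proof.
move=> Fb; rewrite -[s a in LHS]mulr1 Dsum_s // (@Dsum1 _ (fun x y => F (s a * x) y)) ?mulr1 //.
split; [lin|lin|move=> x b y]; rewrite /lactU.
by case: Fb => _ _ Fb; rewrite mulrA src_tgtC -mulrA Fb.
Qed.

Lemma Dsum_t1 V (F : U -> U -> V) a : balU F ->
  \tsum_(w1 ; w2 <- Delta B (t a)) F w1 w2 = F 1 (t a).
Proof.
move=> Fb; rewrite -[t a in LHS]mulr1 Dsum_t // (@Dsum1 _ (fun x y => F x (t a * y))) ?mulr1 //.
split; [lin|lin|move=> x b y]; rewrite /lactU.
by case: Fb => _ _ Fb; rewrite mulrA -src_tgtC -mulrA Fb.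
Qed.

Lemma Dsum_tak V (F : U -> U -> V) a u : balU F ->
  \tsum_(u1 ; u2 <- Delta B u) F (u1 * t a) u2 =
  \tsum_(u1 ; u2 <- Delta B u) F u1 (u2 * s a).
Proof.
move=> Fb; have /(congr1 (fun x => tens_sum x F)) := Delta_takeuchi B u a.
rewrite !(lin_tsum _ _ (tsum_linear Fb)).
under eq_tsum do rewrite tsum_tensor //.
by under [X in _ = X -> _]eq_tsum do rewrite tsum_tensor //.
Qed.

Lemma balU_mull V (F : U -> U -> V) u v : balU F -> balU (fun x y => F (x * u) (y * v)).
Proof.
move=> Fb; split; [lin|lin|move=> x a y].
by case: Fb => _ _ Fb; rewrite -!mulrA Fb /lactU mulrA.
Qed.

(** By the Takeuchi condition, left multiplication by [Delta u] is well defined on [U ⊗_A U]. In the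
    coproduct of a product [u * v], the coproduct of [v] can therefore be evaluated first. *)
Lemma balU_prod V (F : U -> U -> V) u : balU F ->
  balU (fun x y => \tsum_(u1 ; u2 <- Delta B u) F (u1 * x) (u2 * y)).
Proof.
move=> Fb; split; [lin|lin|move=> x a y; rewrite /lactU].
under eq_tsum do rewrite mulrA.
under [RHS]eq_tsum do rewrite mulrA.
by rewrite (@Dsum_tak _ (fun u1 u2 => F (u1 * x) (u2 * y))) //; apply: balU_mull.
Qed.

Lemma Dsum_ut V (F : U -> U -> V) a u : balU F ->
  \tsum_(w1 ; w2 <- Delta B (u * t a)) F w1 w2 =
  \tsum_(u1 ; u2 <- Delta B u) F u1 (u2 * t a).
Proof.
move=> Fb; rewrite DsumM // tsum_exchange Dsum_t1; last exact: balU_prod.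
by apply: eq_tsum => u1 u2; rewrite !mulr1.
Qed.

Lemma Dsum_us V (F : U -> U -> V) a u : balU F ->
  \tsum_(w1 ; w2 <- Delta B (u * s a)) F w1 w2 =
  \tsum_(u1 ; u2 <- Delta B u) F (u1 * s a) u2.
Proof.
move=> Fb; rewrite DsumM // tsum_exchange Dsum_s1; last exact: balU_prod.
by apply: eq_tsum => u1 u2; rewrite !mulr1.
Qed.

Lemma Dsum_coassoc V (F : U -> U -> U -> V) u : balanced3 (lactU B) F ->
  \tsum_(u1 ; u2 <- Delta B u) \tsum_(u11 ; u12 <- Delta B u1) F u11 u12 u2 =
  \tsum_(u1 ; u2 <- Delta B u) \tsum_(u21 ; u22 <- Delta B u2) F u1 u21 u22.
Proof.
move=> Fb; have Gb := balanced3_tsum Fb.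
have F2 x := balanced3_l x Fb.
have /(congr1 (fun x => tens_sum x (fun x Y => tens_sum Y (F x)))) := Delta_coassoc B u.
rewrite !(lin_tsum _ _ (tsum_linear Gb)).
under eq_tsum => u1 u2.
  rewrite (lin_tsum _ _ (tsum_linear Gb)).
  under eq_tsum do rewrite !tsum_tensor //.
  over.
by under [X in _ = X -> _]eq_tsum do rewrite tsum_tensor //.
Qed.

Lemma Dsum_counitl V (G : U -> V) u : linear G ->
  \tsum_(u1 ; u2 <- Delta B u) G (s (eps B u1) * u2) = G u.
Proof. by move=> Gl; rewrite -[in RHS](Delta_counitl B u) (lin_tsum _ _ Gl). Qed.

Lemma Dsum_counitr V (G : U -> V) u : linear G ->
  \tsum_(u1 ; u2 <- Delta B u) G (t (eps B u2) * u1) = G u.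
Proof. by move=> Gl; rewrite -[in RHS](Delta_counitr B u) (lin_tsum _ _ Gl). Qed.

Lemma eps_s a u : eps B (s a * u) = a * eps B u.
Proof. by have := eps_bimod B a 1 u; rewrite tgt1 !mulr1. Qed.

Lemma eps_t a u : eps B (t a * u) = eps B u * a.
Proof. by have := eps_bimod B 1 a u; rewrite rmorph1 !mul1r. Qed.

Lemma eps_tgt a : eps B (t a) = a.
Proof. by rewrite -[t a]mulr1 eps_t eps1 mul1r. Qed.
End BialgebroidSums.

(** * Sweedler sums *)

Section Coaction.
Variables (k : comNzRingType) (A U : algType k) (B : left_bialgebroid A U).
Variables (N : lmodType U) (Y : yd_algebra B N).
Local Notation s := (src B).
Local Notation t := (tgt B).
Local Notation M := (resk N).
Implicit Types (V : lmodType k) (u v : U) (a b : A) (n : M).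

Local Notation balN := (balanced (fun u a => t a * u) (@lactN _ _ _ B N)).

Lemma lactNE a n : lactN B a n = act (s a) n.
Proof. by []. Qed.

Lemma Csum_lact V (F : U -> M -> V) a n : balN F ->
  \tsum_(m ; n0 <- coact Y (act (s a) n)) F m n0 =
  \tsum_(m ; n0 <- coact Y n) F (s a * m) n0.
Proof.
move=> Fb; rewrite coact_lact (lin_tsum _ _ (tsum_linear Fb)).
by apply: eq_tsum => m n0; rewrite tsum_tensor.
Qed.

Lemma Csum_coassoc V (F : U -> U -> M -> V) n : balanced3 B (@lactN _ _ _ B N) F ->
  \tsum_(m ; n0 <- coact Y n) \tsum_(m1 ; m2 <- Delta B m) F m1 m2 n0 =
  \tsum_(m ; n0 <- coact Y n) \tsum_(m' ; n1 <- coact Y n0) F m m' n1.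
Proof.
move=> Fb; have Gb := balanced3_tsum Fb.
have F2 x := balanced3_l x Fb.
have /(congr1 (fun x => tens_sum x (fun x Z => tens_sum Z (F x)))) := coact_coassoc Y n.
rewrite !(lin_tsum _ _ (tsum_linear Gb)).
under eq_tsum => m n0.
  rewrite (lin_tsum _ _ (tsum_linear Gb)).
  under eq_tsum do rewrite !tsum_tensor //.
  over.
by under [X in _ = X -> _]eq_tsum do rewrite tsum_tensor //.
Qed.

Lemma Csum_ract1 V (G : M -> V) a n : linear G ->
  \tsum_(m ; n0 <- coact Y n) G (act (s (eps B (m * t a))) n0) = G (act (t a) n).
Proof. by move=> Gl; rewrite /act -[in RHS](yd_ract Y) (lin_tsum _ _ Gl). Qed.

(** Right [A]-linearity of the coaction. By [yd_ract], [t(a) n] is the sum of the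
    [s(eps(n_(-1) t(a))) n_(0)], on which the coaction is known; coassociativity and the Takeuchi
    condition move [a] to the second leg as [s(a)], and the counit removes the first leg. *)
Lemma Csum_ract V (F : U -> M -> V) a n : balN F ->
  \tsum_(m ; n0 <- coact Y (act (t a) n)) F m n0 =
  \tsum_(m ; n0 <- coact Y n) F (m * s a) n0.
Proof.
move=> Fb; case: (Fb) => F1 F2 F3.
rewrite -(@Csum_ract1 _ (fun x => \tsum_(m ; n0 <- coact Y x) F m n0)); last by lin.
under eq_tsum do rewrite Csum_lact //.
rewrite -(@Csum_coassoc _ (fun x y z => F (s (eps B (x * t a)) * y) z)); last first.
  split; [by lin|by lin|by lin|move=> b x y z|move=> b x y z].
    by rewrite -mulrA eps_t rmorphM mulrA.
  by rewrite mulrA src_tgtC -mulrA F3.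
apply: eq_tsum => m n0.
rewrite (@Dsum_tak _ _ _ _ _ (fun x y => F (s (eps B x) * y) n0)).
  under eq_tsum do rewrite mulrA.
  by rewrite (@Dsum_counitl _ _ _ _ _ (fun x => F (x * s a) n0)) //; lin.
split; [by lin|by lin|move=> x b y].
by rewrite eps_t rmorphM mulrA.
Qed.

(** The Takeuchi property of the coaction. Expanding [t(a) n_(0)] by [yd_ract] and using
    coassociativity brings [eps(m_(2) t(a))] next to [m_(1)]; the right counit law for [m t(a)]
    concludes. *)
Lemma Csum_tak V (F : U -> M -> V) a n : balN F ->
  \tsum_(m ; n0 <- coact Y n) F (m * t a) n0 =
  \tsum_(m ; n0 <- coact Y n) F m (act (t a) n0).
Proof.
move=> Fb; case: (Fb) => F1 F2 F3.
under [RHS]eq_tsum => m n0 do rewrite -(@Csum_ract1 _ (F m)) //.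
rewrite -(@Csum_coassoc _ (fun x y z => F x (act (s (eps B (y * t a))) z))); last first.
  split; [by lin|by lin|by lin|move=> b x y z|move=> b x y z].
    by rewrite -mulrA eps_s rmorphM actM F3.
  by rewrite -mulrA eps_t rmorphM actM.
apply: eq_tsum => m n0.
under [RHS]eq_tsum => m1 m2 do rewrite -[act _ n0]/(lactN B _ _) -F3.
rewrite -(@Dsum_ut _ _ _ _ _ (fun x y => F (t (eps B y) * x) n0)).
  by rewrite (@Dsum_counitr _ _ _ _ _ (fun x => F x n0)) //; lin.
split; [by lin|by lin|move=> x b y].
by rewrite eps_s tgtM mulrA.
Qed.

Lemma Csum_YD V (F : U -> M -> V) u n : balN F ->
  \tsum_(u1 ; u2 <- Delta B u) \tsum_(m ; n0 <- coact Y (act u1 n)) F (m * u2) n0 =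
  \tsum_(u1 ; u2 <- Delta B u) \tsum_(m ; n0 <- coact Y n) F (u1 * m) (act u2 n0).
Proof.
move=> Fb; have /(congr1 (fun x => tens_sum x F)) := yd_compat Y u n.
rewrite !(lin_tsum _ _ (tsum_linear Fb)).
under eq_tsum => m n0.
  rewrite (lin_tsum _ _ (tsum_linear Fb)).
  under eq_tsum do rewrite !tsum_tensor //.
  over.
move=> E; rewrite [LHS]E; apply: eq_tsum => m n0.
rewrite (lin_tsum _ _ (tsum_linear Fb)).
by under eq_tsum do rewrite !tsum_tensor //.
Qed.

Lemma Csum_one V (F : U -> M -> V) : balN F ->
  \tsum_(m ; n0 <- coact Y (ydone Y)) F m n0 = F 1 (ydone Y).
Proof. by move=> Fb; rewrite coact1 tsum_tensor. Qed.

Lemma Csum_mul V (F : U -> M -> V) n n' : balN F ->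
  \tsum_(m ; n0 <- coact Y (ydm Y n n')) F m n0 =
  \tsum_(m ; n0 <- coact Y n) \tsum_(m' ; n1 <- coact Y n') F (m * m') (ydm Y n0 n1).
Proof.
move=> Fb; rewrite coactM (lin_tsum _ _ (tsum_linear Fb)).
apply: eq_tsum => m n0; rewrite (lin_tsum _ _ (tsum_linear Fb)).
by apply: eq_tsum => m' n1; rewrite tsum_tensor.
Qed.

Lemma act_ydm u n n' :
  act u (ydm Y n n') = \tsum_(u1 ; u2 <- Delta B u) ydm Y (act u1 n) (act u2 n').
Proof. exact: yd_actM. Qed.

Lemma balN_mulr V (F : U -> M -> V) u : balN F -> balN (fun x n => F (x * u) n).
Proof.
move=> Fb; split; [by lin|by lin|move=> x a n].
by case: Fb => _ _ Fb; rewrite -mulrA Fb.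
Qed.
End Coaction.

Section Sweedler.
Variables (k : comNzRingType) (A U : algType k) (B : left_bialgebroid A U).
Local Notation s := (src B).
Local Notation t := (tgt B).
Implicit Types (V W : lmodType k) (u v w : U) (a b : A) (us vs l r : seq U).

Local Notation balU := (balanced (fun u a => t a * u) (lactU B)).
Local Notation sw_sum := (@sw_sum k A U B _).

Lemma ssum_nil V (F : seq U -> U -> V) : sw_sum [::] F = F [::] 1.
Proof. by rewrite /Defs.sw_sum /fsum big_seq1 scale1r. Qed.

Lemma ssum_tcons V (F : seq U -> U -> V) u us :
  sw_sum (u :: us) F =
  \tsum_(u1 ; u2 <- Delta B u) sw_sum us (fun us1 w => F (u1 :: us1) (u2 * w)).
Proof.
rewrite /Defs.sw_sum /tens_sum /pm_sum /fsum /= big_allpairs_dep /=.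
apply: eq_bigr => c _; rewrite scaler_sumr.
by apply: eq_bigr => d _; rewrite scalerA.
Qed.

Lemma ssum_cons V (F : seq U -> U -> V) u us :
  sw_sum (u :: us) F =
  sw_sum us (fun us1 w => \tsum_(u1 ; u2 <- Delta B u) F (u1 :: us1) (u2 * w)).
Proof. by rewrite ssum_tcons; apply: fsum_exchange. Qed.

Lemma eq_ssum V (F G : seq U -> U -> V) us :
  (forall us1 w, size us1 = size us -> F us1 w = G us1 w) -> sw_sum us F = sw_sum us G.
Proof.
elim: us F G => [|u us IHus] F G FG; first by rewrite !ssum_nil FG.
rewrite !ssum_cons; apply: IHus => us1 w us1s.
by apply: eq_tsum => u1 u2; rewrite FG //= us1s.
Qed.

Lemma lin_ssum V W (h : V -> W) us (F : seq U -> U -> V) :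
  linear h -> h (sw_sum us F) = sw_sum us (fun us1 w => h (F us1 w)).
Proof. by move=> hl; rewrite /Defs.sw_sum lin_fsum. Qed.

Lemma ssum_family V W us (F : seq U -> U -> V -> W) :
  (forall us1 w, size us1 = size us -> linear (F us1 w)) ->
  linear (fun x : V => sw_sum us (fun us1 w => F us1 w x)).
Proof.
elim: us F => [|u us IHus] F Fl c x y; first by rewrite !ssum_nil Fl.
rewrite !ssum_cons; apply: (IHus (fun us1 w x => \tsum_(u1 ; u2 <- Delta B u)
  F (u1 :: us1) (u2 * w) x)) => us1 w us1s.
by apply: tsum_family => m n; apply: Fl; rewrite /= us1s.
Qed.

Lemma ssum_exchange V us vs (F : seq U -> U -> seq U -> U -> V) :
  sw_sum us (fun us1 w => sw_sum vs (F us1 w)) =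
  sw_sum vs (fun vs1 w' => sw_sum us (fun us1 w => F us1 w vs1 w')).
Proof. exact: fsum_exchange. Qed.

Lemma ssum_tsum (A' : Type) (M' N' : lmodType k) (rM' : M' -> A' -> M') (lN' : A' -> N' -> N')
    V us (x : tens rM' lN') (F : seq U -> U -> M' -> N' -> V) :
  sw_sum us (fun us1 w => tens_sum x (F us1 w)) =
  tens_sum x (fun m n => sw_sum us (fun us1 w => F us1 w m n)).
Proof. exact: fsum_exchange. Qed.

Lemma ssum_cat V us vs (F : seq U -> U -> V) :
  sw_sum (us ++ vs) F =
  sw_sum us (fun us1 w => sw_sum vs (fun vs1 w' => F (us1 ++ vs1) (w * w'))).
Proof.
elim: us F => [|u us IHus] F /=.
  by rewrite ssum_nil; apply: eq_ssum => us1 w; rewrite mul1r.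
rewrite !ssum_tcons; apply: eq_tsum => u1 u2; rewrite IHus.
apply: eq_ssum => us1 w _; apply: eq_ssum => vs1 w' _.
by rewrite mulrA.
Qed.

(** These functions factor through [tpow B n]; their values on sequences of other lengths are left
    free. *)
Definition mbal V n (f : seq U -> V) :=
  (forall l r, (size l + size r).+1 = n -> linear (fun u => f (l ++ u :: r))) /\
  (forall l u a v r, (size l + size r).+2 = n ->
     f (l ++ u * t a :: v :: r) = f (l ++ u :: t a * v :: r)).

(* [admissible n F] says that F induces a map on the tensor product over A of
   the n-fold tensor power of U over A^op with U. *)
Definition admissible V n (F : seq U -> U -> V) :=
  [/\ forall w, mbal n (F^~ w), forall us, size us = n -> linear (F us) &
      forall a u us w, (size us).+1 = n -> F (t a * u :: us) w = F (u :: us) (s a * w)].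

Lemma mbal_ext V n (f g : seq U -> V) :
  (forall us, size us = n -> f us = g us) -> mbal n f -> mbal n g.
Proof.
move=> fg [f1 f2]; split=> [l r e c x y|l u a v r e].
  by rewrite -!fg ?f1 // ?size_cat /= ?addnS.
by rewrite -!fg ?f2 // ?size_cat /= ?addnS.
Qed.

Lemma mbal_lin V W n (f : seq U -> V) (h : V -> W) :
  linear h -> mbal n f -> mbal n (fun us => h (f us)).
Proof.
move=> hl [f1 f2]; split=> [l r e|l u a v r e]; last by rewrite f2.
by apply: lin_comp; last exact: f1.
Qed.

Lemma admissible_ext V n (F G : seq U -> U -> V) :
  (forall us w, size us = n -> F us w = G us w) -> admissible n F -> admissible n G.
Proof.
move=> FG [F1 F2 F3]; split=> [w|us e c x y|a u us w e].
- by apply: mbal_ext (F1 w) => us e; apply: FG.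
- by rewrite -!FG // F2.
- by rewrite -!FG //= F3.
Qed.

Lemma admissible_balU V n (F : seq U -> U -> V) us w : admissible n F -> (size us).+1 = n ->
  balU (fun x y => F (x :: us) (y * w)).
Proof.
move=> [F1 F2 F3] e; split=> [v|u|u a v].
- by case: (F1 (v * w)) => F4 _; apply: (F4 [::]).
- by apply: lin_comp; [apply: F2|lin].
- by rewrite F3 // mulrA.
Qed.

(** The point is the last condition: [t(a)] on the head of the tail passes to [u1] as [u1 t(a)] by
    balancing over [A^op], and the Takeuchi condition turns this into [u2 s(a)], a factor of the
    accumulated product. So the diagonal of a tensor power can be built one argument at a time. *)
Lemma admissible_cons V n (F : seq U -> U -> V) u : admissible n.+1 F ->
  admissible n (fun us w => \tsum_(u1 ; u2 <- Delta B u) F (u1 :: us) (u2 * w)).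
Proof.
move=> Fa; case: (Fa) => F1 F2 F3; split=> [w|us e|a v us w e].
- split=> [l r e|l x a y r e].
    apply: tsum_family => m n0; case: (F1 (n0 * w)) => F4 _.
    by apply: (F4 (m :: l)); rewrite -e.
  apply: eq_tsum => m n0; case: (F1 (n0 * w)) => _ F4.
  by apply: (F4 (m :: l)); rewrite -e.
- apply: tsum_family => m n0; apply: lin_comp; last by lin.
  by apply: F2; rewrite /= e.
- under eq_tsum => u1 u2.
    case: (F1 (u2 * w)) => _ /(_ [::] u1 a v us) /= <-; last by rewrite -e.
    over.
  rewrite (@Dsum_tak _ _ _ _ _ (fun x y => F (x :: v :: us) (y * w))).
    by apply: eq_tsum => u1 u2; rewrite mulrA.
  by apply: admissible_balU Fa _; rewrite /= e.
Qed.

Lemma admissible_cat V n us (F : seq U -> U -> V) : admissible (size us + n) F ->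
  admissible n (fun vs w => sw_sum us (fun us1 w1 => F (us1 ++ vs) (w1 * w))).
Proof.
elim: us F => [|u us IHus] F /= Fa.
  by apply: admissible_ext Fa => vs w _; rewrite ssum_nil mul1r.
apply: admissible_ext (IHus _ (admissible_cons u Fa)) => vs w _.
rewrite ssum_cons; apply: eq_ssum => us1 w1 _.
by apply: eq_tsum => u1 u2; rewrite mulrA.
Qed.

Lemma hole_linear V us (F : seq U -> U -> V) : admissible (size us).+1 F ->
  linear (fun m => sw_sum us (fun us1 w => F (rcons us1 m) w)).
Proof.
rewrite -addn1 => /admissible_cat [/(_ 1) [/(_ [::] [::] erefl) Fl _] _ _].
rewrite (_ : (fun m => _) = (fun m => sw_sum us (fun us1 w => F (us1 ++ [:: m]) (w * 1)))) //.
by apply/funext => m; apply: eq_ssum => us1 w _; rewrite mulr1 cats1.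
Qed.

(** [m] sits in the slot that follows [us], where a cochain will be inserted; [t(a)] on it crosses
    all preceding arguments and ends up in the product of their second legs. *)
Lemma hole_tgt V us (F : seq U -> U -> V) a m : admissible (size us).+1 F ->
  sw_sum us (fun us1 w => F (rcons us1 (t a * m)) w) =
  sw_sum us (fun us1 w => F (rcons us1 m) (w * s a)).
Proof.
rewrite -addn1 => /admissible_cat [_ _ /(_ a m [::] 1 erefl)].
under eq_ssum do rewrite mulr1 cats1.
by under [X in _ = X -> _]eq_ssum do rewrite mulr1 cats1.
Qed.

Lemma ssum_balU V n (F : seq U -> U -> V) us : admissible n F -> (size us).+1 = n ->
  balU (fun x y => sw_sum us (fun us1 w => F (x :: us1) (y * w))).
Proof.
move=> Fa e; split=> [m|m|m a m'].
- apply: ssum_family => us1 w us1s.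
  by case: (@admissible_balU _ _ _ us1 w Fa); rewrite ?us1s.
- apply: ssum_family => us1 w us1s.
  by case: (@admissible_balU _ _ _ us1 w Fa); rewrite ?us1s.
- apply: eq_ssum => us1 w us1s.
  by case: (@admissible_balU _ _ _ us1 w Fa) => [|_ _ /(_ m a m')]; rewrite ?us1s.
Qed.

Lemma ssum_head V n (F : seq U -> U -> V) a u us : admissible n F -> (size us).+1 = n ->
  sw_sum (t a * u :: us) F = sw_sum (u :: us) (fun us1 w => F us1 (t a * w)).
Proof.
move=> Fa e; rewrite !ssum_tcons Dsum_t; last exact: ssum_balU Fa _.
by apply: eq_tsum => u1 u2; apply: eq_ssum => us1 w _; rewrite mulrA.
Qed.

Lemma ssum_last V n (F : seq U -> U -> V) a l u : admissible n F -> (size l).+1 = n ->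
  sw_sum (rcons l (u * t a)) F = sw_sum (rcons l u) (fun us1 w => F us1 (w * t a)).
Proof.
elim: l n F => [|x l IHl] n F Fa e /=.
  rewrite !ssum_tcons Dsum_ut; last exact: ssum_balU Fa _.
  by apply: eq_tsum => u1 u2; rewrite !ssum_nil !mulr1.
case: n Fa e => // n Fa [e]; rewrite !ssum_cons (IHl n) //; last exact: admissible_cons.
by apply: eq_ssum => us1 w _; apply: eq_tsum => u1 u2; rewrite mulrA.
Qed.

(** The diagonal descends to the tensor power: [Delta (u t(a)) = u1 ⊗ u2 t(a)] and
    [Delta (t(a) v) = v1 ⊗ t(a) v2], so moving [t(a)] from [u] to [v] only concerns second legs, and
    these are multiplied together. *)
Lemma ssum_mbal V n (F : seq U -> U -> V) : admissible n F ->
  mbal n (fun us => sw_sum us F).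
Proof.
move=> Fa; split=> [l r e|l u a v r e].
  elim: l n F Fa e => [|x l IHl] n F Fa e /=.
    rewrite (_ : (fun _ => _) = (fun u => \tsum_(u1 ; u2 <- Delta B u)
      sw_sum r (fun us1 w => F (u1 :: us1) (u2 * w)))); last first.
      by apply/funext => u; rewrite ssum_tcons.
    apply: lin_tsumarg; first by lin.
    exact: ssum_balU Fa _.
  case: n Fa e => // n Fa [e].
  rewrite (_ : (fun _ => _) = (fun u => sw_sum (l ++ u :: r)
    (fun us1 w => \tsum_(u1 ; u2 <- Delta B x) F (u1 :: us1) (u2 * w)))); last first.
    by apply/funext => u; rewrite ssum_cons.
  by apply: (IHl n); first exact: admissible_cons.
elim: l n F Fa e => [|x l IHl] n F Fa e /=; last first.
  case: n Fa e => // n Fa [e]; rewrite !ssum_cons.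
  by apply: (IHl n); first exact: admissible_cons.
case: n Fa e => // n Fa [e].
rewrite [RHS]ssum_cons (ssum_head _ _ (admissible_cons _ Fa)) //= ssum_cons.
apply: eq_ssum => us1 w us1s; rewrite Dsum_ut.
  by apply: eq_tsum => u1 u2; rewrite mulrA.
by apply: admissible_balU Fa _; rewrite us1s /= e.
Qed.

(** The summands defined on [U^{⊗ n} ⊗_A U ⊗_A U], the target of the iterated diagonal. *)
Definition admissible3 V n (F : seq U -> U -> U -> V) :=
  [/\ forall w w', mbal n (fun us => F us w w'),
      forall us w', size us = n -> linear (fun w => F us w w'),
      forall us w, size us = n -> linear (F us w),
      forall a u us w w', (size us).+1 = n -> F (t a * u :: us) w w' = F (u :: us) (s a * w) w' &
      forall a us w w', size us = n -> F us (t a * w) w' = F us w (s a * w')].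

Lemma ssum_coassoc V us (F : seq U -> U -> U -> V) : admissible3 (size us) F ->
  sw_sum us (fun us1 w' => sw_sum us1 (fun us2 w => F us2 w w')) =
  sw_sum us (fun us1 w => \tsum_(w1 ; w2 <- Delta B w) F us1 w1 w2).
Proof.
elim: us F => [|u us IHus] F [F1 F2 F3 F4 F5].
  rewrite !ssum_nil Dsum1 //; split=> [v|v|v a v']; rewrite /lactU; [exact: F2|exact: F3|exact: F5].
have Fb us1 w w' : size us1 = size us ->
    balanced3 B (lactU B) (fun x y z => F (x :: us1) (y * w) (z * w')).
  move=> us1s; split=> [y z|x z|x y|a x y z|a x y z].
  - by case: (F1 (y * w) (z * w')) => F6 _; apply: (F6 [::]); rewrite us1s.
  - by apply: (@lin_comp _ _ _ _ (fun y => F (x :: us1) y _)); [apply: F2; rewrite /= us1s|lin].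
  - by apply: lin_comp; [apply: F3; rewrite /= us1s|lin].
  - by rewrite F4 ?mulrA // us1s.
  - by rewrite -mulrA F5 ?mulrA //= us1s.
have F2b us1 x : size us1 = size us -> balU (F (x :: us1)).
  move=> us1s; split=> [v|v|v a v']; [apply: F2|apply: F3|apply: F5]; exact: (congr1 S us1s).
(* The head [u] is absorbed into the summand in order to induct on [us]. The left side produces the
   form with [u11], [u12], [u2]; the form of [F'E] serves the last balancing condition and the right
   side, where [Delta] of a product is expanded. *)
pose F' us1 w w' := \tsum_(u1 ; u2 <- Delta B u) \tsum_(u11 ; u12 <- Delta B u1)
  F (u11 :: us1) (u12 * w) (u2 * w').
have F'E us1 w w' : size us1 = size us -> F' us1 w w' =
    \tsum_(u1 ; u2 <- Delta B u) \tsum_(u21 ; u22 <- Delta B u2)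
      F (u1 :: us1) (u21 * w) (u22 * w').
  move=> us1s.
  by apply: (@Dsum_coassoc _ _ _ _ _ (fun x y z => F (x :: us1) (y * w) (z * w'))); apply: Fb.
transitivity (sw_sum us (fun us1 w' => sw_sum us1 (fun us2 w => F' us2 w w'))).
  rewrite ssum_cons; apply: eq_ssum => us1 w' us1s; rewrite ssum_tsum.
  by apply: eq_tsum => u1 u2; rewrite ssum_cons.
rewrite IHus.
  rewrite ssum_cons; apply: eq_ssum => us1 w us1s.
  under [RHS]eq_tsum => u1 u2.
    rewrite DsumM; last exact: F2b.
    over.
  under eq_tsum do rewrite F'E //.
  rewrite tsum_exchange; apply: eq_tsum => u1 u2.
  by rewrite tsum_exchange; apply: eq_tsum => u21 u22.
split=> [w w'|us1 w' us1s|us1 w us1s|a v us1 w w' us1s|a us1 w w' us1s].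
- split=> [l r e|l x a y r e].
    apply: tsum_family => u1 u2; apply: tsum_family => u11 u12.
    by case: (F1 (u12 * w) (u2 * w')) => F6 _; apply: (F6 (u11 :: l)); rewrite /= -e.
  apply: eq_tsum => u1 u2; apply: eq_tsum => u11 u12.
  by case: (F1 (u12 * w) (u2 * w')) => _ F6; apply: (F6 (u11 :: l)); rewrite /= -e.
- apply: tsum_family => u1 u2; apply: tsum_family => u11 u12.
  by apply: (@lin_comp _ _ _ _ (fun y => F (u11 :: us1) y _)); [apply: F2; rewrite /= us1s|lin].
- apply: tsum_family => u1 u2; apply: tsum_family => u11 u12.
  by apply: lin_comp; [apply: F3; rewrite /= us1s|lin].
- apply: eq_tsum => u1 u2.
  under eq_tsum => u11 u12.
    case: (F1 (u12 * w) (u2 * w')) => _ /(_ [::] u11 a v us1) /= <-; last by rewrite /= -us1s.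
    over.
  rewrite (@Dsum_tak _ _ _ _ _ (fun x y => F (x :: v :: us1) (y * w) (u2 * w'))).
    by apply: eq_tsum => u11 u12; rewrite mulrA.
  split=> [y|x|x b y].
  - by case: (F1 (y * w) (u2 * w')) => F6 _; apply: (F6 [::]); rewrite /= us1s.
  - by apply: (@lin_comp _ _ _ _ (fun y => F (x :: v :: us1) y _)); [apply: F2; rewrite /= us1s|lin].
  - by rewrite F4 /= ?us1s // mulrA.
- rewrite !F'E //; apply: eq_tsum => u1 u2.
  under eq_tsum do rewrite mulrA.
  rewrite (@Dsum_tak _ _ _ _ _ (fun x y => F (u1 :: us1) (x * w) (y * w'))); last exact/balU_mull/F2b.
  by apply: eq_tsum => u21 u22; rewrite mulrA.
Qed.

(** The counit law of the diagonal, with the head absorbed into the summand as for coassociativity;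
    by [epsMs], [eps (u2 * w)] depends on [w] only through [s (eps w)]. *)
Lemma ssum_counit V us (F : seq U -> U -> V) : admissible (size us) F ->
  sw_sum us (fun us1 w => F us1 (s (eps B w))) = F us 1.
Proof.
elim: us F => [|u us IHus] F Fa.
  by rewrite ssum_nil eps1 rmorph1.
pose G us1 w := \tsum_(u1 ; u2 <- Delta B u) F (u1 :: us1) (s (eps B (u2 * w))).
have Gb us1 w : size us1 = size us ->
    balU (fun x y => F (x :: us1) (s (eps B (y * w)))).
  move=> us1s; case: (Fa) => F1 F2 F3; split=> [v|v|v a v'].
  - by case: (F1 (s (eps B (v * w)))) => F4 _; apply: (F4 [::]); rewrite us1s.
  - by apply: lin_comp; [apply: F2; rewrite /= us1s|lin].
  - by rewrite F3 /= ?us1s // -mulrA eps_s rmorphM.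
have Ga : admissible (size us) G.
  case: (Fa) => F1 F2 F3; split=> [w|us1 us1s|a v us1 w us1s].
  - split=> [l r e|l x a y r e].
      apply: tsum_family => u1 u2; case: (F1 (s (eps B (u2 * w)))) => F4 _.
      by apply: (F4 (u1 :: l)); rewrite /= -e.
    apply: eq_tsum => u1 u2; case: (F1 (s (eps B (u2 * w)))) => _ F4.
    by apply: (F4 (u1 :: l)); rewrite /= -e.
  - apply: tsum_family => u1 u2; apply: lin_comp; last by lin.
    by apply: F2; rewrite /= us1s.
  - rewrite /G; under eq_tsum => u1 u2.
      case: (F1 (s (eps B (u2 * w)))) => _ /(_ [::] u1 a v us1) /= <-; last by rewrite /= -us1s.
      over.
    rewrite (@Dsum_tak _ _ _ _ _ (fun x y => F (x :: v :: us1) (s (eps B (y * w))))); last exact: Gb.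
    by apply: eq_tsum => u1 u2; rewrite mulrA.
rewrite ssum_cons -[RHS](_ : G us 1 = _).
  rewrite -IHus //; apply: eq_ssum => us1 w us1s; apply: eq_tsum => u1 u2.
  by rewrite epsMs.
rewrite /G; under eq_tsum => u1 u2.
  rewrite mulr1 -[s _]mulr1; case: (Fa) => _ _ <- //.
  over.
rewrite (@Dsum_counitr _ _ _ _ _ (fun x => F (x :: us) 1)) //.
by case: Fa => F1 _ _; case: (F1 1) => F4 _; apply: (F4 [::]).
Qed.
End Sweedler.

(** * Insertion of cochains *)

Section Insertion.
Variables (k : comNzRingType) (A U : algType k) (B : left_bialgebroid A U).
Variables (N : lmodType U) (Y : yd_algebra B N).
Local Notation t := (tgt B).
Local Notation M := (resk N).
Implicit Types (V : lmodType k) (f g h : seq U -> M).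
Implicit Types us vs : seq U.

Local Notation balU := (balanced (fun u a => t a * u) (lactU B)).
Local Notation balN := (balanced (fun u a => t a * u) (@lactN _ _ _ B N)).
Local Notation sw_sum := (@sw_sum k A U B _).
Local Notation mbal := (mbal B).
Local Notation admissible := (admissible B).

Definition multi n f :=
  mbal n f /\
  forall a u us, (size us).+1 = n -> f (t a * u :: us) = act (t a) (f (u :: us)).

Lemma multi_ext n f g : (forall us, size us = n -> f us = g us) -> multi n f -> multi n g.
Proof.
move=> fg [f1 f2]; split; first exact: mbal_ext f1.
by move=> a u us e; rewrite -!fg ?f2.
Qed.

Lemma admissible3_Delta V n (F : seq U -> U -> U -> V) : admissible3 B n F ->
  admissible n (fun us w => \tsum_(w1 ; w2 <- Delta B w) F us w1 w2).
Proof.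
move=> [F1 F2 F3 F4 F5].
have Fb us : size us = n -> balU (F us).
  by move=> e; split=> [v|v|v a v']; [apply: F2|apply: F3|apply: F5].
split=> [w|us e|a u us w e].
- split=> [l r e|l u a v r e].
    by apply: tsum_family => w1 w2; case: (F1 w1 w2) => F6 _; apply: F6.
  by apply: eq_tsum => w1 w2; case: (F1 w1 w2) => _ F6; apply: F6.
- by apply: lin_tsumarg; [lin|apply: Fb].
- rewrite Dsum_s; last exact: Fb.
  by apply: eq_tsum => w1 w2; apply: F4.
Qed.

(* The sum of F(D_(-1), D_(0)) for D = D_g(us). *)
Definition Dsum V g us (F : U -> M -> V) : V :=
  sw_sum us (fun us1 w => \tsum_(m ; n <- coact Y (g us1)) F (m * w) n).

Lemma DsumE V g us (F : U -> M -> V) :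
  Dsum g us F = sw_sum us (fun us1 w => \tsum_(m ; n <- coact Y (g us1)) F (m * w) n).
Proof. by []. Qed.

Lemma eq_Dsum V g g' us (F F' : U -> M -> V) :
  (forall us1, size us1 = size us -> g us1 = g' us1) ->
  (forall m n, F m n = F' m n) -> Dsum g us F = Dsum g' us F'.
Proof.
move=> gg' FF'; apply: eq_ssum => us1 w e; rewrite gg' //.
exact: eq_tsum.
Qed.

Lemma eq_Dsumr V g us (F F' : U -> M -> V) :
  (forall m n, F m n = F' m n) -> Dsum g us F = Dsum g us F'.
Proof. exact: eq_Dsum. Qed.

Lemma lin_Dsum V (W : lmodType k) g us (F : U -> M -> V) (h : V -> W) :
  linear h -> h (Dsum g us F) = Dsum g us (fun m n => h (F m n)).
Proof.
move=> hl; rewrite /Dsum lin_ssum //; apply: eq_ssum => us1 w _.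
by rewrite (lin_tsum _ _ hl).
Qed.

Lemma Dsum_family V (W : lmodType k) g us (F : U -> M -> V -> W) :
  (forall m n, linear (F m n)) -> linear (fun x => Dsum g us (fun m n => F m n x)).
Proof. by move=> Fl; apply: ssum_family => us1 w _; apply: tsum_family. Qed.

Lemma ssum_Dsum V us g vs (F : seq U -> U -> U -> M -> V) :
  sw_sum us (fun us1 w => Dsum g vs (F us1 w)) =
  Dsum g vs (fun m n => sw_sum us (fun us1 w => F us1 w m n)).
Proof.
rewrite /Dsum ssum_exchange; apply: eq_ssum => vs1 w _.
by rewrite ssum_tsum.
Qed.

Lemma tsum_Dsum (A' : Type) (M' N' : lmodType k) (rM' : M' -> A' -> M') (lN' : A' -> N' -> N')
    V (x : tens rM' lN') g vs (F : M' -> N' -> U -> M -> V) :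
  tens_sum x (fun x y => Dsum g vs (F x y)) =
  Dsum g vs (fun m n => tens_sum x (fun x y => F x y m n)).
Proof.
rewrite [RHS]/Dsum; under [RHS]eq_ssum do rewrite tsum_exchange.
by rewrite ssum_tsum.
Qed.

Lemma Dsum_exchange V g us h vs (F : U -> M -> U -> M -> V) :
  Dsum g us (fun m n => Dsum h vs (F m n)) =
  Dsum h vs (fun m' n' => Dsum g us (fun m n => F m n m' n')).
Proof.
rewrite [LHS]/Dsum; under eq_ssum do rewrite tsum_Dsum.
by rewrite ssum_Dsum.
Qed.

Lemma Dsum_admissible V q g (F : U -> M -> V) : multi q g -> balN F ->
  admissible q (fun us w => \tsum_(m ; n <- coact Y (g us)) F (m * w) n).
Proof.
move=> [g1 g2] Fb; split=> [w|us e|a u us w e].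
- apply: (mbal_lin (h := fun x => \tsum_(m ; n <- coact Y x) F (m * w) n)) g1.
  by lin; apply: balN_mulr.
- by lin.
- rewrite g2 // Csum_ract; last exact: balN_mulr.
  by apply: eq_tsum => m n; rewrite mulrA.
Qed.

Lemma Dsum_mbal V q g (F : U -> M -> V) : multi q g -> balN F ->
  mbal q (fun us => Dsum g us F).
Proof. by move=> gc Fb; apply/ssum_mbal/Dsum_admissible. Qed.

(** [t(a)] reaches the product of second legs from the left, hence stands just to the right of the
    coaction leg [m], and [Csum_tak] hands it to [n]. *)
Lemma Dsum_head V q g (F : U -> M -> V) a u us : multi q g -> balN F -> (size us).+1 = q ->
  Dsum g (t a * u :: us) F = Dsum g (u :: us) (fun m n => F m (act (t a) n)).
Proof.
move=> gc Fb e; rewrite /Dsum (ssum_head _ _ (Dsum_admissible gc Fb)) //.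
apply: eq_ssum => us1 w _; under eq_tsum do rewrite mulrA.
by rewrite (@Csum_tak _ _ _ _ _ _ _ (fun x n => F (x * w) n)) //; apply: balN_mulr.
Qed.

Lemma Dsum_last V q g (F : U -> M -> V) a l u : multi q g -> balN F -> (size l).+1 = q ->
  Dsum g (rcons l (u * t a)) F = Dsum g (rcons l u) (fun m n => F (m * t a) n).
Proof.
move=> gc Fb e; rewrite /Dsum (ssum_last _ _ (Dsum_admissible gc Fb)) //.
by apply: eq_ssum => us1 w _; apply: eq_tsum => m n; rewrite mulrA.
Qed.

Lemma Dsum_nil V g (F : U -> M -> V) :
  Dsum g [::] F = \tsum_(m ; n <- coact Y (g [::])) F m n.
Proof. by rewrite /Dsum ssum_nil; apply: eq_tsum => m n; rewrite mulr1. Qed.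

Lemma balanced3_Delta V (F : U -> U -> M -> V) w w' : balanced3 B (@lactN _ _ _ B N) F ->
  balN (fun m n => \tsum_(m1 ; m2 <- Delta B m) F (m1 * w) (m2 * w') n).
Proof.
move=> Fb; case: (Fb) => F1 F2 F3 F4 F5.
have Gb n : balU (fun x y => F (x * w) (y * w') n).
  by split; [by lin|by lin|move=> x a y]; rewrite -mulrA F4 /lactU mulrA.
split=> [n|m|m a n]; [by lin; apply: Gb|by lin|].
rewrite (Dsum_t _ _ (Gb n)).
by apply: eq_tsum => m1 m2; rewrite -mulrA F5.
Qed.

(** [D_h] is not itself a coaction: splitting its first leg yields the coaction of [D_(0)] with the
    product of the second legs of [us] as an extra right factor. Coassociativity of the coaction and
    of the diagonal enter together. *)
Lemma Dsum_colinear V q h us (F : U -> U -> M -> V) : multi q h -> size us = q ->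
  balanced3 B (@lactN _ _ _ B N) F ->
  Dsum h us (fun m n => \tsum_(m1 ; m2 <- Delta B m) F m1 m2 n) =
  sw_sum us (fun us1 w => Dsum h us1 (fun m n =>
    \tsum_(m' ; n' <- coact Y n) F m (m' * w) n')).
Proof.
move=> hc e Fb; have F2b x := balanced3_l x Fb; case: (Fb) => F1 F2 F3 F4 F5.
have F6 z : balU (fun x y => F x y z) by split.
have F7 z w w' : balU (fun x y => F (x * w) (y * w') z).
  by split; [by lin|by lin|move=> x a y]; rewrite -mulrA F4 /lactU mulrA.
have Gb u v : balanced3 B (@lactN _ _ _ B N) (fun x y z => F (x * u) (y * v) z).
  by split; [by lin|by lin|by lin|move=> a x y z|move=> a x y z]; rewrite -mulrA ?F4 ?F5 ?mulrA.
pose G us1 w w' := \tsum_(m ; n <- coact Y (h us1)) \tsum_(m1 ; m2 <- Delta B m)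
  F (m1 * w) (m2 * w') n.
have GE us1 w w' : G us1 w w' = \tsum_(m ; n <- coact Y (h us1))
    \tsum_(m' ; n' <- coact Y n) F (m * w) (m' * w') n'.
  exact: (@Csum_coassoc _ _ _ _ _ _ _ (fun x y z => F (x * w) (y * w') z)).
case: hc => h1 h2.
have Ga : admissible3 B (size us) G.
  split=> [w w'|us1 w' us1s|us1 w us1s|a u us1 w w' us1s|a us1 w w' us1s].
  - rewrite e; apply: (mbal_lin (h := fun x => \tsum_(m ; n <- coact Y x)
      \tsum_(m1 ; m2 <- Delta B m) F (m1 * w) (m2 * w') n)) h1.
    by lin; apply: balanced3_Delta.
  - by rewrite /G; lin.
  - by rewrite /G; lin.
  - rewrite /G h2 -?e // Csum_ract; last exact: balanced3_Delta.
    apply: eq_tsum => m n; rewrite Dsum_us //.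
    by apply: eq_tsum => m1 m2; rewrite mulrA.
  - apply: eq_tsum => m n; under eq_tsum do rewrite mulrA.
    rewrite (Dsum_tak _ _ (F7 n w w')).
    by apply: eq_tsum => m1 m2; rewrite mulrA.
transitivity (sw_sum us (fun us1 w => \tsum_(w1 ; w2 <- Delta B w) G us1 w1 w2)).
  apply: eq_ssum => us1 w _; rewrite /G tsum_exchange; apply: eq_tsum => m n.
  by rewrite DsumM // tsum_exchange.
rewrite -ssum_coassoc //; apply: eq_ssum => us1 w' _.
by apply: eq_ssum => us2 w _; rewrite GE.
Qed.

(** Here braided commutativity enters. [Dsum_colinear] turns the left side into sums of
    [(n_(-1) (w X)) · n_(0)], which is the braided form of [n · (w X)]. *)
Lemma Dsum_braided V q h us (F : U -> M -> V) X : braided_commutative Y ->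
  multi q h -> size us = q -> balN F ->
  Dsum h us (fun m n => \tsum_(m1 ; m2 <- Delta B m) F m1 (ydm Y (act m2 X) n)) =
  sw_sum us (fun us1 w => Dsum h us1 (fun m n => F m (ydm Y n (act w X)))).
Proof.
move=> bc hc e Fb.
rewrite (@Dsum_colinear _ q _ _ (fun x y n => F x (ydm Y (act y X) n))) //; last first.
  case: (Fb) => F1 F2 F3.
  split; [by lin|by lin|by lin|move=> a x y z|move=> a x y z].
    by rewrite F3 lactNE actM ydm_lact.
  by rewrite actM ydm_bal lactNE.
apply: eq_ssum => us1 w _; apply: eq_Dsumr => m n.
have FE : linear (F m) by case: Fb.
rewrite -(lin_tsum _ _ FE); congr (F m _).
rewrite [RHS]/(ydm _ _ _) bc.
by apply: eq_tsum => m' n'; rewrite actM.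
Qed.

(** The summand for inserting a cochain into [f] between [us] and [vs]; being balanced in [m] and
    [n], it can be summed against [D_g]. *)
Definition Phi f us vs (m : U) (n : M) : M :=
  sw_sum us (fun us1 w => ydm Y (f (us1 ++ m :: vs)) (act w n)).

Lemma PhiE f us vs m n :
  Phi f us vs m n = sw_sum us (fun us1 w => ydm Y (f (us1 ++ m :: vs)) (act w n)).
Proof. by []. Qed.

Lemma mbal_catr V n (F : seq U -> V) vs : mbal (n + size vs) F -> mbal n (fun us => F (us ++ vs)).
Proof.
move=> [F1 F2]; split=> [l r e c x y|l u a v r e].
  by rewrite -!catA; apply: (F1 l (r ++ vs)); rewrite size_cat -e addSn addnA.
by rewrite -!catA; apply: F2; rewrite size_cat -e !addSn addnA.
Qed.

Lemma mbal_catl V n (F : seq U -> V) us : mbal (size us + n) F -> mbal n (fun vs => F (us ++ vs)).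
Proof.
move=> [F1 F2]; split=> [l r e c x y|l u a v r e].
  by rewrite !catA; apply: (F1 (us ++ l) r); rewrite size_cat -e addnS addnA.
by rewrite !catA; apply: F2; rewrite size_cat -e !addnS addnA.
Qed.

Lemma mul_admissible p f us vs n : multi p f -> (size us + size vs)%N = p ->
  admissible (size us) (fun us1 w => ydm Y (f (us1 ++ vs)) (act w n)).
Proof.
move=> [f1 f2] e; split=> [w|us1 us1s|a u us1 w us1s].
- apply: (mbal_lin (h := fun x => ydm Y x (act w n))); first by lin.
  by apply: mbal_catr; rewrite e.
- by lin.
- by rewrite /= f2 ?ydm_bal ?actM // size_cat -e -us1s addSn.
Qed.

Lemma Phi_balanced p f us vs : multi p f -> (size us + size vs).+1 = p -> balN (Phi f us vs).
Proof.
move=> fc e.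
have Fa n : admissible (size us).+1 (fun us1 w => ydm Y (f (us1 ++ vs)) (act w n)).
  (* [rcons us 0] only supplies a sequence with one more argument; the conclusion refers to its
     length alone. *)
  by have := @mul_admissible p f (rcons us 0) vs n fc; rewrite size_rcons; apply; rewrite addSn.
split=> [n|m|m a n].
- have := hole_linear (Fa n).
  by under [X in linear X -> _]eq_fun do under eq_ssum do rewrite cat_rcons.
- by apply: ssum_family => us1 w _; lin.
- have := hole_tgt a m (Fa n).
  under eq_ssum do rewrite cat_rcons.
  by under [X in _ = X -> _]eq_ssum do rewrite cat_rcons actM.
Qed.

Definition ins f g us vs ws : M := Dsum g vs (Phi f us ws).

Lemma insE f g us vs ws : ins f g us vs ws = Dsum g vs (Phi f us ws).
Proof. by []. Qed.

(** Associativity in [N] combined with the module algebra law [u (X W) = (u1 X) (u2 W)]; the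
    iterated diagonal of [us] supplies the two legs. *)
Lemma mul_assoc p f us vs X W : multi p f -> (size us + size vs)%N = p ->
  sw_sum us (fun us1 w' => sw_sum us1 (fun us2 w =>
    ydm Y (ydm Y (f (us2 ++ vs)) (act w X)) (act w' W))) =
  sw_sum us (fun us1 w => ydm Y (f (us1 ++ vs)) (act w (ydm Y X W))).
Proof.
move=> fc e; rewrite (@ssum_coassoc _ _ _ _ _ _ (fun us2 w w' =>
    ydm Y (ydm Y (f (us2 ++ vs)) (act w X)) (act w' W))).
  apply: eq_ssum => us1 w _; rewrite act_ydm.
  have Yl : linear (ydm Y (f (us1 ++ vs))) by lin.
  rewrite (lin_tsum _ _ Yl).
  by apply: eq_tsum => w1 w2; rewrite ydmA.
have [F1 F2 F3] := mul_admissible X fc e.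
split=> [w w'|us1 w' us1s|us1 w us1s|a u us1 w w' us1s|a us1 w w' us1s].
- by apply: (mbal_lin (h := fun x => ydm Y x (act w' W))) (F1 w); lin.
- by lin.
- by lin.
- by rewrite F3.
- by rewrite !actM ydm_ract ydm_bal.
Qed.
End Insertion.

Section Composition.
Variables (k : comNzRingType) (A U : algType k) (B : left_bialgebroid A U).
Variables (N : lmodType U) (Y : yd_algebra B N).
Local Notation t := (tgt B).
Local Notation M := (resk N).
Implicit Types (V : lmodType k) (f g h : seq U -> M).
Implicit Types us vs : seq U.

Local Notation balU := (balanced (fun u a => t a * u) (lactU B)).
Local Notation balN := (balanced (fun u a => t a * u) (@lactN _ _ _ B N)).
Local Notation sw_sum := (@sw_sum k A U B _).
Local Notation multi := (@multi _ _ _ B N).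
Local Notation Dsum := (Dsum Y).
Local Notation ins := (ins Y).
Local Notation Phi := (Phi Y).

Lemma balN_ydl V (F : U -> M -> V) W X : balN F -> balN (fun m n => F (m * W) (ydm Y n X)).
Proof.
move=> Fb; split; [by lin|by lin|move=> m a n].
by case: Fb => _ _ Fb; rewrite -mulrA Fb !lactNE ydm_lact.
Qed.

Lemma coact_admissible3 V q g (F : U -> M -> V) us vs X W : multi q g -> balN F ->
  (size us + size vs)%N = q ->
  admissible3 B (size us) (fun us w w' => \tsum_(z ; n <- coact Y (g (us ++ vs)))
    F (z * (w * W)) (ydm Y n (act w' X))).
Proof.
move=> [g1 g2] Fb e; split=> [w w'|us1 w' us1s|us1 w us1s|a u us1 w w' us1s|a us1 w w' us1s].
- apply: (mbal_lin (h := fun x => \tsum_(z ; n <- coact Y x)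
    F (z * (w * W)) (ydm Y n (act w' X)))).
    by lin; apply: balN_ydl.
  by apply: mbal_catr; rewrite e.
- by lin.
- by lin.
- rewrite /= g2; last by rewrite size_cat -e -us1s addSn.
  rewrite Csum_ract; last exact: balN_ydl.
  by apply: eq_tsum => z n; rewrite !mulrA.
- under eq_tsum do rewrite -[t a * w * W]mulrA [_ * (t a * _)]mulrA.
  rewrite (@Csum_tak _ _ _ _ _ _ _ (fun z n => F (z * (w * W)) (ydm Y n (act w' X)))); last exact: balN_ydl.
  by apply: eq_tsum => z n; rewrite actM ydm_bal.
Qed.

Lemma admissible3_balU V n (F : seq U -> U -> U -> V) us : admissible3 B n F -> size us = n ->
  balU (F us).
Proof.
move=> [F1 F2 F3 F4 F5] e; split=> [v|v|v a v']; [exact: F2|exact: F3|exact: F5].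
Qed.

(** How [D] behaves on a composite of [g] and [h]: [D_h] is taken on the inner block, its first leg
    becomes an argument of [D_g], and the two values in [N] are multiplied. [gh] is prescribed on
    the relevant lengths only, since composites will be extended by zero. *)
Lemma Dsum_comp V q r g h gh us vs ws (F : U -> M -> V) :
  multi q g -> multi r h -> (size us + size ws).+1 = q -> size vs = r -> balN F ->
  (forall us1 vs1 ws1, size us1 = size us -> size vs1 = size vs -> size ws1 = size ws ->
     gh (us1 ++ vs1 ++ ws1) = ins g h us1 vs1 ws1) ->
  Dsum gh (us ++ vs ++ ws) F =
  Dsum h vs (fun m n => sw_sum us (fun us1 w => Dsum g (us1 ++ m :: ws)
    (fun m' n' => F m' (ydm Y n' (act w n))))).
Proof.
move=> gc hc e vss Fb ghE.
(* The left side will be brought to the sum of [L] over the coaction of [D_(0)], the right side to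
   its sum over the coproduct of [D_(-1)]; [Dsum_colinear] connects the two. *)
pose L m x n' := sw_sum ws (fun ws1 w' => sw_sum us (fun us1 w =>
  \tsum_(w1 ; w2 <- Delta B w) \tsum_(z ; n <- coact Y (g (us1 ++ m :: ws1)))
    F (z * (w1 * (x * w'))) (ydm Y n (act w2 n')))).
have Lb : balanced3 B (@lactN _ _ _ B N) L.
  have Ea ws1 x w' n' : size ws1 = size ws -> admissible3 B (size us).+1 (fun us1 w1 w2 =>
      \tsum_(z ; n <- coact Y (g (us1 ++ ws1))) F (z * (w1 * (x * w'))) (ydm Y n (act w2 n'))).
    move=> ws1s; have := @coact_admissible3 _ _ _ _ (rcons us 0) ws1 n' (x * w') gc Fb.
    by rewrite size_rcons; apply; rewrite ws1s addSn e.
  have Eb us1 ws1 m x w' n' : size us1 = size us -> size ws1 = size ws ->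
      balU (fun w1 w2 => \tsum_(z ; n <- coact Y (g (us1 ++ m :: ws1)))
        F (z * (w1 * (x * w'))) (ydm Y n (act w2 n'))).
    move=> us1s /(Ea _ x w' n') /(@admissible3_balU _ _ _ (rcons us1 m)).
    by rewrite cat_rcons; apply; rewrite size_rcons us1s.
  split=> [x n'|m n'|m x|a m x n'|a m x n'].
  - apply: ssum_family => ws1 w' ws1s.
    have := hole_linear (admissible3_Delta (Ea ws1 x w' n' ws1s)).
    by under [X in linear X -> _]eq_fun do under eq_ssum do under eq_tsum do rewrite cat_rcons.
  - apply: ssum_family => ws1 w' ws1s; apply: ssum_family => us1 w us1s.
    by lin; apply: balN_ydl.
  - apply: ssum_family => ws1 w' ws1s; apply: ssum_family => us1 w us1s.
    by lin; apply: balN_ydl.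
  - apply: eq_ssum => ws1 w' ws1s.
    have := hole_tgt a m (admissible3_Delta (Ea ws1 x w' n' ws1s)).
    under eq_ssum do under eq_tsum do rewrite cat_rcons.
    move=> ->; apply: eq_ssum => us1 w us1s.
    rewrite Dsum_us; last by rewrite cat_rcons; apply: Eb.
    apply: eq_tsum => w1 w2; rewrite cat_rcons.
    by apply: eq_tsum => z n; rewrite !mulrA.
  - apply: eq_ssum => ws1 w' ws1s; apply: eq_ssum => us1 w us1s.
    under eq_tsum do under eq_tsum do rewrite -[t a * x * w']mulrA [_ * (t a * _)]mulrA.
    rewrite (Dsum_tak _ _ (Eb us1 ws1 m x w' n' us1s ws1s)).
    by apply: eq_tsum => w1 w2; apply: eq_tsum => z n; rewrite actM.
transitivity (sw_sum vs (fun vs1 w => Dsum h vs1 (fun m n =>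
    \tsum_(m' ; n' <- coact Y n) L m (m' * w) n'))).
  rewrite [LHS]DsumE ssum_cat.
  under eq_ssum do rewrite ssum_cat.
  rewrite ssum_exchange; apply: eq_ssum => vs1 w2 vs1s.
  rewrite ssum_exchange.
  transitivity (sw_sum ws (fun ws1 w3 => sw_sum us (fun us1 w1 =>
    Dsum h vs1 (fun m n => sw_sum us1 (fun us2 w =>
      \tsum_(z ; n0 <- coact Y (ydm Y (g (us2 ++ m :: ws1)) (act w n)))
        F (z * (w1 * (w2 * w3))) n0))))).
    apply: eq_ssum => ws1 w3 ws1s; apply: eq_ssum => us1 w1 us1s; rewrite ghE //.
    have Hl : linear (fun x => \tsum_(m ; n <- coact Y x) F (m * (w1 * (w2 * w3))) n).
      by lin; apply: balN_mulr.
    rewrite (lin_Dsum _ _ _ _ Hl); apply: eq_Dsumr => m n.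
    by rewrite PhiE (lin_ssum _ _ _ Hl).
  under eq_ssum do rewrite ssum_Dsum.
  rewrite ssum_Dsum; apply: eq_Dsumr => m n.
  rewrite -ssum_tsum; apply: eq_ssum => ws1 w3 ws1s.
  rewrite -ssum_tsum ssum_coassoc.
    apply: eq_ssum => us1 w us1s.
    have Gb : balN (fun x n' => \tsum_(z ; n0 <- coact Y (g (us1 ++ m :: ws1)))
        F (z * (x * (w2 * w3))) (ydm Y n0 n')).
      split; [by lin|by lin|move=> x a n'].
      under eq_tsum do rewrite -[t a * x * _]mulrA [_ * (t a * _)]mulrA.
      rewrite (@Csum_tak _ _ _ _ _ _ _ (fun z n0 => F (z * (x * (w2 * w3))) (ydm Y n0 n'))).
        by apply: eq_tsum => z n0; rewrite ydm_bal lactNE.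
      exact: balN_ydl.
    (* The coaction of [w1 n], multiplied by [w2], is traded for [w1 n_(-1)] and [w2 n_(0)]: this is
       the Yetter-Drinfel'd condition. *)
    rewrite [RHS]tsum_exchange; have := Csum_YD Y w n Gb.
    under [X in _ = X -> _]eq_tsum => w1 w2'.
      under eq_tsum => z n0 do under eq_tsum do rewrite -[w1 * z * _]mulrA [z * (w2 * w3)]mulrA.
      over.
    move=> <-; apply: eq_tsum => u1 u2.
    rewrite Csum_mul; last exact: balN_mulr.
    rewrite tsum_exchange; apply: eq_tsum => z n1; apply: eq_tsum => z' n2.
    by rewrite !mulrA.
  have [[g1 g2] [F1 F2 F3]] := (gc, Fb).
  split=> [w w'|us1 w' us1s|us1 w us1s|a u us1 w w' us1s|a us1 w w' us1s].
  - apply: (mbal_lin (h := fun x => \tsum_(z ; n0 <- coact Y (ydm Y x (act w n)))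
      F (z * (w' * (w2 * w3))) n0)).
      by lin; apply: balN_mulr.
    by apply: mbal_catr; rewrite /= addnS ws1s e.
  - by lin; apply: balN_mulr.
  - by lin.
  - by rewrite /= g2 ?ydm_bal ?actM // size_cat /= addnS ws1s -e -us1s addSn.
  - rewrite actM ydm_ract Csum_ract; last exact: balN_mulr.
    by apply: eq_tsum => z n0; rewrite !mulrA.
rewrite -(Dsum_colinear Y hc vss Lb); apply: eq_Dsumr => m n.
under [RHS]eq_ssum => us1 w us1s.
  rewrite DsumE ssum_cat.
  under eq_ssum do rewrite ssum_tcons.
  rewrite ssum_tsum.
  over.
rewrite [RHS]ssum_tsum; apply: eq_tsum => m1 m2.
under [RHS]eq_ssum do rewrite ssum_exchange.
rewrite [RHS]ssum_exchange; apply: eq_ssum => ws1 w' ws1s.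
rewrite ssum_coassoc //; apply: (coact_admissible3 _ _ gc Fb).
by rewrite /= addnS ws1s e.
Qed.
(** Once [D] of the composite [gh] is expanded by [Dsum_comp], both sides sum over [D_h] and then
    over [D_g], and they agree by [mul_assoc]. *)
Lemma ins_nested p q r f g h fg gh a b c d e :
  multi p f -> multi q g -> multi r h ->
  (size a + size e).+1 = p -> (size b + size d).+1 = q -> size c = r ->
  (forall b1 c1 d1, size b1 = size b -> size c1 = size c -> size d1 = size d ->
     gh (b1 ++ c1 ++ d1) = ins g h b1 c1 d1) ->
  (forall a1 v e1, size a1 = size a -> size v = q -> size e1 = size e ->
     fg (a1 ++ v ++ e1) = ins f g a1 v e1) ->
  ins f gh a (b ++ c ++ d) e = ins fg h (a ++ b) c (d ++ e).
Proof.
move=> fc gc hc ae bd cr ghE fgE; have Fb := @Phi_balanced _ _ _ _ _ Y p f a e fc ae.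
rewrite [LHS](Dsum_comp gc hc bd cr Fb ghE); apply: eq_Dsumr => m n.
rewrite PhiE ssum_cat ssum_exchange; apply: eq_ssum => b1 w2 b1s.
transitivity (sw_sum a (fun a1 w1 => Dsum g (b1 ++ m :: d) (fun m' n' => sw_sum a1 (fun a2 w =>
    ydm Y (ydm Y (f (a2 ++ m' :: e)) (act w n')) (act w1 (act w2 n)))))).
  rewrite ssum_Dsum; apply: eq_Dsumr => m' n'.
  by rewrite (mul_assoc _ _ _ fc) // addnS.
apply: eq_ssum => a1 w1 a1s.
rewrite -actM -catA -[m :: d ++ e]/((m :: d) ++ e) (catA b1) fgE //; last first.
  by rewrite size_cat /= b1s addnS.
have Hl : linear (fun x => ydm Y x (act (w1 * w2) n)) by lin.
rewrite (lin_Dsum _ _ _ _ Hl); apply: eq_Dsumr => m' n'.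
by rewrite PhiE (lin_ssum _ _ _ Hl).
Qed.

(** Both sides sum over [D_h] on [b] and [D_g] on [d], but multiply the two values in [N] in
    opposite orders. On the left, the first leg of [D_h] is an argument that precedes [d], so it is
    split and its second half acts on the value of [g]; [Dsum_braided] restores the order. *)
Lemma ins_disjoint p q r f g h fg fh a b c d e : braided_commutative Y ->
  multi p f -> multi q g -> multi r h ->
  (size a + size c + size e).+2 = p -> size d = q -> size b = r ->
  (forall x d1 e1, size x = (size a + size c).+1 -> size d1 = q -> size e1 = size e ->
     fg (x ++ d1 ++ e1) = ins f g x d1 e1) ->
  (forall a1 b1 x, size a1 = size a -> size b1 = r -> size x = (size c + size e).+1 ->
     fh (a1 ++ b1 ++ x) = ins f h a1 b1 x) ->
  ins fg h a b (c ++ d ++ e) = ins fh g (a ++ b ++ c) d e.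
Proof.
move=> bc fc gc hc ace dq br fgE fhE.
have Fb c1 m' : size c1 = size c -> balN (Phi f a (c1 ++ m' :: e)).
  move=> c1s; apply: Phi_balanced fc _.
  by rewrite -ace size_cat /= c1s !addnS addnA.
transitivity (sw_sum c (fun c1 w' => Dsum g d (fun m' n' => Dsum h b (fun m n =>
    \tsum_(m1 ; m2 <- Delta B m) Phi f a (c1 ++ m' :: e) m1 (ydm Y (act m2 (act w' n')) n))))).
  under eq_ssum do rewrite Dsum_exchange.
  rewrite ssum_Dsum; apply: eq_Dsumr => m n.
  transitivity (sw_sum a (fun a1 w1 => Dsum g d (fun m' n' =>
      sw_sum (a1 ++ m :: c) (fun a2 w => ydm Y (ydm Y (f (a2 ++ m' :: e)) (act w n')) (act w1 n))))).
    rewrite PhiE; apply: eq_ssum => a1 w1 a1s.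
    rewrite -[m :: c ++ _]/((m :: c) ++ _) catA fgE //; last by rewrite size_cat /= a1s addnS.
    have Hl : linear (fun x => ydm Y x (act w1 n)) by lin.
    rewrite (lin_Dsum _ _ _ _ Hl); apply: eq_Dsumr => m' n'.
    by rewrite PhiE (lin_ssum _ _ _ Hl).
  rewrite ssum_Dsum;
  rewrite [RHS]ssum_Dsum; apply: eq_Dsumr => m' n'.
  under eq_ssum => a1 w1 a1s.
    rewrite ssum_cat; under eq_ssum do rewrite ssum_cons.
    rewrite ssum_exchange.
    over.
  rewrite ssum_exchange; apply: eq_ssum => c1 w' c1s.
  under eq_ssum do rewrite ssum_tsum.
  rewrite ssum_tsum; apply: eq_tsum => m1 m2.
  rewrite PhiE -(mul_assoc _ _ _ fc).
    apply: eq_ssum => a1 w1 a1s; apply: eq_ssum => a2 w a2s.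
    by rewrite -!actM -catA !mulrA.
  by rewrite -ace /= size_cat /= c1s !addnS addnA.
transitivity (sw_sum c (fun c1 w' => Dsum g d (fun m' n' => sw_sum b (fun b1 w => Dsum h b1 (fun m n =>
    Phi f a (c1 ++ m' :: e) m (ydm Y n (act w (act w' n')))))))).
  apply: eq_ssum => c1 w' c1s; apply: eq_Dsumr => m' n'.
  by apply: (Dsum_braided _ bc hc br); apply: Fb.
rewrite ssum_Dsum; apply: eq_Dsumr => m' n'; rewrite PhiE ssum_cat.
under [RHS]eq_ssum do rewrite ssum_cat.
rewrite [RHS]ssum_exchange.
under [RHS]eq_ssum do rewrite ssum_exchange.
rewrite [RHS]ssum_exchange; apply: eq_ssum => c1 w3 c1s.
apply: eq_ssum => b1 w2 b1s.
transitivity (sw_sum a (fun a1 w1 => Dsum h b1 (fun m n => sw_sum a1 (fun a2 w =>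
  ydm Y (ydm Y (f (a2 ++ m :: c1 ++ m' :: e)) (act w n)) (act w1 (act w2 (act w3 n'))))))).
  rewrite ssum_Dsum; apply: eq_Dsumr => m n.
  rewrite (mul_assoc _ _ _ fc) //.
  by rewrite -ace /= size_cat /= c1s !addnS addnA.
apply: eq_ssum => a1 w1 a1s; rewrite -!catA fhE ?b1s //; last first.
  by rewrite size_cat /= c1s addnS.
have Hl : linear (fun x => ydm Y x (act (w1 * (w2 * w3)) n')) by lin.
rewrite (lin_Dsum _ _ _ _ Hl); apply: eq_Dsumr => m n.
by rewrite PhiE (lin_ssum _ _ _ Hl) !actM.
Qed.
End Composition.

Lemma split_seq (T : Type) m (s : seq T) : (m <= size s)%N ->
  exists s1 s2, s = s1 ++ s2 /\ size s1 = m.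
Proof.
by move=> ms; exists (take m s), (drop m s); rewrite cat_take_drop size_takel.
Qed.

(** * Balancing of an insertion in all its arguments *)

Section InsertionMulti.
Variables (k : comNzRingType) (A U : algType k) (B : left_bialgebroid A U).
Variables (N : lmodType U) (Y : yd_algebra B N).
Local Notation t := (tgt B).
Local Notation M := (resk N).
Implicit Types (V : lmodType k) (f g h : seq U -> M).
Implicit Types us vs a b e : seq U.

Local Notation sw_sum := (@sw_sum k A U B _).
Local Notation mbal := (mbal B).
Local Notation admissible := (admissible B).
Local Notation multi := (@multi _ _ _ B N).
Local Notation Dsum := (Dsum Y).
Local Notation ins := (ins Y).
Local Notation Phi := (Phi Y).

Lemma mbal_Dsum V n g vs (F : seq U -> U -> M -> V) :
  (forall m x, mbal n (fun us => F us m x)) -> mbal n (fun us => Dsum g vs (F us)).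
Proof.
move=> Fm; split=> [l r e|l u a v r e].
  by apply: Dsum_family => m x; case: (Fm m x) => F1 _; apply: F1.
by apply: eq_Dsumr => m x; case: (Fm m x) => _; apply.
Qed.

Lemma mbal_ssum V n vs (F : seq U -> seq U -> U -> V) :
  (forall vs1 w, size vs1 = size vs -> mbal n (fun us => F us vs1 w)) ->
  mbal n (fun us => sw_sum vs (F us)).
Proof.
move=> Fm; split=> [l r e|l u a v r e].
  by apply: ssum_family => vs1 w /(Fm _ w) [F1 _]; apply: F1.
by apply: eq_ssum => vs1 w /(Fm _ w) [_]; apply.
Qed.

Section Ins.
Variables (p q : nat) (f g : seq U -> M).
Hypotheses (fc : multi p f) (gc : multi q g).

Lemma mul_admissible' us m vs n : (size us + size vs).+1 = p ->
  admissible (size us) (fun us1 w => ydm Y (f (us1 ++ m :: vs)) (act w n)).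
Proof. by move=> e; apply: (mul_admissible _ _ fc); rewrite /= addnS. Qed.

Lemma ins_mbal1 a b e : (size a + size e).+1 = p ->
  mbal (size a) (fun us => ins f g us b e).
Proof. by move=> ae; apply: mbal_Dsum => m n; apply/ssum_mbal/mul_admissible'. Qed.

Lemma ins_mbal2 a e : (size a + size e).+1 = p -> mbal q (fun us => ins f g a us e).
Proof. by move=> ae; apply: (Dsum_mbal Y gc); apply: Phi_balanced fc ae. Qed.

Lemma ins_mbal3 a b e : (size a + size e).+1 = p ->
  mbal (size e) (fun us => ins f g a b us).
Proof.
move=> ae; apply: mbal_Dsum => m n; apply: mbal_ssum => us1 w us1s.
apply: (mbal_lin (h := fun x => ydm Y x (act w n))); first by lin.
apply: (mbal_ext (f := fun us => f (rcons us1 m ++ us))).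
  by move=> us _; rewrite cat_rcons.
by apply: mbal_catl; rewrite size_rcons us1s addSn ae; case: fc.
Qed.

(** With [Phi_next], [Phi_head] and [Phi_nil], this records how [t(x)] crosses the boundaries of the
    slot of [f]. *)
Lemma Phi_last a u x e m n : (size a + size e).+2 = p ->
  Phi f (rcons a (u * t x)) e m n = Phi f (rcons a u) e m (act (t x) n).
Proof.
move=> ae; rewrite PhiE.
rewrite (@ssum_last _ _ _ _ _ (size a).+1 (fun us1 w => ydm Y (f (us1 ++ m :: e)) (act w n))) //.
  by apply: eq_ssum => us1 w _; rewrite actM.
have := @mul_admissible' (rcons a 0) m e n; rewrite size_rcons; apply.
by rewrite addSn.
Qed.

Lemma Phi_next a v x e m n : (size a + size e).+2 = p ->
  Phi f a (v :: e) (m * t x) n = Phi f a (t x * v :: e) m n.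
Proof.
move=> ae; apply: eq_ssum => us1 w us1s; case: fc => -[_ ->] //.
by rewrite us1s.
Qed.

Lemma Phi_head a u x e m n : (size a + size e).+2 = p ->
  Phi f (t x * u :: a) e m n = act (t x) (Phi f (u :: a) e m n).
Proof.
move=> ae; rewrite PhiE.
rewrite (@ssum_head _ _ _ _ _ (size a).+1 (fun us1 w => ydm Y (f (us1 ++ m :: e)) (act w n))) //.
  have Hl : linear (act (t x) : M -> M) by lin.
  by rewrite PhiE (lin_ssum _ _ _ Hl); apply: eq_ssum => us1 w _; rewrite actM ydm_ract.
have := @mul_admissible' (rcons a 0) m e n; rewrite size_rcons; apply.
by rewrite addSn.
Qed.

Lemma Phi_nil x e m n :
  Phi f [::] e m (act (t x) n) = act (t x) (Phi f [::] e m n) :> M.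
Proof. by rewrite !PhiE !ssum_nil !act1 ydm_ract. Qed.

(** By cases on where the affected arguments lie relative to the inserted block. Inside [a], [b] or
    [e], one of the [ins_mbal] lemmas applies; across a boundary, [t(x)] is passed on through one of
    the two components of [D_g]. *)
Lemma multi_ins i n fg : (i < p)%N -> n.+1 = (p + q)%N ->
  (forall a b e, size a = i -> size b = q -> (i + size e).+1 = p ->
     fg (a ++ b ++ e) = ins f g a b e) ->
  multi n fg.
Proof.
move=> ip npq fgE; split; last first.
  move=> x u us e.
  have act_lin : linear (act (t x) : M -> M) by lin.
  case: i ip fgE => [|i] ip fgE.
    (* For [q = 0] the block is empty, so [t(x)] meets the coaction of [g [::]] directly and
       [Csum_tak] takes over the role of [Dsum_head]. *)
    case: (posnP q) => [q0|q_gt0].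
      have E v : fg (v :: us) = ins f g [::] [::] (v :: us).
        by rewrite -fgE //= ?q0 //; lia.
      have ue : (size us).+2 = p by lia.
      rewrite !E !insE !Dsum_nil.
      under eq_tsum do rewrite -Phi_next //.
      rewrite Csum_tak; last by apply: Phi_balanced fc _ => /=.
      rewrite (lin_tsum _ _ act_lin).
      by apply: eq_tsum => m y; rewrite Phi_nil.
    have [|b [e' [usE bs]]] := @split_seq _ q.-1 us; first by lia.
    move: e; rewrite usE size_cat => e.
    have E v : fg (v :: b ++ e') = ins f g [::] (v :: b) e'.
      by rewrite -fgE //=; lia.
    rewrite !E !insE (Dsum_head Y _ _ gc); [|by apply: Phi_balanced fc _ => /=; lia|by lia].
    by rewrite (lin_Dsum _ _ _ _ act_lin); apply: eq_Dsumr => m y; rewrite Phi_nil.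
  have [|a [e' [usE sa]]] := @split_seq _ i us; first by lia.
  have [|b [e'' [e'E sb]]] := @split_seq _ q e'; first by move: e; rewrite usE size_cat; lia.
  move: e; rewrite usE e'E !size_cat => e.
  have E v : fg (v :: a ++ b ++ e'') = ins f g (v :: a) b e''.
    by rewrite -fgE //=; lia.
  rewrite !E !insE (lin_Dsum _ _ _ _ act_lin); apply: eq_Dsumr => m y.
  by rewrite Phi_head //; lia.
split=> [l r e|l u x v r e].
  case: (ltnP (size l) i) => [li|il].
    have [|a [e' [rE sa]]] := @split_seq _ (i - size l).-1 r; first by lia.
    have [|b [e'' [e'E sb]]] := @split_seq _ q e'; first by move: e; rewrite rE size_cat; lia.
    move: e; rewrite rE e'E !size_cat => e.
    have E v : fg (l ++ v :: a ++ b ++ e'') = ins f g (l ++ v :: a) b e''.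
      by rewrite -fgE -?catA // ?size_cat /=; lia.
    move=> c y z; rewrite !E.
    have := @ins_mbal1 (l ++ 0 :: a) b e''; rewrite size_cat /= => -[|+ _]; first by lia.
    by move=> /(_ l a); apply; lia.
  have [|a [b' [lE sa]]] := @split_seq _ i l; first by lia.
  case: (ltnP (size l) (i + q)) => [lq|ql].
    have [|b [e' [rE sb]]] := @split_seq _ (i + q - size l).-1 r; first by lia.
    move: e il lq sb; rewrite rE lE !size_cat => e il lq sb.
    have E v : fg ((a ++ b') ++ v :: b ++ e') = ins f g a (b' ++ v :: b) e'.
      by rewrite -fgE -?catA // ?size_cat /=; lia.
    move=> c y z; rewrite !E.
    have [|+ _] := @ins_mbal2 a e'; first by lia.
    by move=> /(_ b' b); apply; lia.
  have [|b [e' [b'E sb]]] := @split_seq _ q b'; first by move: e ql; rewrite lE !size_cat; lia.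
  move: e ql; rewrite lE b'E !size_cat => e ql.
  have E v : fg ((a ++ b ++ e') ++ v :: r) = ins f g a b (e' ++ v :: r).
    by rewrite -fgE -?catA // ?size_cat /=; lia.
  move=> c y z; rewrite !E.
  have := @ins_mbal3 a b (e' ++ 0 :: r); rewrite size_cat /= => -[|+ _]; first by lia.
  by move=> /(_ e' r); apply; lia.
case: (ltnP (size l).+1 i) => [li|il].
  have [|a [e' [rE sa]]] := @split_seq _ (i - size l).-2 r; first by lia.
  have [|b [e'' [e'E sb]]] := @split_seq _ q e'; first by move: e; rewrite rE size_cat; lia.
  move: e; rewrite rE e'E !size_cat => e.
  have E u' v' : fg (l ++ u' :: v' :: a ++ b ++ e'') = ins f g (l ++ u' :: v' :: a) b e''.
    by rewrite -fgE -?catA // ?size_cat /=; lia.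
  rewrite !E.
  have := @ins_mbal1 (l ++ 0 :: 0 :: a) b e''; rewrite size_cat /= => -[|_]; first by lia.
  by apply; lia.
case: (ltnP (size l) i) => [li|{}il].
  (* [u] is the last argument before the slot; [v] begins the block or, if the block is empty, the
     remaining arguments. *)
  have lE : i = (size l).+1 by lia.
  case: (posnP q) => [q0|q_gt0].
    have E u' v' : fg (l ++ u' :: v' :: r) = ins f g (rcons l u') [::] (v' :: r).
      by rewrite -fgE ?cat_rcons ?size_rcons //=; lia.
    rewrite !E !insE !Dsum_nil.
    under eq_tsum do (rewrite Phi_last; last by rewrite /=; lia).
    under [RHS]eq_tsum do (rewrite -Phi_next; last by rewrite size_rcons; lia).
    by rewrite Csum_tak //; apply: Phi_balanced fc _; rewrite size_rcons /=; lia.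
  have [|b [e' [rE sb]]] := @split_seq _ q.-1 r; first by lia.
  move: e; rewrite rE !size_cat => e.
  have E u' v' : fg (l ++ u' :: v' :: b ++ e') = ins f g (rcons l u') (v' :: b) e'.
    by rewrite -fgE ?cat_rcons ?size_rcons //=; lia.
  rewrite !E !insE (Dsum_head Y _ _ gc); [|by apply: Phi_balanced fc _; rewrite size_rcons; lia|by lia].
  by apply: eq_Dsumr => m y; rewrite Phi_last //; lia.
have [|a [b' [lE sa]]] := @split_seq _ i l; first by lia.
case: (ltnP (size l).+1 (i + q)) => [lq|ql].
  have [|b [e' [rE sb]]] := @split_seq _ (i + q - size l).-2 r; first by lia.
  move: e il lq sb; rewrite rE lE !size_cat => e il lq sb.
  have E u' v' : fg ((a ++ b') ++ u' :: v' :: b ++ e') = ins f g a (b' ++ u' :: v' :: b) e'.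
    by rewrite -fgE -?catA // ?size_cat /=; lia.
  rewrite !E.
  have [|_] := @ins_mbal2 a e'; first by lia.
  by apply; lia.
(* In the first case [u] ends the block and [v] begins the remaining arguments. *)
case: (ltnP (size l) (i + q)) => [lq|{}ql].
  move: e il lq ql; rewrite lE !size_cat => e il lq ql.
  have E u' v' : fg ((a ++ b') ++ u' :: v' :: r) = ins f g a (rcons b' u') (v' :: r).
    by rewrite -fgE -?catA ?cat_rcons // ?size_rcons /=; lia.
  have sb : (size b').+1 = q by lia.
  rewrite !E !insE (Dsum_last Y _ _ gc) //; last by apply: Phi_balanced fc _ => /=; lia.
  by apply: eq_Dsumr => m y; rewrite Phi_next //; lia.
have [|b [e' [b'E sb]]] := @split_seq _ q b'; first by move: e ql; rewrite lE !size_cat; lia.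
move: e ql; rewrite lE b'E !size_cat => e ql.
have E u' v' : fg ((a ++ b ++ e') ++ u' :: v' :: r) = ins f g a b (e' ++ u' :: v' :: r).
  by rewrite -fgE -?catA // ?size_cat /=; lia.
rewrite !E.
have := @ins_mbal3 a b (e' ++ 0 :: 0 :: r); rewrite size_cat /= => -[|_]; first by lia.
by apply; lia.
Qed.
End Ins.
End InsertionMulti.

(** * The cochain [mu] and the terms of the coboundary *)

Section Multiplication.
Variables (k : comNzRingType) (A U : algType k) (B : left_bialgebroid A U).
Variables (N : lmodType U) (Y : yd_algebra B N).
Local Notation s := (src B).
Local Notation t := (tgt B).
Local Notation M := (resk N).
Implicit Types (V : lmodType k) (f g h : seq U -> M).
Implicit Types us vs a b e : seq U.

Local Notation balU := (balanced (fun (u : U) (x : A) => t x * u) (lactU B)).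
Local Notation balN := (balanced (fun (u : U) (x : A) => t x * u) (@lactN _ _ _ B N)).
Local Notation sw_sum := (@sw_sum k A U B _).
Local Notation admissible := (admissible B).
Local Notation multi := (@multi _ _ _ B N).
Local Notation Dsum := (Dsum Y).
Local Notation ins := (ins Y).
Local Notation one := (ydone Y : M).

Lemma ydm1l n : ydm Y one n = n. Proof. exact: ydmul1l. Qed.
Lemma ydm1r n : ydm Y n one = n. Proof. exact: ydmul1r. Qed.
Lemma act_one_s u : act u one = act (s (eps B u)) one. Proof. exact: yd_act1l. Qed.

Lemma act_one_t x : act (t x) one = act (s x) one.
Proof. by rewrite act_one_s eps_tgt. Qed.

Definition mu us : M := if us is [:: u; v] then act (s (eps B (u * v))) one else 0.

Lemma multi_mu : multi 2 mu.
Proof.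
split=> [|x u [|v [|]] //= _]; last first.
  rewrite /mu -mulrA eps_t rmorphM actM -(act_one_t x) -!actM.
  by rewrite src_tgtC.
split=> [l r|l u x v r].
  by case: l => [|u [|v l]] //=; case: r => [|v' [|v'' r]] //= _; rewrite /mu; lin.
case: l => [|u' l] //= [] /eqP; rewrite size_eq0 => /eqP ->.
by rewrite /mu /= mulrA.
Qed.

(** Since [coact 1 = 1 ⊗ 1], the coaction of [s(eps(u1 v1)) 1_N] contributes only the factor
    [s(eps(u1 v1))], which the counit law merges with [u2 v2]. *)
Lemma Dsum_mu V u v (F : U -> M -> V) : balN F -> Dsum mu [:: u; v] F = F (u * v) one.
Proof.
move=> Fb; rewrite DsumE ssum_tcons.
have Gb : balU (fun x y => F (s (eps B x) * y) one).
  split; [by lin|by lin|move=> x a y].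
  by rewrite eps_t rmorphM mulrA.
rewrite -[RHS](@Dsum_counitl _ _ _ B _ (fun x => F x one)); last by lin.
rewrite (DsumM _ _ Gb); apply: eq_tsum => u1 u2; rewrite ssum_tcons.
apply: eq_tsum => v1 v2; rewrite ssum_nil Csum_lact; last exact: balN_mulr.
rewrite (@Csum_one _ _ _ _ _ _ _ (fun m n => F (s (eps B (u1 * v1)) * m * (u2 * (v2 * 1))) n)).
  by rewrite !mulr1.
split; [by lin|by lin|move=> m x n].
by case: Fb => _ _ Fb; rewrite mulrA src_tgtC -mulrA -mulrA Fb mulrA.
Qed.

(** By [epsMt], [eps (m * w)] depends on [w] only through [t (eps w)], so [yd_ract] turns the
    coaction into [t (eps w)] acting on the value; the counit law of the diagonal then removes the
    second legs. *)
Lemma Dsum_counit f us q : multi q f -> size us = q ->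
  Dsum f us (fun m n => act (s (eps B m)) n) = f us.
Proof.
move=> [f1 f2] e.
have Fa : admissible (size us) (fun us w => act (t (eps B w)) (f us)).
  split=> [w|us1 us1s|x u us1 w us1s].
  - by rewrite e; apply: (mbal_lin (h := act _)) f1; lin.
  - by lin.
  - by rewrite f2 -?e // -actM -tgtM eps_s.
rewrite -[RHS]act1 -(tgt1 B) -(eps1 B) -[RHS](ssum_counit Fa) DsumE.
apply: eq_ssum => us1 w us1s; rewrite eps_src.
rewrite -(@Csum_ract1 _ _ _ _ _ Y _ (fun x => x)) //.
by apply: eq_tsum => m n; rewrite epsMt.
Qed.

Lemma mu_actE m v n : ydm Y (mu [:: m; v]) n = act (s (eps B (m * v))) n.
Proof. by rewrite /mu /= ydm_lact ydm1l. Qed.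

Lemma eps_mul_balN v : balN (fun m n => act (s (eps B (m * v))) n).
Proof.
split; [by lin|by lin|move=> m x n].
by rewrite -mulrA eps_t rmorphM actM.
Qed.

(** This, [ins_mu_l0], [ins_mu_r] and [ins_mu] evaluate insertions involving [mu]: they are the last
    term of the coboundary in positive degree and in degree 0, the first term, and the inner
    terms. *)
Lemma ins_mu_l f q a u v : multi q f -> (size a).+1 = q ->
  ins mu f [::] (rcons a u) [:: v] = f (rcons a (u * t (eps B v))).
Proof.
move=> fc e; rewrite insE.
rewrite -[RHS](Dsum_counit fc); last by rewrite size_rcons.
have E1 := eps_mul_balN 1.
rewrite (@Dsum_last _ _ _ _ _ _ _ q _ (fun m n => act (s (eps B m)) n)) //.
  by apply: eq_Dsumr => m n; rewrite PhiE ssum_nil act1 mu_actE epsMt.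
by have := eps_mul_balN 1; under [X in balanced _ _ X]eq_fun do under eq_fun do rewrite mulr1.
Qed.

Lemma ins_mu_l0 f v : ins mu f [::] [::] [:: v] = act (t (eps B v)) (f [::]).
Proof.
rewrite insE Dsum_nil -(@Csum_ract1 _ _ _ _ _ Y _ (fun x => x)) //.
by apply: eq_tsum => m n; rewrite PhiE ssum_nil act1 mu_actE epsMt.
Qed.

Lemma ins_mu_r f q u b : multi q f -> size b = q -> ins mu f [:: u] b [::] = act u (f b).
Proof.
move=> fc e; rewrite -[f b](Dsum_counit fc) //.
have Hl : linear (act u : M -> M) by lin.
rewrite (lin_Dsum _ _ _ _ Hl); apply: eq_Dsumr => m n.
rewrite PhiE ssum_tcons; under eq_tsum do rewrite ssum_nil mulr1 mu_actE epsMt.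
rewrite (@Dsum_tak _ _ _ _ _ (fun x y => act (s (eps B x)) (act y n))).
  under eq_tsum do rewrite -actM mulrA.
  by rewrite (@Dsum_counitl _ _ _ _ _ (fun x => act (x * s (eps B m)) n)) ?actM //; lin.
split; [by lin|by lin|move=> x y z].
by rewrite eps_t rmorphM !actM.
Qed.

Lemma ins_mu f p a u v e : multi p f -> (size a + size e).+1 = p ->
  ins f mu a [:: u; v] e = f (a ++ u * v :: e).
Proof.
move=> fc ae; rewrite insE Dsum_mu; last exact: Phi_balanced fc ae.
have Fa := @mul_admissible _ _ _ _ _ Y p f a (u * v :: e) one fc.
rewrite PhiE -[RHS]ydm1r -[one in RHS]act1 -(ssum_counit (Fa _)); last by rewrite /= addnS.
by apply: eq_ssum => us1 w _; rewrite -act_one_s.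
Qed.

Lemma ssum_tak V us u x (F : seq U -> U -> V) : admissible (size us).+1 F ->
  sw_sum us (fun us1 w => \tsum_(u1 ; u2 <- Delta B u) F (rcons us1 (u1 * t x)) (w * u2)) =
  sw_sum us (fun us1 w => \tsum_(u1 ; u2 <- Delta B u) F (rcons us1 u1) (w * (u2 * s x))).
Proof.
rewrite -addn1 => /admissible_cat Fa; rewrite !ssum_tsum.
have := @admissible_balU _ _ _ _ _ _ _ [::] 1 Fa erefl => /(Dsum_tak x u).
under eq_tsum do under eq_ssum do rewrite mulr1 cats1.
by under [X in _ = X -> _]eq_tsum do under eq_ssum do rewrite mulr1 cats1.
Qed.

Definition rcup f g a b : M := sw_sum a (fun a1 w => ydm Y (f a1) (act w (g b))).

(** The cup product is [mu] with [f] and [g] inserted. Once [g b] is written by [Dsum_counit], the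
    factor [s(eps m)] acting on [n] passes to the last argument of [f] as [t(eps m)] by the Takeuchi
    condition, and this is the value of [mf] with last argument [m]. *)
Lemma ins_cup p q f g mf a b : multi p f -> multi q g -> size a = p -> size b = q ->
  (forall a1 v, size a1 = p -> mf (a1 ++ [:: v]) = ins mu f [::] a1 [:: v]) ->
  ins mf g a b [::] = rcup f g a b.
Proof.
move=> fc gc ap bq mfE.
rewrite /rcup -[g b](Dsum_counit gc) // insE.
transitivity (Dsum g b (fun m n => sw_sum a (fun a1 w => ydm Y (f a1) (act w (act (s (eps B m)) n))))).
  apply: eq_Dsumr => m n; rewrite PhiE.
  case/lastP: a ap => [|a u] ap.
    by rewrite !ssum_nil !act1 (mfE [::]) // ins_mu_l0 ydm_bal.
  rewrite -cats1 !ssum_cat.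
  have Fa := @mul_admissible _ _ _ _ _ Y p f (rcons a u) [::] n fc.
  have /Fa {}Fa : (size (rcons a u) + size (Nil U))%N = p by rewrite addn0.
  rewrite size_rcons in Fa ap.
  have := ssum_tak u (eps B m) Fa.
  under eq_ssum => a1 w a1s.
    under eq_tsum do rewrite cats0 -(ins_mu_l _ _ fc) ?a1s // -mfE ?size_rcons ?a1s //.
    over.
  move=> E; transitivity (sw_sum a (fun a1 w => \tsum_(u1 ; u2 <- Delta B u)
    ydm Y (mf (rcons a1 u1 ++ [:: m])) (act (w * u2) n))).
    apply: eq_ssum => a1 w a1s; rewrite ssum_tcons; apply: eq_tsum => u1 u2.
    by rewrite ssum_nil mulr1 (cats1 a1).
  rewrite E; apply: eq_ssum => a1 w a1s; rewrite ssum_tcons; apply: eq_tsum => u1 u2.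
  by rewrite ssum_nil mulr1 (cats1 a1) cats0 -actM mulrA.
rewrite -ssum_Dsum; apply: eq_ssum => a1 w _.
have Hl : linear (fun x => ydm Y (f a1) (act w x)) by lin.
by symmetry; apply: (lin_Dsum _ _ _ _ Hl).
Qed.

Lemma rcup1r p f a : multi p f -> size a = p -> rcup f (fun _ => one) a [::] = f a.
Proof.
move=> fc ap.
have Fa := @mul_admissible _ _ _ _ _ Y p f a [::] one fc.
have /Fa {}Fa : (size a + size (Nil U))%N = p by rewrite addn0.
have := ssum_counit Fa; rewrite cats0 act1 ydm1r => <-.
by apply: eq_ssum => a1 w _; rewrite cats0 -act_one_s.
Qed.

End Multiplication.

Section TrivialExtension.
Variables (k : comNzRingType) (T : lmodType k).

(* The square-zero extension of k by T, which allows to prove identities in T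
   with the tactic [ring]. *)
Definition sqz : Type := (k * T)%type.
HB.instance Definition _ := Choice.on sqz.
HB.instance Definition _ := GRing.Zmodule.copy sqz (k * T)%type.

Definition sqz_mul (x y : sqz) : sqz := (x.1 * y.1, x.1 *: y.2 + y.1 *: x.2).
Definition sqz_one : sqz := (1, 0).

Lemma sqz_mulA : associative sqz_mul.
Proof.
move=> [a x] [b y] [c z]; rewrite /sqz_mul /= mulrA; congr (_, _).
by rewrite !scalerDr !scalerA addrA [c * a]mulrC [c * b]mulrC.
Qed.
Lemma sqz_mulC : commutative sqz_mul.
Proof. by move=> [a x] [b y]; rewrite /sqz_mul /= mulrC addrC. Qed.
Lemma sqz_mul1 : left_id sqz_one sqz_mul.
Proof. by move=> [a x]; rewrite /sqz_mul /= mul1r scale1r scaler0 addr0. Qed.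
Lemma sqz_mulDl : left_distributive sqz_mul +%R.
Proof.
move=> [a x] [b y] [c z]; rewrite /sqz_mul /=; congr (_, _).
  by rewrite mulrDl.
by rewrite scalerDl scalerDr addrACA.
Qed.
Lemma sqz_one_neq0 : sqz_one != 0.
Proof. by apply/eqP => -[] /eqP; rewrite oner_eq0. Qed.
HB.instance Definition _ := GRing.Zmodule_isComNzRing.Build sqz
  sqz_mulA sqz_mulC sqz_mul1 sqz_mulDl sqz_one_neq0.

Definition sqz_in (x : T) : sqz := (0, x).
Definition sqz_sc (c : k) : sqz := (c, 0).

Lemma sqz_inj : injective sqz_in. Proof. by move=> x y []. Qed.
Lemma sqz_inD x y : sqz_in (x + y) = sqz_in x + sqz_in y.
Proof. by congr (_, _); rewrite addr0. Qed.
Lemma sqz_inN x : sqz_in (- x) = - sqz_in x.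
Proof. by congr (_, _); rewrite oppr0. Qed.
Lemma sqz_in0 : sqz_in 0 = 0. Proof. by []. Qed.
Lemma sqz_inZ c x : sqz_in (c *: x) = sqz_sc c * sqz_in x.
Proof. by rewrite /sqz_in /sqz_sc -[RHS]/(_, _) /= mulr0 scale0r addr0. Qed.
Lemma sqz_scM c d : sqz_sc (c * d) = sqz_sc c * sqz_sc d.
Proof. by rewrite -[RHS]/(_, _) /= !scaler0 addr0. Qed.
Lemma sqz_scD c d : sqz_sc (c + d) = sqz_sc c + sqz_sc d.
Proof. by congr (_, _); rewrite addr0. Qed.
Lemma sqz_scN c : sqz_sc (- c) = - sqz_sc c.
Proof. by congr (_, _); rewrite oppr0. Qed.
Lemma sqz_sc1 : sqz_sc 1 = 1. Proof. by []. Qed.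
Lemma sqz_sc0 : sqz_sc 0 = 0. Proof. by []. Qed.
Definition sqzE := (sqz_inD, sqz_inN, sqz_in0, sqz_inZ, sqz_scM, sqz_scD, sqz_scN, sqz_sc1, sqz_sc0).
End TrivialExtension.

Ltac modring := apply: sqz_inj; rewrite ?sqzE; ring.

(** * Operads with multiplication *)

(* A nonsymmetric operad with multiplication; [o_part O q i f g] is the partial
   composition f o_(i+1) g, where q is the arity of g. *)
Record mult_operad (k : comNzRingType) (T : lmodType k) := MultOperad {
  o_dom :> nat -> T -> Prop;
  o_part : nat -> nat -> T -> T -> T;
  o_mu : T;
  o_dom0 : forall p, o_dom p 0;
  o_dom_lin : forall p c f g, o_dom p f -> o_dom p g -> o_dom p (c *: f + g);
  o_dom_part : forall p q n i f g, o_dom p f -> o_dom q g -> (i < p)%N ->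
    n.+1 = (p + q)%N -> o_dom n (o_part q i f g);
  o_linl : forall p q i c f f' g, o_dom p f -> o_dom p f' -> o_dom q g -> (i < p)%N ->
    o_part q i (c *: f + f') g = c *: o_part q i f g + o_part q i f' g;
  o_linr : forall p q i c f g g', o_dom p f -> o_dom q g -> o_dom q g' -> (i < p)%N ->
    o_part q i f (c *: g + g') = c *: o_part q i f g + o_part q i f g';
  o_nested : forall p q r i j f g h, o_dom p f -> o_dom q g -> o_dom r h ->
    (i < p)%N -> (j < q)%N ->
    o_part r (i + j) (o_part q i f g) h = o_part (q + r).-1 i f (o_part r j g h);
  o_disjoint : forall p q r i j f g h, o_dom p f -> o_dom q g -> o_dom r h ->
    (i <= j)%N -> (j.+1 < p)%N ->
    o_part r i (o_part q j.+1 f g) h = o_part q (j + r) (o_part r i f h) g;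
  o_dom_mu : o_dom 2 o_mu;
  o_mu_assoc : o_part 2 0 o_mu o_mu = o_part 2 1 o_mu o_mu }.

Section OperadTheory.
Variables (k : comNzRingType) (T : lmodType k) (O : mult_operad T).
Local Notation C := (o_dom O).
Local Notation o := (o_part O).
Implicit Types (f g h : T) (p q r m n i j a b : nat).

Definition signk n : k := (-1) ^+ n.

Lemma sgP n : signk n = 1 \/ signk n = -1.
Proof. by rewrite /signk -(signr_odd k n); case: odd; [right|left]. Qed.
Lemma sg_sq n : signk n * signk n = 1.
Proof. by case: (sgP n) => ->; rewrite ?mulrNN mulr1. Qed.
Lemma sgD m n : signk (m + n) = signk m * signk n. Proof. exact: exprD. Qed.
Lemma sgS n : signk n.+1 = - signk n. Proof. by rewrite /signk exprS mulN1r. Qed.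
Lemma sg_odd m n : odd m = odd n -> signk m = signk n.
Proof. by rewrite /signk -(signr_odd k m) -(signr_odd k n) => ->. Qed.

Lemma domZ p c f : C p f -> C p (c *: f).
Proof. by move=> Cf; rewrite -[_ *: _]addr0; apply/o_dom_lin/o_dom0. Qed.
Lemma domD p f g : C p f -> C p g -> C p (f + g).
Proof. by move=> Cf Cg; rewrite -[f]scale1r; apply: o_dom_lin. Qed.
Lemma domN p f : C p f -> C p (- f).
Proof. by rewrite -scaleN1r; apply: domZ. Qed.
Lemma domB p f g : C p f -> C p g -> C p (f - g).
Proof. by move=> Cf /domN; apply: domD. Qed.
Lemma dom_sum p I (r : seq I) (P : pred I) (F : I -> T) :
  (forall x, P x -> C p (F x)) -> C p (\sum_(x <- r | P x) F x).
Proof. by move=> CF; apply: big_ind => //; [apply: o_dom0|apply: domD]. Qed.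

Lemma o0l p q i g : C q g -> o q i 0 g = 0.
Proof.
move=> Cg; have := @o_linl _ _ O i.+1 q i (-1) 0 0 g (o_dom0 _ _) (o_dom0 _ _) Cg (ltnSn i).
by rewrite scaler0 addr0 scaleN1r addNr.
Qed.
Lemma o0r p q i f : C p f -> (i < p)%N -> o q i f 0 = 0.
Proof.
move=> Cf ip; have := @o_linr _ _ O p q i (-1) f 0 0 Cf (o_dom0 _ _) (o_dom0 _ _) ip.
by rewrite scaler0 addr0 scaleN1r addNr.
Qed.
Lemma oZl p q i c f g : C p f -> C q g -> (i < p)%N -> o q i (c *: f) g = c *: o q i f g.
Proof.
move=> Cf Cg ip; have := o_linl c Cf (o_dom0 O p) Cg ip.
by rewrite !addr0 (o0l p) // addr0.
Qed.
Lemma oDl p q i f f' g : C p f -> C p f' -> C q g -> (i < p)%N ->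
  o q i (f + f') g = o q i f g + o q i f' g.
Proof. by move=> Cf Cf' Cg ip; have := o_linl 1 Cf Cf' Cg ip; rewrite !scale1r. Qed.
Lemma oZr p q i c f g : C p f -> C q g -> (i < p)%N -> o q i f (c *: g) = c *: o q i f g.
Proof.
move=> Cf Cg ip; have := o_linr c Cf Cg (o_dom0 O q) ip.
by rewrite !addr0 (o0r _ Cf) // addr0.
Qed.
Lemma oDr p q i f g g' : C p f -> C q g -> C q g' -> (i < p)%N ->
  o q i f (g + g') = o q i f g + o q i f g'.
Proof. by move=> Cf Cg Cg' ip; have := o_linr 1 Cf Cg Cg' ip; rewrite !scale1r. Qed.
Lemma o_sumr p q i f I (r : seq I) (P : pred I) (F : I -> T) : C p f -> (i < p)%N ->
  (forall x, P x -> C q (F x)) -> o q i f (\sum_(x <- r | P x) F x) = \sum_(x <- r | P x) o q i f (F x).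
Proof.
move=> Cf ip CF; have : C q (\sum_(x <- r | P x) F x) /\
    o q i f (\sum_(x <- r | P x) F x) = \sum_(x <- r | P x) o q i f (F x); last by case.
elim/big_rec2: _ => [|j x y Pj [Cy E]]; first by split; [apply: o_dom0|rewrite (o0r _ Cf)].
by split; [apply: domD => //; apply: CF|rewrite (oDr Cf) ?E //; apply: CF].
Qed.
Lemma o_suml p q i g I (r : seq I) (P : pred I) (F : I -> T) : C q g -> (i < p)%N ->
  (forall x, P x -> C p (F x)) -> o q i (\sum_(x <- r | P x) F x) g = \sum_(x <- r | P x) o q i (F x) g.
Proof.
move=> Cg ip CF; have : C p (\sum_(x <- r | P x) F x) /\
    o q i (\sum_(x <- r | P x) F x) g = \sum_(x <- r | P x) o q i (F x) g; last by case.
elim/big_rec2: _ => [|j x y Pj [Cy E]]; first by split; [apply: o_dom0|rewrite (o0l p)].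
by split; [apply: domD => //; apply: CF|rewrite (@oDl p) ?E //; apply: CF].
Qed.

(* The sum of (-1)^(|g| i) x o_(a+i) g over i < n, with |g| = q - 1. *)
Definition osum q g a n (x : T) : T := \sum_(i < n) signk (q.+1 * i) *: o q (a + i) x g.

Lemma lsum0 q g a x : osum q g a 0 x = 0. Proof. exact: big_ord0. Qed.

Lemma lsumS q g a n x : osum q g a n.+1 x = o q a x g + signk q.+1 *: osum q g a.+1 n x.
Proof.
rewrite /osum big_ord_recl muln0 /signk expr0 scale1r addn0 scaler_sumr; congr (_ + _).
by apply: eq_bigr => i _; rewrite scalerA -exprD mulnS -addSnnS.
Qed.

Lemma lsumD q g a n n' x :
  osum q g a (n + n') x = osum q g a n x + signk (q.+1 * n) *: osum q g (a + n) n' x.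
Proof.
rewrite /osum big_split_ord /= scaler_sumr; congr (_ + _).
by apply: eq_bigr => i _; rewrite scalerA -sgD mulnDr addnA.
Qed.

Lemma lsumSr q g a n x :
  osum q g a n.+1 x = osum q g a n x + signk (q.+1 * n) *: o q (a + n) x g.
Proof. by rewrite -addn1 lsumD lsumS lsum0 scaler0 addr0. Qed.

(** The arity equation is conditional because an empty sum is 0, which lies in every arity, while
    [m + q] may then be 0. *)
Lemma lsum_dom m m' q g a n x : C m x -> C q g -> (a + n <= m)%N ->
  ((0 < n)%N -> m'.+1 = (m + q)%N) -> C m' (osum q g a n x).
Proof.
move=> Cx Cg anm e; apply: dom_sum => i _; apply: domZ.
by apply: (o_dom_part Cx Cg); [|apply: e]; have := ltn_ord i; lia.
Qed.

Lemma lsum_lin m q g a n c x y : C m x -> C m y -> C q g -> (a + n <= m)%N ->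
  osum q g a n (c *: x + y) = c *: osum q g a n x + osum q g a n y.
Proof.
move=> Cx Cy Cg anm; rewrite /osum scaler_sumr -big_split; apply: eq_bigr => i _ /=.
have im : (a + i < m)%N by have := ltn_ord i; lia.
by rewrite (o_linl _ Cx Cy) // scalerDr !scalerA mulrC.
Qed.

Lemma lsum_arg0 q g a n : C q g -> osum q g a n 0 = 0.
Proof. by move=> Cg; rewrite /osum big1 // => i _; rewrite (o0l 0) // scaler0. Qed.

Lemma lsum_nested m q r g h a b n x : C m x -> C q g -> C r h -> (a < m)%N -> (b + n <= q)%N ->
  osum r h (a + b) n (o q a x g) = o (q + r).-1 a x (osum r h b n g).
Proof.
move=> Cx Cg Ch am bnq; rewrite /osum (@o_sumr _ _ _ _ _ _ _ _ Cx am) => [|i _]; last first.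
  by apply/domZ/(o_dom_part Cg Ch); have := ltn_ord i; lia.
apply: eq_bigr => i _; have iq : (b + i < q)%N by have := ltn_ord i; lia.
have Cgh : C (q + r).-1 (o r (b + i) g h) by apply: (o_dom_part Cg Ch); lia.
rewrite (oZr _ Cx Cgh) //.
by rewrite -(o_nested Cx Cg Ch) // addnA.
Qed.

Lemma lsum_disjoint m q r g h a b n x : C m x -> C q g -> C r h -> (a <= b)%N -> (b.+1 + n <= m)%N ->
  osum r h (b + q) n (o q a x g) = o q a (osum r h b.+1 n x) g.
Proof.
move=> Cx Cg Ch ab bnm; case: n bnm => [|n] bnm; first by rewrite !lsum0 (o0l m).
have [m' m'E] : exists m', m'.+1 = (m + r)%N by exists (m + r).-1; lia.
rewrite /osum (@o_suml m') // => [||i _]; first 1 last.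
- by lia.
- by apply/domZ/(o_dom_part Cx Ch); have := ltn_ord i; lia.
apply: eq_bigr => i _; have im : (b.+1 + i < m)%N by have := ltn_ord i; lia.
have Cxh : C m' (o r (b.+1 + i) x h) by apply: (o_dom_part Cx Ch).
rewrite (oZl _ Cxh) //; last by lia.
rewrite addSn (o_disjoint Cx Ch Cg); [by rewrite addnAC|lia|lia].
Qed.
End OperadTheory.

(** Signs become functions of parities, so that [signs] can split on the parity of each variable and
    leave polynomial identities. *)
Definition sgb (k : comNzRingType) (b : bool) : k := if b then -1 else 1.
Lemma sgE (k : comNzRingType) n : signk k n = sgb k (odd n).
Proof. by rewrite /signk -(signr_odd k n); case: odd. Qed.

Ltac signs := rewrite ?sgE ?(oddM, oddD) /= ?(oddM, oddD) /=;
  repeat match goal with |- context [odd ?n] => case: (odd n) => /= end; rewrite /sgb.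

(** * The pre-Lie identity, the bracket and the Jacobi identity *)

Section OperadBracket.
Variables (k : comNzRingType) (T : lmodType k) (O : mult_operad T).
Local Notation C := (o_dom O).
Local Notation o := (o_part O).
Local Notation mu := (o_mu O).
Local Notation Cmu := (o_dom_mu O).
Local Notation sg := (signk k).
Local Notation lsum := (osum O).
Implicit Types (f g h x y : T) (p q r m n i j a b : nat).

Definition opl p q f g : T := lsum q g 0 p f.
(** The sign [(-1)^(|f||g|)]. The product [opl] omits it; in the bracket of cochains it occurs once
    on the first product and twice on the second, where it cancels, whence the asymmetric form of
    [obr]. *)
Definition okap p q : k := sg (p.+1 * q.+1).
Definition obr p q f g : T := okap p q *: opl p q f g - opl q p g f.
Definition ocup p q f g : T := o q p (o p 0 mu f) g.
(** The Hochschild differential: [o p 1 mu f] is the first term of the coboundary, [opl p 2 f mu]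
    collects the inner terms and [o p 0 mu f] is the last one. *)
Definition odel p f : T := o p 1 mu f - opl p 2 f mu + sg p.+1 *: o p 0 mu f.

Lemma pl_dom p q n f g : C p f -> C q g -> ((0 < p)%N -> n.+1 = (p + q)%N) -> C n (opl p q f g).
Proof. by move=> Cf Cg e; apply: (lsum_dom Cf Cg). Qed.

Lemma pl_dom' p q f g : C p f -> C q g -> C (p + q).-1 (opl p q f g).
Proof. by move=> Cf Cg; apply: pl_dom Cf Cg _; lia. Qed.

Lemma pl_arg0 p q g : C q g -> opl p q 0 g = 0.
Proof. exact: lsum_arg0. Qed.

(** Slot [a] is separated from the double sum: either [g] takes it, and then [h] goes into [g] or
    after it, or [g] goes further right and [h] takes slot [a] or leaves it too. *)
Lemma lsum_lsumS m q r g h a n x : C m x -> C q g -> C r h -> (a + n < m)%N ->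
  lsum r h a (n + q) (lsum q g a n.+1 x) =
  o (q + r).-1 a x (opl q r g h) + sg (r.+1 * q) *: o q a (lsum r h a.+1 n x) g
  + sg q.+1 *: o r a (lsum q g a.+1 n x) h
  + (sg q.+1 * sg r.+1) *: lsum r h a.+1 (n + q).-1 (lsum q g a.+1 n x).
Proof.
move=> Cx Cg Ch anm; set y := lsum q g a.+1 n x.
have CX : C (m + q).-1 (o q a x g) by apply: (o_dom_part Cx Cg); lia.
have Cy : C (m + q).-1 y by apply: (lsum_dom Cx Cg); lia.
rewrite lsumS -/y addrC (lsum_lin _ Cy CX Ch); last by lia.
have -> : lsum r h a (n + q) (o q a x g) =
    o (q + r).-1 a x (opl q r g h) + sg (r.+1 * q) *: o q a (lsum r h a.+1 n x) g.
  rewrite addnC lsumD (lsum_disjoint Cx Cg Ch); [|lia|lia].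
  by rewrite -[X in lsum r h X q _]addn0 (lsum_nested Cx Cg Ch) //; lia.
have -> : lsum r h a (n + q) y = o r a y h + sg r.+1 *: lsum r h a.+1 (n + q).-1 y.
  have [nq|] := posnP (n + q); last by case: (n + q)%N => // N _; rewrite lsumS.
  have y0 : y = 0 by rewrite /y (_ : n = 0%N) ?lsum0 //; lia.
  by rewrite nq !lsum0 y0 (o0l r) // scaler0 addr0.
modring.
Qed.

Lemma lsum_plS m q r g h a n x : C m x -> C q g -> C r h -> (a + n < m)%N ->
  lsum (q + r).-1 (opl q r g h) a n.+1 x =
  o (q + r).-1 a x (opl q r g h)
  + (sg q.+1 * sg r.+1) *: lsum (q + r).-1 (opl q r g h) a.+1 n x.
Proof.
move=> Cx Cg Ch anm; rewrite lsumS; congr (_ + _).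
(* For [q = 0] the truncated [(q + r).-1] may give the wrong sign, but then [opl q r g h] is 0. *)
case: q Cg => [|q] Cg; last by congr (_ *: _); signs; rewrite ?mulrNN ?mulr1 ?mul1r.
rewrite /opl lsum0 /osum !big1 ?scaler0 // => i _; rewrite (o0r _ Cx) ?scaler0 //;
  have := ltn_ord i; lia.
Qed.

(** The graded pre-Lie identity restricted to [n] consecutive slots of [x] from [a] on, which is the
    form that can be proved by induction. Inserting [g] into one of [n > 0] slots leaves
    [(n + q).-1] slots for [h]. *)
Lemma lsum_comm m q r g h a n x : C m x -> C q g -> C r h -> (a + n <= m)%N ->
  lsum r h a (n + q).-1 (lsum q g a n x) =
  lsum (q + r).-1 (opl q r g h) a n x
  + okap q r *: (lsum q g a (n + r).-1 (lsum r h a n x)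
                - lsum (q + r).-1 (opl r q h g) a n x).
Proof.
move=> Cx Cg Ch; elim: n a => [|n IHn] a anm.
  by rewrite !lsum0 !lsum_arg0 // subrr scaler0 addr0.
have anm' : (a + n < m)%N by lia.
rewrite [(n.+1 + q).-1]/= [(n.+1 + r).-1]/=.
rewrite (lsum_lsumS Cx Cg Ch anm') (lsum_lsumS Cx Ch Cg anm') (lsum_plS Cx Cg Ch anm').
rewrite [(q + r)%N in X in _ - X]addnC (lsum_plS Cx Ch Cg anm').
rewrite IHn; last by lia.
rewrite [(r + q)%N]addnC /okap.
signs; modring.
Qed.

Lemma pl_comm p q r f g h : C p f -> C q g -> C r h ->
  opl (p + q).-1 r (opl p q f g) h =
  opl p (q + r).-1 f (opl q r g h)
  + okap q r *: (opl (p + r).-1 q (opl p r f h) g - opl p (q + r).-1 f (opl r q h g)).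
Proof. by move=> Cf Cg Ch; apply: (lsum_comm Cf Cg Ch). Qed.

Lemma pl_linl p q c f f' g : C p f -> C p f' -> C q g ->
  opl p q (c *: f + f') g = c *: opl p q f g + opl p q f' g.
Proof. by move=> Cf Cf' Cg; apply: (lsum_lin _ Cf Cf' Cg). Qed.

Lemma pl_linr p q c f g g' : C p f -> C q g -> C q g' ->
  opl p q f (c *: g + g') = c *: opl p q f g + opl p q f g'.
Proof.
move=> Cf Cg Cg'; rewrite /opl /osum scaler_sumr -big_split; apply: eq_bigr => i _ /=.
rewrite (o_linr _ Cf Cg Cg'); last exact: ltn_ord.
by rewrite scalerDr !scalerA mulrC.
Qed.

Lemma pl_subl p q c f f' g : C p f -> C p f' -> C q g ->
  opl p q (c *: f - f') g = c *: opl p q f g - opl p q f' g.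
Proof.
move=> Cf Cf' Cg; rewrite pl_linl //; last exact: domN.
by rewrite -scaleN1r -[_ *: f']addr0 pl_linl ?pl_arg0 ?addr0 ?scaleN1r //; apply: o_dom0.
Qed.

Lemma pl_subr p q c f g g' : C p f -> C q g -> C q g' ->
  opl p q f (c *: g - g') = c *: opl p q f g - opl p q f g'.
Proof.
move=> Cf Cg Cg'; rewrite pl_linr //; last exact: domN.
congr (_ + _); have := pl_linr (-1) Cf Cg' (o_dom0 O q).
have -> : opl p q f 0 = 0.
  have := pl_linr (-1) Cf (o_dom0 O q) (o_dom0 O q).
  by rewrite scaler0 addr0 scaleN1r addNr.
by rewrite !addr0 !scaleN1r.
Qed.

Lemma br_dom p q n f g : C p f -> C q g -> n.+1 = (p + q)%N -> C n (obr p q f g).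
Proof.
move=> Cf Cg e; apply: domB; first by apply/domZ/pl_dom.
by apply: pl_dom Cg Cf _; lia.
Qed.

Lemma br_dom' p q f g : C p f -> C q g -> C (p + q).-1 (obr p q f g).
Proof.
move=> Cf Cg; apply: domB; first exact/domZ/pl_dom'.
by rewrite addnC; apply: pl_dom'.
Qed.

Lemma br_linl p q c f f' g : C p f -> C p f' -> C q g ->
  obr p q (c *: f + f') g = c *: obr p q f g + obr p q f' g.
Proof. by move=> Cf Cf' Cg; rewrite /obr pl_linl // pl_linr //; modring. Qed.

Lemma br_linr p q c f g g' : C p f -> C q g -> C q g' ->
  obr p q f (c *: g + g') = c *: obr p q f g + obr p q f g'.
Proof. by move=> Cf Cf' Cg; rewrite /obr pl_linl // pl_linr //; modring. Qed.

Lemma kapC p q : okap p q = okap q p.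
Proof. by rewrite /okap mulnC. Qed.

Lemma kap_sq p q : okap p q * okap p q = 1.
Proof. exact: sg_sq. Qed.

Lemma brC p q f g : obr p q f g = - (okap p q *: obr q p g f).
Proof.
rewrite /obr (kapC q p) scalerBr scalerA kap_sq scale1r.
by rewrite opprB.
Qed.

Lemma br00 f g : obr 0 0 f g = 0.
Proof. by rewrite /obr /opl !lsum0 scaler0 subrr. Qed.

(** The signs themselves agree unless [q + r = 0], where the predecessor is truncated; in that case
    the inner product is an empty sum. *)
Lemma kap_plr p q r f g h : C p f ->
  okap p (q + r).-1 *: opl p (q + r).-1 f (opl q r g h) =
  (okap p q * okap p r) *: opl p (q + r).-1 f (opl q r g h).
Proof.
move=> Cf; case: q => [|q]; last by congr (_ *: _); rewrite /okap; signs; rewrite ?mulrNN ?mulr1 ?mul1r.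
rewrite /opl lsum0 /osum !big1 ?scaler0 // => i _;
  by rewrite (o0r _ Cf (ltn_ord i)) scaler0.
Qed.

Lemma kap_pll p q r f g h : C p f ->
  okap (q + r).-1 p *: opl (q + r).-1 p (opl q r g h) f =
  (okap q p * okap r p) *: opl (q + r).-1 p (opl q r g h) f.
Proof.
move=> Cf; case: q => [|q]; last by congr (_ *: _); rewrite /okap; signs; rewrite ?mulrNN ?mulr1 ?mul1r.
by rewrite [opl 0 r g h]lsum0 pl_arg0 // !scaler0.
Qed.

(** The commutator of a graded pre-Lie product is a Lie bracket: [pl_comm] is used three times, with
    each of [f], [g], [h] once in the outermost position. *)
Lemma br_jacobi p q r f g h : C p f -> C q g -> C r h ->
  obr p (q + r).-1 f (obr q r g h) =
  obr (p + q).-1 r (obr p q f g) h + okap p q *: obr q (p + r).-1 g (obr p r f h).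
Proof.
move=> Cf Cg Ch.
have Cgh := pl_dom' Cg Ch; have Chg := pl_dom' Ch Cg.
have Cfg := pl_dom' Cf Cg; have Cgf := pl_dom' Cg Cf.
have Cfh := pl_dom' Cf Ch; have Chf := pl_dom' Ch Cf.
have rE : (r + q)%N = (q + r)%N by rewrite addnC.
have qE : (q + p)%N = (p + q)%N by rewrite addnC.
have rE' : (r + p)%N = (p + r)%N by rewrite addnC.
rewrite rE in Chg; rewrite qE in Cgf; rewrite rE' in Chf.
rewrite /obr !pl_subl // !pl_subr //.
(* [E1] to [E6] replace signs of composite arities by products of signs in [p], [q], [r], whose
   parities [signs] can treat independently. *)
have E1 := kap_plr q r g h Cf; have E2 := kap_plr r q h g Cf; rewrite rE in E2.
have E3 := kap_pll p q f g Ch; have E4 := kap_pll q p g f Ch; rewrite qE in E4.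
have E5 := kap_plr p r f h Cg; have E6 := kap_plr r p h f Cg; rewrite rE' in E6.
have L1 := pl_comm Cf Cg Ch; have L2 := pl_comm Cg Cf Ch; have L3 := pl_comm Ch Cf Cg.
rewrite qE in L2; rewrite rE' rE in L3.
rewrite !scalerBr [okap p (q + r).-1 *: (_ *: _)]scalerA [okap p (q + r).-1 * _]mulrC -scalerA E1 E2.
rewrite [okap (p + q).-1 r *: (_ *: _)]scalerA [okap (p + q).-1 r * _]mulrC -[(okap p q * okap (p + q).-1 r) *: _]scalerA E3 E4.
rewrite [okap q (p + r).-1 *: (_ *: _)]scalerA [okap q (p + r).-1 * _]mulrC -[(okap p r * okap q (p + r).-1) *: _]scalerA E5 E6.
rewrite L1 L2 L3.
rewrite /okap; signs; modring.
Qed.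

Lemma pl_mu p f : opl 2 p mu f = o p 0 mu f + sg p.+1 *: o p 1 mu f.
Proof. by rewrite /opl !lsumS lsum0 scaler0 addr0. Qed.

(** With the differential written as the bracket with [mu], its compatibility with brackets is an
    instance of the Jacobi identity. *)
Lemma del_br p f : odel p f = obr 2 p mu f.
Proof.
rewrite /odel /obr pl_mu /okap; signs; modring.
Qed.

Lemma del_dom p f : C p f -> C p.+1 (odel p f).
Proof. by move=> Cf; rewrite del_br; apply: (br_dom Cmu Cf). Qed.

Lemma del_lin p c f g : C p f -> C p g -> odel p (c *: f + g) = c *: odel p f + odel p g.
Proof. by move=> Cf Cg; rewrite !del_br; apply: (br_linr _ Cmu). Qed.

Lemma del_br_der p q n f g : C p f -> C q g -> n.+1 = (p + q)%N ->
  odel n (obr p q f g) = obr p.+1 q (odel p f) g + sg p.+1 *: obr p q.+1 f (odel q g).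
Proof.
move=> Cf Cg e; rewrite !del_br.
have := br_jacobi Cmu Cf Cg; rewrite -e /= => ->.
by congr (_ + _ *: _); rewrite /okap; signs.
Qed.
End OperadBracket.

(** * The cup product of an operad with multiplication *)

Section OperadCup.
Variables (k : comNzRingType) (T : lmodType k) (O : mult_operad T).
Local Notation C := (o_dom O).
Local Notation o := (o_part O).
Local Notation mu := (o_mu O).
Local Notation Cmu := (o_dom_mu O).
Local Notation sg := (signk k).
Local Notation lsum := (osum O).
Local Notation pl := (opl O).
Local Notation cup := (ocup O).
Local Notation del := (odel O).
Implicit Types (f g h : T) (p q r m n i j a b : nat).

Lemma mu0_dom p f : C p f -> C p.+1 (o p 0 mu f).
Proof. by move=> Cf; apply: (o_dom_part Cmu Cf). Qed.
Lemma mu1_dom p f : C p f -> C p.+1 (o p 1 mu f).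
Proof. by move=> Cf; apply: (o_dom_part Cmu Cf). Qed.

Lemma cup_dom p q f g : C p f -> C q g -> C (p + q) (cup p q f g).
Proof. by move=> Cf Cg; apply: (o_dom_part (mu0_dom Cf) Cg). Qed.

Lemma cup_linl p q c f f' g : C p f -> C p f' -> C q g ->
  cup p q (c *: f + f') g = c *: cup p q f g + cup p q f' g.
Proof.
move=> Cf Cf' Cg; rewrite /ocup (o_linr _ Cmu Cf Cf') //.
by rewrite (o_linl _ (mu0_dom Cf) (mu0_dom Cf') Cg).
Qed.

Lemma cup_linr p q c f g g' : C p f -> C q g -> C q g' ->
  cup p q f (c *: g + g') = c *: cup p q f g + cup p q f g'.
Proof. by move=> Cf Cg Cg'; apply: (o_linr _ (mu0_dom Cf) Cg Cg'). Qed.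

Lemma mu_mu p q f g : C p f -> C q g -> o p 0 (o q 1 mu g) f = cup p q f g.
Proof. by move=> Cf Cg; rewrite (o_disjoint Cmu Cg Cf). Qed.

Lemma cup_partl p q r i f g h : C p f -> C q g -> C r h -> (i < p)%N ->
  o r i (cup p q f g) h = cup (p + r).-1 q (o r i f h) g.
Proof.
move=> Cf Cg Ch ip; case: p Cf ip => // p Cf ip.
rewrite /ocup (o_disjoint (mu0_dom Cf) Cg Ch) //.
by rewrite -(o_nested Cmu Cf Ch).
Qed.

Lemma cup_partr p q r j f g h : C p f -> C q g -> C r h -> (j < q)%N ->
  o r (p + j) (cup p q f g) h = cup p (q + r).-1 f (o r j g h).
Proof. by move=> Cf Cg Ch jq; rewrite /ocup (o_nested (mu0_dom Cf) Cg Ch). Qed.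


(** [mu1_cup], [mu0_cup] and [cup_mu] are three readings of the associativity of [mu]. The first two
    give the outer terms of the differential of a cup product; by the third, the last term of
    [del f] cancels the first term of [del g]. *)
Lemma mu1_cup p q f g : C p f -> C q g ->
  o (p + q) 1 mu (cup p q f g) = cup p.+1 q (o p 1 mu f) g.
Proof.
move=> Cf Cg.
have E1 := o_nested Cmu (mu0_dom Cf) Cg (erefl : 1 < 2)%N (ltnSn p).
have E2 := o_nested Cmu Cmu Cf (erefl : 1 < 2)%N (erefl : 0 < 2)%N.
have E3 := o_nested Cmu Cmu Cf (erefl : 0 < 2)%N (erefl : 1 < 2)%N.
rewrite /ocup -[LHS]E1 -[o p.+1 1 mu _]E2.
by rewrite -[o p.+1 0 mu _]E3 o_mu_assoc.
Qed.

Lemma mu0_cup p q f g : C p f -> C q g ->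
  o (p + q) 0 mu (cup p q f g) = cup p q.+1 f (o q 0 mu g).
Proof.
move=> Cf Cg.
have E1 := o_nested Cmu (mu0_dom Cf) Cg (erefl : 0 < 2)%N (ltnSn p).
have E2 := o_nested Cmu Cmu Cf (erefl : 0 < 2)%N (erefl : 0 < 2)%N.
have E3 := o_nested (mu0_dom Cf) Cmu Cg (ltnSn p) (erefl : 0 < 2)%N.
have E4 := o_disjoint Cmu Cmu Cf (leqnn 0) (erefl : 1 < 2)%N.
rewrite /ocup -[LHS]E1 -[o p.+1 0 mu _]E2 -[RHS]E3 o_mu_assoc.
by rewrite [in LHS]E4 addn0.
Qed.

Lemma cup_mu p q f g : C p f -> C q g ->
  cup p.+1 q (o p 0 mu f) g = cup p q.+1 f (o q 1 mu g).
Proof.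
move=> Cf Cg.
have E2 := o_nested Cmu Cmu Cf (erefl : 0 < 2)%N (erefl : 0 < 2)%N.
have E3 := o_nested (mu0_dom Cf) Cmu Cg (ltnSn p) (erefl : 1 < 2)%N.
have E4 := o_disjoint Cmu Cmu Cf (leqnn 0) (erefl : 1 < 2)%N.
rewrite /ocup -[o p.+1 0 mu _]E2 -[RHS]E3 o_mu_assoc.
by rewrite [in LHS]E4 addn1.
Qed.

Lemma cupA p q r f g h : C p f -> C q g -> C r h ->
  cup (p + q) r (cup p q f g) h = cup p (q + r) f (cup q r g h).
Proof.
move=> Cf Cg Ch; rewrite {1}/ocup mu0_cup //.
by rewrite (cup_partr Cf (mu0_dom Cg) Ch).
Qed.

Lemma cup_suml p q g I (r : seq I) (F : I -> T) : C q g -> (forall x, C p (F x)) ->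
  cup p q (\sum_(x <- r) F x) g = \sum_(x <- r) cup p q (F x) g.
Proof.
move=> Cg CF; rewrite /ocup (@o_sumr _ _ O 2 p 0 mu _ r xpredT F Cmu) //.
by rewrite (@o_suml _ _ O p.+1 q p g _ r xpredT) // => x _; apply: mu0_dom.
Qed.

Lemma cup_sumr p q f I (r : seq I) (F : I -> T) : C p f -> (forall x, C q (F x)) ->
  cup p q f (\sum_(x <- r) F x) = \sum_(x <- r) cup p q f (F x).
Proof.
by move=> Cf CF; rewrite /ocup (@o_sumr _ _ O p.+1 q p _ _ r xpredT F (mu0_dom Cf)).
Qed.

Lemma cupZl p q c f g : C p f -> C q g -> cup p q (c *: f) g = c *: cup p q f g.
Proof.
move=> Cf Cg; have := cup_linl c Cf (o_dom0 O p) Cg.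
by rewrite !addr0 [cup p q 0 g]/ocup (o0r _ Cmu) // (o0l p.+1) // addr0.
Qed.
Lemma cupZr p q c f g : C p f -> C q g -> cup p q f (c *: g) = c *: cup p q f g.
Proof.
move=> Cf Cg; have := cup_linr c Cf Cg (o_dom0 O q).
by rewrite !addr0 [cup p q f 0]/ocup (o0r _ (mu0_dom Cf)) // addr0.
Qed.

Lemma lsum_cupl p q r n f g h : C p f -> C q g -> C r h -> (n <= p)%N ->
  lsum r h 0 n (cup p q f g) = cup (p + r).-1 q (lsum r h 0 n f) g.
Proof.
move=> Cf Cg Ch np.
have ip (i : 'I_n) : (i < p)%N by apply: leq_trans np.
have Cfh (i : 'I_n) : C (p + r).-1 (o r (0 + i) f h).
  by apply: (o_dom_part Cf Ch) => //; have := ip i; lia.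
rewrite [lsum r h 0 n f]/osum cup_suml // => [|i]; last exact: domZ.
by apply: eq_bigr => i _; rewrite (cupZl _ (Cfh i) Cg) (cup_partl Cf Cg Ch (ip i)).
Qed.

Lemma lsum_cupr p q r n f g h : C p f -> C q g -> C r h -> (n <= q)%N ->
  lsum r h p n (cup p q f g) = cup p (q + r).-1 f (lsum r h 0 n g).
Proof.
move=> Cf Cg Ch np.
have ip (i : 'I_n) : (i < q)%N by apply: leq_trans np.
have Cgh (i : 'I_n) : C (q + r).-1 (o r (0 + i) g h).
  by apply: (o_dom_part Cg Ch) => //; have := ip i; lia.
rewrite [lsum r h 0 n g]/osum cup_sumr // => [|i]; last exact: domZ.
by apply: eq_bigr => i _; rewrite (cupZr _ Cf (Cgh i)) (cup_partr Cf Cg Ch (ip i)).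
Qed.

Lemma pl_cup p q r f g h : C p f -> C q g -> C r h ->
  pl (p + q) r (cup p q f g) h =
  cup (p + r).-1 q (pl p r f h) g + sg (r.+1 * p) *: cup p (q + r).-1 f (pl q r g h).
Proof.
move=> Cf Cg Ch; by rewrite {1}/opl lsumD lsum_cupl // add0n lsum_cupr.
Qed.

Lemma delE p f :
  del p f = sg p.+1 *: o p 0 mu f + ((-1) *: pl p 2 f mu + o p 1 mu f).
Proof. rewrite /odel; modring. Qed.

Lemma del_cup p q f g : C p f -> C q g ->
  del (p + q) (cup p q f g) = cup p.+1 q (del p f) g + sg p *: cup p q.+1 f (del q g).
Proof.
move=> Cf Cg; have Cf' := del_dom Cf.
have Cfm : C p.+1 (pl p 2 f mu) by apply: (pl_dom Cf Cmu) => ?; lia.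
have Cgm : C q.+1 (pl q 2 g mu) by apply: (pl_dom Cg Cmu) => ?; lia.
have Cf0 := mu0_dom Cf; have Cf1 := mu1_dom Cf.
have Cg0 := mu0_dom Cg; have Cg1 := mu1_dom Cg.
have -> : cup p.+1 q (del p f) g =
    cup p.+1 q (o p 1 mu f) g - cup p.+1 q (pl p 2 f mu) g + sg p.+1 *: cup p.+1 q (o p 0 mu f) g.
  by rewrite delE !cup_linl //; [modring|apply: o_dom_lin].
have -> : cup p q.+1 f (del q g) =
    cup p q.+1 f (o q 1 mu g) - cup p q.+1 f (pl q 2 g mu) + sg q.+1 *: cup p q.+1 f (o q 0 mu g).
  by rewrite delE !cup_linr //; [modring|apply: o_dom_lin].
rewrite {1}/odel mu1_cup // mu0_cup // (pl_cup Cf Cg Cmu) cup_mu //.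
have E2 n : (n + 2).-1 = n.+1 by rewrite addn2.
rewrite !E2.
signs; modring.
Qed.
End OperadCup.

Section OperadHomotopies.
Variables (k : comNzRingType) (T : lmodType k) (O : mult_operad T).
Local Notation C := (o_dom O).
Local Notation o := (o_part O).
Local Notation mu := (o_mu O).
Local Notation Cmu := (o_dom_mu O).
Local Notation sg := (signk k).
Local Notation pl := (opl O).
Local Notation cup := (ocup O).
Local Notation del := (odel O).
Implicit Types (f g h : T) (p q r m n i j a b : nat).

(** For a cocycle the inner terms of the differential are determined by the outer ones, so
    insertions of [mu] into [f] can be traded for insertions of [f] into [mu]. *)
Lemma del0_pl p f : del p f = 0 -> pl p 2 f mu = sg p.+1 *: pl 2 p mu f.
Proof.
move=> df; rewrite pl_mu -[LHS]addr0 -df /odel.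
signs; modring.
Qed.

Lemma plZl p q c f g : C p f -> C q g -> pl p q (c *: f) g = c *: pl p q f g.
Proof.
by move=> Cf Cg; have := pl_linl c Cf (o_dom0 O p) Cg; rewrite pl_arg0 // !addr0.
Qed.

Lemma pl_right0 p q f : C p f -> pl p q f 0 = 0.
Proof.
move=> Cf; rewrite /opl /osum big1 // => i _.
by rewrite (o0r _ Cf (ltn_ord i)) scaler0.
Qed.

Lemma plZr p q c f g : C p f -> C q g -> pl p q f (c *: g) = c *: pl p q f g.
Proof.
by move=> Cf Cg; have := pl_linr c Cf Cg (o_dom0 O q); rewrite pl_right0 // !addr0.
Qed.

(** In [mu] with [f] inserted, [g] meets either a slot of [f] or the slot of [mu] left free; the
    latter gives the two cup products. *)
Lemma pl_mul p q f g : C p f -> C q g ->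
  pl p.+1 q (pl 2 p mu f) g =
  o (p + q).-1 0 mu (pl p q f g) + (sg p.+1 * sg q.+1) *: o (p + q).-1 1 mu (pl p q f g)
  + sg (q.+1 * p) *: cup p q f g + sg p.+1 *: cup q p g f.
Proof.
move=> Cf Cg; rewrite pl_mu addrC (pl_linl _ (mu1_dom Cf) (mu0_dom Cf) Cg).
rewrite {1}/opl lsumS mu_mu // {1}/opl lsumSr add0n.
have E0 := @lsum_nested _ _ O 2 p q f g 0 0 p mu Cmu Cf Cg erefl (leqnn p).
have E1 := @lsum_nested _ _ O 2 p q f g 1 0 p mu Cmu Cf Cg erefl (leqnn p).
rewrite add0n in E0; rewrite addn0 in E1; rewrite E0 E1.
rewrite -/(opl O p q f g) -/(ocup O p q f g); modring.
Qed.

(** The pre-Lie identity for [f], [g] and [mu], with [del0_pl] applied to both cocycles: besides the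
    differential of [pl p q f g], the expansion by [pl_mul] leaves exactly the graded commutator. *)
Lemma cup_comm p q f g : C p f -> C q g -> del p f = 0 -> del q g = 0 ->
  cup p q f g = sg (p * q) *: cup q p g f + sg (p * q.+1).+1 *: (sg (p + q) *: del (p + q).-1 (pl p q f g)).
Proof.
move=> Cf Cg df dg.
have -> : sg (p + q) *: del (p + q).-1 (pl p q f g) =
    sg (p + q) *: (o (p + q).-1 1 mu (pl p q f g) - pl (p + q).-1 2 (pl p q f g) mu)
    + o (p + q).-1 0 mu (pl p q f g).
  (* For [p = 0] the product [pl p q f g] is empty, so the sign attached to the truncated arity is
     harmless. *)
  rewrite /odel; case: p Cf df => [|p] Cf df.
    by rewrite [pl 0 q f g]lsum0 !(o0r _ Cmu) // !scaler0 !addr0.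
  by rewrite scalerDr [sg _ *: (sg _ *: _)]scalerA sg_sq scale1r.
have E := pl_comm Cf Cg Cmu.
have e1 n : (n + 2).-1 = n.+1 by rewrite addn2.
rewrite (del0_pl df) (del0_pl dg) !e1 in E.
have Cmg : C q.+1 (pl 2 q mu g) by apply: (pl_dom Cmu Cg).
have Cmf : C p.+1 (pl 2 p mu f) by apply: (pl_dom Cmu Cf).
rewrite (plZr _ Cf Cmg) (plZl _ Cmf Cg) pl_mul // in E.
rewrite E /okap.
signs; modring.
Qed.
End OperadHomotopies.

(** * The second order brace and the Leibniz rule *)

Section OperadLeibniz.
Variables (k : comNzRingType) (T : lmodType k) (O : mult_operad T).
Local Notation C := (o_dom O).
Local Notation o := (o_part O).
Local Notation mu := (o_mu O).
Local Notation Cmu := (o_dom_mu O).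
Local Notation sg := (signk k).
Local Notation kap := (okap k).
Local Notation lsum := (osum O).
Local Notation pl := (opl O).
Local Notation br := (obr O).
Local Notation cup := (ocup O).
Local Notation del := (odel O).
Implicit Types (h : T) (m n i j a b : nat).

Variables (q r : nat) (f g : T).
Hypotheses (Cf : C q f) (Cg : C r g).

(* The sum over i < j < n of (-1)^(|f| i + |g| j) times the insertion of f at
   position a + i and of g at position a + j, i.e. a brace x{f, g}. *)
Fixpoint psum n a (x : T) : T :=
  if n is n'.+1 then
    sg r.+1 *: o q a (lsum r g a.+1 n' x) f + (sg q.+1 * sg r.+1) *: psum n' a.+1 x
  else 0.

Lemma psumS n a x : psum n.+1 a x =
  sg r.+1 *: o q a (lsum r g a.+1 n x) f + (sg q.+1 * sg r.+1) *: psum n a.+1 x.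
Proof. by []. Qed.

Lemma psum1 a x : psum 1 a x = 0.
Proof. by rewrite psumS lsum0 (o0l q) // !scaler0 addr0. Qed.

Lemma psum_small n a x : (n < 2)%N -> psum n a x = 0.
Proof. by case: n => [|[|]] // _; rewrite psum1. Qed.

Lemma psum_dom m m' n a x : C m x -> (a + n <= m)%N -> ((1 < n)%N -> m'.+2 = (m + q + r)%N) ->
  C m' (psum n a x).
Proof.
move=> Cx; elim: n a => [|n IHn] a anm e; first exact: o_dom0.
case: (posnP n) => [->|n_gt0]; first by rewrite psum1; apply: o_dom0.
have := e n_gt0 => {}e.
have CL : C (m + r).-1 (lsum r g a.+1 n x) by apply: (lsum_dom Cx Cg); lia.
apply: o_dom_lin; first by apply: (o_dom_part CL Cf); lia.
by apply/domZ/IHn; lia.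
Qed.

Lemma psum_lin m n a c x y : C m x -> C m y -> (a + n <= m)%N ->
  psum n a (c *: x + y) = c *: psum n a x + psum n a y.
Proof.
move=> Cx Cy; elim: n a => [|n IHn] a anm; first by rewrite scaler0 addr0.
case: (posnP n) => [->|n_gt0]; first by rewrite !psum1 scaler0 addr0.
rewrite !psumS IHn; last by lia.
rewrite (lsum_lin _ Cx Cy Cg); last by lia.
have CL z : C m z -> C (m + r).-1 (lsum r g a.+1 n z).
  by move=> Cz; apply: (lsum_dom Cz Cg); lia.
rewrite (o_linl _ (CL _ Cx) (CL _ Cy) Cf); last by lia.
modring.
Qed.

Lemma psum0 n a : psum n a 0 = 0.
Proof.
have := @psum_lin (a + n) n a (-1) 0 0 (o_dom0 O _) (o_dom0 O _) (leqnn _).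
by rewrite scaler0 addr0 scaleN1r addNr.
Qed.

Lemma psumZ m n a c x : C m x -> (a + n <= m)%N -> psum n a (c *: x) = c *: psum n a x.
Proof.
move=> Cx anm; have := psum_lin c Cx (o_dom0 O m) anm.
by rewrite psum0 !addr0.
Qed.

Lemma psum_nested m p p' h n a b x : C m x -> C p h -> (a < m)%N -> (b + n <= p)%N ->
  ((1 < n)%N -> p'.+2 = (p + q + r)%N) ->
  psum n (a + b) (o p a x h) = o p' a x (psum n b h).
Proof.
move=> Cx Ch am; elim: n b => [|n IHn] b bnp e; first by rewrite (o0r _ Cx).
case: (posnP n) => [->|n_gt0]; first by rewrite !psum1 (o0r _ Cx).
have := e n_gt0 => {}e.
have CL : C (p + r).-1 (lsum r g b.+1 n h) by apply: (lsum_dom Ch Cg); lia.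
have CLf : C p' (o q b (lsum r g b.+1 n h) f) by apply: (o_dom_part CL Cf); lia.
have CP : C p' (psum n b.+1 h) by apply: (psum_dom Ch); lia.
rewrite !psumS (o_linr _ Cx CLf (domZ _ CP) am) (oZr _ Cx CP am); congr (_ *: _ + _ *: _).
  rewrite -addnS (lsum_nested Cx Ch Cg); [|lia|lia].
  rewrite (o_nested Cx CL Cf am); last by lia.
  by congr (o _ _ _ _); lia.
by rewrite -addnS IHn //; lia.
Qed.

Lemma psum_disjoint m s h n a b x : C m x -> C s h -> (a <= b)%N -> (b.+1 + n <= m)%N ->
  psum n (b + s) (o s a x h) = o s a (psum n b.+1 x) h.
Proof.
move=> Cx Ch; elim: n b => [|n IHn] b ab bnm; first by rewrite (o0l s).
case: (posnP n) => [->|n_gt0]; first by rewrite !psum1 (o0l s).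
have CL : C (m + r).-1 (lsum r g b.+2 n x) by apply: (lsum_dom Cx Cg); lia.
have CLf : C (m + r + q).-2 (o q b.+1 (lsum r g b.+2 n x) f) by apply: (o_dom_part CL Cf); lia.
have CP : C (m + r + q).-2 (psum n b.+2 x) by apply: (psum_dom Cx); lia.
rewrite !psumS (o_linl _ CLf (domZ _ CP) Ch) ?(oZl _ CP Ch); [|lia|lia].
congr (_ *: _ + _ *: _); last by rewrite -addSn IHn //; lia.
rewrite -addSn (lsum_disjoint Cx Ch Cg); [|lia|lia].
by rewrite (o_disjoint CL Cf Ch) //; lia.
Qed.

(** The definition splits off the first slot; the last one has to be split off when [h] fills the
    first slot of [mu], because the free slot of [mu] then comes last. *)
Lemma psumSr m n a x : C m x -> (a + n < m)%N ->
  psum n.+1 a x = psum n a x + sg (r.+1 * n) *: lsum q f a n (o r (a + n) x g).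
Proof.
move=> Cx; elim: n a => [|n IHn] a anm; first by rewrite psum1 lsum0 scaler0 addr0.
have CG : C (m + r).-1 (o r (a.+1 + n) x g) by apply: (o_dom_part Cx Cg); lia.
have CL : C (m + r).-1 (lsum r g a.+1 n x) by apply: (lsum_dom Cx Cg); lia.
rewrite [LHS]psumS IHn; last by lia.
rewrite psumS (lsumS O q f) (lsumSr O r g) [lsum r g a.+1 n x + _]addrC (o_linl _ CG CL Cf); last by lia.
rewrite -[(a + n.+1)%N]addSnnS mulnS sgD.
modring.
Qed.

Hypotheses (df : del q f = 0) (dg : del r g = 0).

Lemma lsumZr m s c h a n x : C m x -> C s h -> (a + n <= m)%N ->
  lsum s (c *: h) a n x = c *: lsum s h a n x.
Proof.
move=> Cx Ch anm; rewrite /osum scaler_sumr; apply: eq_bigr => i _.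
rewrite (oZr _ Cx Ch) ?scalerA 1?mulrC //; have := ltn_ord i; lia.
Qed.

(** In [lsum_comm] for [mu] and [g], the two terms that compose [mu] with [g] cancel because [g] is
    a cocycle. *)
Lemma lsum_mu_comm m n a x : C m x -> (a + n <= m)%N ->
  lsum r g a n.+1 (lsum 2 mu a n x) =
  sg r.+1 *: lsum 2 mu a (n + r).-1 (lsum r g a n x).
Proof.
move=> Cx anm; have := lsum_comm Cx Cmu Cg anm.
rewrite addn2 /= (del0_pl dg) => ->.
have -> : lsum (2 + r).-1 (sg r.+1 *: pl 2 r mu g) a n x =
    sg r.+1 *: lsum (2 + r).-1 (pl 2 r mu g) a n x.
  exact: lsumZr Cx (pl_dom' Cmu Cg) anm.
by rewrite /okap; signs; modring.
Qed.

(** The pair can be placed into [x] with [mu] inserted in three ways. Both in that [mu] gives the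
    cup product; exactly one in it becomes, by the cocycle conditions, an insertion of [mu] into [f]
    or [g]; none in it leaves [mu] in a slot of [x]. The last two kinds add up to [psum] followed by
    an insertion of [mu]. *)
Lemma psum_mu m n a x : C m x -> (a + n <= m)%N ->
  psum n.+1 a (lsum 2 mu a n x) =
  sg r.+1 *: lsum (q + r) (cup q r f g) a n x
  + (sg q.+1 * sg r.+1) *: lsum 2 mu a (n + q + r).-2 (psum n a x).
Proof.
move=> Cx; elim: n a => [|n IHn] a anm.
  by rewrite !lsum0 psum0 (lsum_arg0 _ _ Cmu) !scaler0 addr0.
have am : (a < m)%N by lia.
set y := lsum r g a.+1 n x.
have CxM : C m.+1 (o 2 a x mu) by apply: (o_dom_part Cx Cmu); lia.
have CLM : C m.+1 (lsum 2 mu a.+1 n x) by apply: (lsum_dom Cx Cmu); lia.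
have Cy : C (m + r).-1 y by apply: (lsum_dom Cx Cg); lia.
have CyM : C (m + r) (o 2 a y mu).
  case: (posnP n) => [n0|n_gt0]; last by apply: (o_dom_part Cy Cmu); lia.
  by rewrite /y n0 lsum0 (o0l 2 _ Cmu); apply: o_dom0.
have Cmf : C q.+1 (pl 2 q mu f) by apply: (pl_dom Cmu Cf).
rewrite lsumS [o 2 a x mu + _]addrC (psum_lin _ CLM CxM); last by lia.
(* The [mu] in slot [a] receives both [f] and [g], or only [f] in one of its two slots, or neither;
   it cannot receive only [g], since [f] comes before [g] and [a] is the first slot. *)
have -> : psum n.+2 a (o 2 a x mu) = sg r.+1 *: o (q + r) a x (cup q r f g)
    + o q.+1 a y (pl 2 q mu f) + o 2 a (psum n a.+1 x) mu.
  have e1 : lsum r g a.+2 n (o 2 a x mu) = o 2 a y mu.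
    by rewrite -addn2 (lsum_disjoint Cx Cmu Cg) //; lia.
  have e2 : psum n a.+2 (o 2 a x mu) = o 2 a (psum n a.+1 x) mu.
    by rewrite -addn2 (psum_disjoint Cx Cmu) //; lia.
  have e3 : o q a (o r a.+1 (o 2 a x mu) g) f = o (q + r) a x (cup q r f g).
    rewrite -[a.+1]addn1 (o_nested Cx Cmu Cg am (erefl : 1 < 2)%N).
    have := o_nested Cx (mu1_dom Cg) Cf am (ltn0Sn r); rewrite addn0 => ->.
    by rewrite mu_mu //; congr (o _ _ _ _); lia.
  have e4 : o q.+1 a y (pl 2 q mu f) = o q a (o 2 a y mu) f + sg q.+1 *: o q a.+1 (o 2 a y mu) f.
    case: (posnP n) => [n0|n_gt0].
      by rewrite /y n0 lsum0 (o0l 2 _ Cmu) !(o0l q _ Cf) (o0l q _ Cmf) scaler0 addr0.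
    have am' : (a < (m + r).-1)%N by lia.
    have := @lsum_nested _ _ O _ 2 q mu f a 0 2 y Cy Cmu Cf am' (leqnn 2); rewrite addn0 -/(pl 2 q mu f) => <-.
    by rewrite !lsumS lsum0 scaler0 addr0.
  have CXG : C (m + r) (o r a.+1 (o 2 a x mu) g) by apply: (o_dom_part CxM Cg); lia.
  rewrite psumS lsumS e1 addrC psumS e1 e2 e4.
  rewrite [o r a.+1 _ g + _]addrC (o_linl _ CyM CXG Cf); last by lia.
  by rewrite e3; signs; modring.
rewrite [psum n.+2 a _]psumS (lsum_mu_comm Cx) -/y; last by lia.
rewrite IHn; last by lia.
rewrite lsumS.
have CL : C (m + r) (lsum 2 mu a.+1 (n + r).-1 y).
  case: (posnP n) => [n0|n_gt0]; last by apply: (lsum_dom Cy Cmu); lia.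
  by rewrite /y n0 lsum0 (lsum_arg0 _ _ Cmu); apply: o_dom0.
rewrite (oZl _ CL Cf); last by lia.
case: (posnP n) => [n0|n_gt0].
  rewrite /y n0 !lsum0 !psum1 /= ?(o0l 2 _ Cmu, o0l q _ Cf, lsum_arg0 _ _ Cmu, o0l q _ Cmf).
  by rewrite !scaler0; modring.
have -> : lsum 2 mu a (n.+1 + q + r).-2 (psum n.+1 a x) =
    sg r.+1 *: (sg q.+1 *: o q.+1 a y (pl 2 q mu f) + sg q *: o q a (lsum 2 mu a.+1 (n + r).-1 y) f)
    + (sg q.+1 * sg r.+1) *: (o 2 a (psum n a.+1 x) mu - lsum 2 mu a.+1 (n + q + r).-2 (psum n a.+1 x)).
  have CZ : C (m + r + q).-2 (o q a y f) by apply: (o_dom_part Cy Cf); lia.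
  have CP : C (m + r + q).-2 (psum n a.+1 x) by apply: (psum_dom Cx); lia.
  rewrite psumS (lsum_lin _ CZ (domZ _ CP) Cmu); last by lia.
  congr (_ *: _ + _).
    rewrite (_ : (n.+1 + q + r).-2 = q + (n + r).-1)%N; last by lia.
    have am' : (a < (m + r).-1)%N by lia.
    rewrite lsumD (lsum_disjoint Cy Cf Cmu) //; last by lia.
    have := @lsum_nested _ _ O _ q 2 f mu a 0 q y Cy Cf Cmu am' (leqnn q); rewrite addn0 -/(pl q 2 f mu) => ->.
    rewrite (del0_pl df) addn2 /= (oZr _ Cy Cmf) //.
    by congr (_ + _ *: _); signs.
  have := lsum_lin (sg q.+1 * sg r.+1) CP (o_dom0 O _) Cmu.
  move=> /(_ a (n.+1 + q + r).-2); rewrite !addr0 (lsum_arg0 _ _ Cmu) addr0 => ->; last by lia.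
  congr (_ *: _); case: (ltnP 1 n) => [n1|n1].
    rewrite (_ : (n.+1 + q + r).-2 = (n + q + r).-2.+1); last by lia.
    by rewrite lsumS sgE scaleN1r.
  by rewrite psum_small // !(lsum_arg0 _ _ Cmu) (o0l 2 _ Cmu) subr0.
signs; modring.
Qed.

(** This is [psum_mu] over all slots of [h], with insertions of [mu] into the cocycle [h] replaced
    by insertions of [h] into [mu]. There the free slot of [mu] can take only [f] if it comes first
    and only [g] if it comes last, which yields the two cup products. *)
Lemma pl_cup_right p h : C p h -> del p h = 0 ->
  pl p (q + r) h (cup q r f g) =
  (sg p.+1 * sg (r.+1 * p.+1)) *: cup (p + q).-1 r (pl p q h f) g
  + cup q (p + r).-1 f (pl p r h g)
  + sg q.+1 *: del (p + q + r).-2 (psum p 0 h).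
Proof.
move=> Ch dh; have := @psum_mu p p 0 h Ch (leqnn p); set P := psum p 0 h.
rewrite -/(pl p 2 h mu) -/(pl p (q + r) h _) (del0_pl dh) pl_mu.
set p' := (p + q + r).-2; rewrite -/(pl p' 2 P mu).
have CP : C p' P by apply: (psum_dom Ch); lia.
have e1 : psum p.+1 0 (o p 1 mu h) =
    sg r.+1 *: cup q (p + r).-1 f (pl p r h g) + (sg q.+1 * sg r.+1) *: o p' 1 mu P.
  rewrite psumS.
  have := @psum_nested 2 p p' h p 1 0 mu Cmu Ch erefl (leqnn p).
  rewrite addn0 => ->; last by rewrite /p'; lia.
  have := @lsum_nested _ _ O 2 p r h g 1 0 p mu Cmu Ch Cg erefl (leqnn p).
  rewrite addn0 => ->; rewrite mu_mu //; last exact: pl_dom'.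
have e0 : psum p.+1 0 (o p 0 mu h) =
    o p' 0 mu P + sg (r.+1 * p) *: cup (p + q).-1 r (pl p q h f) g.
  rewrite (psumSr (mu0_dom Ch)) // lsum_cupl //.
  have := @psum_nested 2 p p' h p 0 0 mu Cmu Ch erefl (leqnn p).
  by rewrite addn0 => ->; last by rewrite /p'; lia.
rewrite addrC (psumZ _ _ (m := p.+1)); last 2 first.
- by apply: o_dom_lin; [apply: mu1_dom|apply: mu0_dom].
- by [].
rewrite (psum_lin _ (mu1_dom Ch) (mu0_dom Ch)) // e0 e1 => E.
have -> : pl p (q + r) h (cup q r f g) = sg r.+1 *: (sg r.+1 *: pl p (q + r) h (cup q r f g)).
  by rewrite scalerA sg_sq scale1r.
have -> : sg r.+1 *: pl p (q + r) h (cup q r f g) =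
  sg r.+1 *: pl p (q + r) h (cup q r f g) + (sg q.+1 * sg r.+1) *: pl p' 2 P mu
  - (sg q.+1 * sg r.+1) *: pl p' 2 P mu by rewrite addrK.
rewrite -E /odel.
have -> : sg p'.+1 *: o p' 0 mu P = - sg (p + q + r) *: o p' 0 mu P.
  (* With at most one slot the brace is 0; otherwise [p'] is not truncated and has the parity of
     [p + q + r]. *)
  case: (ltnP 1 p) => [p1|p1]; last by rewrite /P psum_small // (o0r _ Cmu) // !scaler0.
  by congr (_ *: _); rewrite -sgS; apply: sg_odd; rewrite /p' -[in RHS](_ : p'.+2 = (p + q + r)%N) /= ?negbK //; rewrite /p'; lia.
signs; modring.
Qed.

(** Inserting [h] into a cup product is a strict graded derivation by [pl_cup]; the homotopy term
    comes only from inserting the cup product into [h]. *)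
Lemma br_cup p h : C p h -> del p h = 0 ->
  br p (q + r) h (cup q r f g) =
  cup (p + q).-1 r (br p q h f) g
  + sg (p.+1 * q) *: cup q (p + r).-1 f (br p r h g)
  + (kap p (q + r) * sg q.+1) *: del (p + q + r).-2 (psum p 0 h).
Proof.
move=> Ch dh; rewrite /obr pl_cup_right // pl_cup // [(q + p)%N]addnC [(r + p)%N]addnC.
have Cfh := pl_dom' Cf Ch; have Cgh := pl_dom' Cg Ch.
rewrite [(q + p)%N]addnC in Cfh; rewrite [(r + p)%N]addnC in Cgh.
have Chf := pl_dom' Ch Cf; have Chg := pl_dom' Ch Cg.
rewrite !(cup_linl _ Chf (domN Cfh) Cg) !(cup_linr _ Cf Chg (domN Cgh)).
rewrite -!scaleN1r (cupZl _ Cfh Cg) (cupZr _ Cf Cgh) /okap.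
signs; modring.
Qed.
End OperadLeibniz.

(** * The operad of cochains *)

Section CochainOperad.
Variables (k : comNzRingType) (A U : algType k) (B : left_bialgebroid A U).
Variables (N : lmodType U) (Y : yd_algebra B N) (bc : braided_commutative Y).
Local Notation t := (tgt B).
Local Notation M := (resk N).
Local Notation T := (seq U -> resk N).
Implicit Types f g h : T.
Implicit Types a b d e us : seq U.

(** Extension by zero makes an equality of cochains an equality of functions that is tested on one
    length only, see [coch_ext]. *)
Definition coch p (f : T) := multi B p f /\ forall us, size us <> p -> f us = 0.

Definition part q i (f g : T) : T := fun us =>
  if (i + q <= size us)%N then ins Y f g (take i us) (take q (drop i us)) (drop (i + q) us) else 0.

Lemma part_cat q i f g a b e : size a = i -> size b = q ->
  part q i f g (a ++ b ++ e) = ins Y f g a b e.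
Proof.
move=> <- <-; rewrite /part !size_cat leq_add2l leq_addr take_size_cat //.
rewrite drop_size_cat // take_size_cat // addnC -drop_drop.
by rewrite !drop_size_cat.
Qed.

Lemma Dsum_zero (V : lmodType k) g us : Dsum Y g us (fun _ _ => 0 : V) = 0.
Proof.
have H : linear (fun _ : V => 0 : V) by move=> x y z; rewrite scaler0 addr0.
by rewrite -(lin_Dsum Y g us (fun _ _ => 0) H).
Qed.

Lemma ins_zero p f g a b e : (forall us, size us <> p -> f us = 0) ->
  (size a + size e).+1 <> p -> ins Y f g a b e = 0.
Proof.
move=> f0 ae; rewrite -[RHS](@Dsum_zero M g b) insE; apply: eq_Dsumr => m n.
have H : linear (fun _ : M => 0 : M) by move=> x y z; rewrite scaler0 addr0.
rewrite PhiE -[RHS](esym (lin_ssum B a (fun _ _ => 0) H)).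
apply: eq_ssum => us1 w us1s; rewrite f0; last by rewrite size_cat /= us1s addnS.
have Hl : linear (fun x => ydm Y x (act w n)) by lin.
exact: (lin0 Hl).
Qed.

Lemma ins_linl c f f' g a b e :
  ins Y (c *: f + f') g a b e = c *: ins Y f g a b e + ins Y f' g a b e.
Proof.
have H : linear (fun f : T => ins Y f g a b e); last exact: H.
apply: Dsum_family => m n; apply: ssum_family => us1 w _.
by apply: (@lin_ydl _ _ _ _ _ Y _ (fun f : T => f (us1 ++ m :: e))).
Qed.

Lemma ins_linr p c f g g' a b e : multi B p f -> (size a + size e).+1 = p ->
  ins Y f (c *: g + g') a b e = c *: ins Y f g a b e + ins Y f g' a b e.
Proof.
move=> fc ae; have Fb := Phi_balanced Y fc ae.
have H : linear (fun g : T => ins Y f g a b e); last exact: H.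
apply: ssum_family => us1 w _.
apply: (@lin_tsumarg _ _ _ _ _ _ _ _ _ (fun g : T => coact Y (g us1))).
  by apply: (@lin_linear _ _ _ _ _ (fun g : T => g us1)).
exact: balN_mulr.
Qed.

Lemma coch_ext n f g : coch n f -> coch n g ->
  (forall us, size us = n -> f us = g us) -> f = g.
Proof.
move=> [_ f0] [_ g0] fg; apply/funext => us.
by have [/fg //|/eqP us_n] := eqVneq (size us) n; rewrite f0 ?g0.
Qed.

Lemma coch0 p : coch p 0.
Proof.
split=> //; split=> [|x u us _]; last by rewrite /act /0 /= scaler0.
by split=> // l r _ c x y; rewrite /0 /= scaler0 addr0.
Qed.

Lemma coch_lin p c f g : coch p f -> coch p g -> coch p (c *: f + g).
Proof.
move=> [[[f1 f2] f3] f0] [[[g1 g2] g3] g0].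
have E us : (c *: f + g) us = c *: f us + g us by [].
split=> [|us us_p]; last by rewrite E f0 // g0 // scaler0 addr0.
split=> [|x u us e].
  split=> [l r e d x y|l u x v r e]; last by rewrite !E f2 ?g2.
  by rewrite !E f1 // g1 // !scalerDr !scalerA mulrC addrACA.
have Hl : linear (act (t x) : M -> M) by lin.
by rewrite !E f3 // g3 // Hl.
Qed.

Lemma split3 p q i us : (i < p)%N -> (size us).+1 = (p + q)%N ->
  exists a b e, [/\ us = a ++ b ++ e, size a = i, size b = q & (i + size e).+1 = p].
Proof.
move=> ip e.
have [|a [us' [usE ai]]] := @split_seq _ i us; first by lia.
have [|b [e' [us'E bq]]] := @split_seq _ q us'; first by move: e; rewrite usE size_cat; lia.
exists a, b, e'; split=> //; first by rewrite usE us'E.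
by move: e; rewrite usE us'E !size_cat; lia.
Qed.

Lemma coch_part p q n i f g : coch p f -> coch q g -> (i < p)%N -> n.+1 = (p + q)%N ->
  coch n (part q i f g).
Proof.
move=> [fc f0] [gc g0] ip npq; split.
  apply: (multi_ins fc gc ip npq) => a b e ai bq _.
  by rewrite part_cat.
move=> us us_n; rewrite /part; case: leqP => // le_us.
apply: (ins_zero _ _ f0); rewrite size_take size_drop.
by case: ifP => ?; lia.
Qed.

Lemma part_linl p q i c f f' g : coch p f -> coch p f' -> coch q g -> (i < p)%N ->
  part q i (c *: f + f') g = c *: part q i f g + part q i f' g.
Proof.
move=> fc f'c gc ip; apply/funext => us.
rewrite -[RHS]/(c *: part q i f g us + part q i f' g us) /part.
by case: leqP => _; rewrite ?ins_linl // scaler0 addr0.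
Qed.

Lemma part_linr p q i c f g g' : coch p f -> coch q g -> coch q g' -> (i < p)%N ->
  part q i f (c *: g + g') = c *: part q i f g + part q i f g'.
Proof.
move=> fc gc g'c ip.
have [n e] : exists n, n.+1 = (p + q)%N by exists (p + q).-1; lia.
apply: (@coch_ext n).
- by apply: (@coch_part p q) => //; apply: coch_lin.
- by apply: coch_lin; apply: (@coch_part p q).
move=> us us_n.
have [|a [b [e' [-> ai bq ae]]]] := @split3 p q i us ip; first by rewrite us_n.
rewrite -[RHS]/(c *: part q i f g _ + part q i f g' _) !part_cat //.
by apply: (@ins_linr p); [case: fc|rewrite ai].
Qed.

Lemma part_nested p q r i j f g h : coch p f -> coch q g -> coch r h ->
  (i < p)%N -> (j < q)%N ->
  part r (i + j) (part q i f g) h = part (q + r).-1 i f (part r j g h).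
Proof.
move=> fc gc hc ip jq.
have fgc : coch (p + q).-1 (part q i f g) by apply: (coch_part fc gc); lia.
have ghc : coch (q + r).-1 (part r j g h) by apply: (coch_part gc hc); lia.
apply: (@coch_ext (p + q + r).-2).
- by apply: (coch_part fgc hc); lia.
- by apply: (coch_part fc ghc); lia.
move=> us us_n.
have [|a [v [e [-> ai vs ae]]]] := @split3 p (q + r).-1 i us ip; first by rewrite us_n; lia.
have [|b [c [d [vE bj cr bd]]]] := @split3 q r j v jq; first by rewrite vs; lia.
rewrite vE [RHS]part_cat -?vE // {}vE -!catA catA part_cat ?size_cat ?ai ?bj //.
case: fc gc hc => [fc _] [gc _] [hc _].
symmetry; apply: (ins_nested fc gc hc); rewrite ?ai ?bj //.
- by move=> b1 c1 d1 b1s c1s _; rewrite part_cat //; lia.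
- by move=> a1 v1 e1 ? ? _; rewrite part_cat.
Qed.

Lemma part_disjoint p q r i j f g h : coch p f -> coch q g -> coch r h ->
  (i <= j)%N -> (j.+1 < p)%N ->
  part r i (part q j.+1 f g) h = part q (j + r) (part r i f h) g.
Proof.
move=> fc gc hc ij jp.
have fgc : coch (p + q).-1 (part q j.+1 f g) by apply: (coch_part fc gc); lia.
have fhc : coch (p + r).-1 (part r i f h) by apply: (coch_part fc hc); lia.
apply: (@coch_ext (p + q + r).-2).
- by apply: (coch_part fgc hc); lia.
- by apply: (coch_part fhc gc); lia.
move=> us us_n.
have [||a [b [v [-> ai br ae]]]] := @split3 (p + q).-1 r i us; [by lia|by rewrite us_n; lia|].
have [||c [d [e [vE cs ds es]]]] := @split3 (p - i).-1 q (j - i) v; [by lia|by lia|].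
rewrite vE part_cat //.
rewrite [RHS](_ : _ = part q (j + r) (part r i f h) g ((a ++ b ++ c) ++ d ++ e)); last by rewrite -!catA.
rewrite part_cat //; last by rewrite !size_cat ai br cs; lia.
case: fc gc hc => [fc _] [gc _] [hc _].
apply: (ins_disjoint bc fc gc hc) => //.
- by rewrite ai cs; lia.
- by move=> x d1 e1 xs ? _; rewrite part_cat // xs ai cs; lia.
- by move=> a1 b1 x a1s ? _; rewrite part_cat // a1s.
Qed.

Lemma coch_mu : coch 2 (mu Y).
Proof.
split; first exact: multi_mu.
by case=> [|u [|v [|]]].
Qed.

Lemma part_mu_assoc : part 2 0 (mu Y) (mu Y) = part 2 1 (mu Y) (mu Y).
Proof.
have muc := coch_mu; apply: (@coch_ext 3).
- exact: (coch_part muc muc).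
- exact: (coch_part muc muc).
move=> [|u [|v [|w [|]]]] //= _.
rewrite (@part_cat 2 0 _ _ [::] [:: u; v] [:: w]) //.
rewrite (@part_cat 2 1 _ _ [:: u] [:: v; w] [::]) //.
rewrite (@ins_mu_l _ _ _ _ _ Y (mu Y) 2 [:: u] v w) //; last exact: multi_mu.
rewrite (@ins_mu_r _ _ _ _ _ Y (mu Y) 2 u [:: v; w]) //; last exact: multi_mu.
(* Both sides are [s (eps (u * v * w))] acting on the unit. *)
by rewrite /mu /= -actM [RHS]act_one_s -epsMs mulrA -epsMt mulrA.
Qed.

Definition cochain_operad : mult_operad T := MultOperad
  coch0 coch_lin coch_part part_linl part_linr part_nested part_disjoint coch_mu part_mu_assoc.

End CochainOperad.

(** * Cochains on tensor powers and functions on sequences *)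

Section TensorPower.
Variables (k : comNzRingType) (A U : algType k) (B : left_bialgebroid A U).
Variables (N : lmodType U).
Local Notation t := (tgt B).
Local Notation T := (seq U -> resk N).
Implicit Types (l r us : seq U).

Lemma tupE p l : size l = p -> tup p l = l :> seq U.
Proof.
move=> lp; apply: (@eq_from_nth _ 0); rewrite size_tuple // => i ip.
by rewrite -[i]/(nat_of_ord (Ordinal ip)) -tnth_nth tnth_mktuple.
Qed.

Lemma tup_tuple p (v : p.-tuple U) : tup p v = v.
Proof. by apply: val_inj; apply: tupE; rewrite size_tuple. Qed.

Lemma tpow_gen_lin p l r : (size l + size r).+1 = p ->
  linear (fun u => pm_gen (@tpow_rel _ _ _ B p) (tup p (l ++ u :: r))).
Proof.
move=> e c x y; have E := @pm_gen_rel _ _ (@tpow_rel _ _ _ B p).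
have /E := tpow_relD B (c *: x) y e; rewrite /fsum big_seq1 big_cons big_seq1 /= !scale1r => ->.
by have /E := tpow_relZ B c x e; rewrite /fsum !big_seq1 /= scale1r => ->.
Qed.

Lemma tpow_gen_bal p l u a v r : (size l + size r).+2 = p ->
  pm_gen (@tpow_rel _ _ _ B p) (tup p (l ++ u * t a :: v :: r)) =
  pm_gen (@tpow_rel _ _ _ B p) (tup p (l ++ u :: t a * v :: r)).
Proof.
move=> e; have E := @pm_gen_rel _ _ (@tpow_rel _ _ _ B p).
by have /E := tpow_rel_bal B u a v e; rewrite /fsum !big_seq1 /= !scale1r.
Qed.

Lemma tpow_respect p (V : lmodType k) (F : seq U -> V) : mbal B p F ->
  forall x y, @tpow_rel _ _ _ B p x y ->
    fsum (fun v : p.-tuple U => F v) x = fsum (fun v : p.-tuple U => F v) y.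
Proof.
move=> [F1 F2] x y; rewrite /fsum; case=> [l u v r e|l c u r e|l u a v r e];
  rewrite !big_cons !big_nil /= !addr0 ?scale1r.
- rewrite !tupE ?size_cat /= ?addnS //.
  by have := F1 l r e 1 u v; rewrite !scale1r.
- rewrite !tupE ?size_cat /= ?addnS //.
  by rewrite (linZ (F1 l r e)).
- by rewrite !tupE ?size_cat /= ?addnS // F2.
Qed.

Lemma multi_ev p (f : precochain B N p) : cochain f -> multi B p (ev f).
Proof.
move=> [fl ft]; split; last exact: ft.
split=> [l r e|l u a v r e]; last by rewrite /ev tpow_gen_bal.
by apply: (lin_comp fl); apply: tpow_gen_lin.
Qed.

Definition of_seq p (F : T) : precochain B N p := fun x => pm_sum (fun v : p.-tuple U => F v) x.

Lemma ev_of_seq p F us : multi B p F -> size us = p -> ev (@of_seq p F) us = F us.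
Proof.
by move=> [F1 _] e; rewrite /ev /of_seq pm_sum_gen ?tupE //; apply: tpow_respect.
Qed.

Lemma cochain_of_seq p F : multi B p F -> cochain (@of_seq p F).
Proof.
move=> Fc; split=> [|a u us e]; last by rewrite !ev_of_seq //; case: Fc => _; apply.
by apply: pm_sum_linear; apply: tpow_respect; case: Fc.
Qed.

Definition trunc p (f : precochain B N p) : T := fun us => if size us == p then ev f us else 0.

Lemma trunc_ev p (f : precochain B N p) us : size us = p -> trunc f us = ev f us.
Proof. by move=> e; rewrite /trunc e eqxx. Qed.

Lemma trunc_coch p (f : precochain B N p) : cochain f -> coch B p (trunc f).
Proof.
move=> fc; split; last by move=> us /eqP/negPf e; rewrite /trunc e.
by apply: multi_ext (multi_ev fc) => us e; rewrite trunc_ev.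
Qed.

Lemma trunc_of_seq p F : coch B p F -> trunc (@of_seq p F) = F.
Proof.
move=> [Fc F0]; apply/funext => us; rewrite /trunc.
by have [e|/eqP/F0 //] := eqVneq (size us) p; rewrite ev_of_seq.
Qed.

Lemma trunc_inj p (f g : precochain B N p) : cochain f -> cochain g ->
  trunc f = trunc g -> f = g.
Proof.
move=> [fl _] [gl _] fg; apply/funext; apply: (presmod_lin_ext fl gl) => v.
have := congr1 (fun F : T => F v) fg.
by rewrite /trunc size_tuple eqxx /ev tup_tuple.
Qed.

Lemma trunc_lin p c (f g : precochain B N p) : trunc (c *: f + g) = c *: trunc f + trunc g.
Proof.
apply/funext => us; rewrite -[RHS]/(c *: trunc f us + trunc g us) /trunc.
by case: eqP => // _; rewrite scaler0 addr0.
Qed.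
End TensorPower.

Section Comparison.
Variables (k : comNzRingType) (A U : algType k) (B : left_bialgebroid A U).
Variables (N : lmodType U) (Y : yd_algebra B N) (bc : braided_commutative Y).
Local Notation t := (tgt B).
Local Notation M := (resk N).
Local Notation T := (seq U -> resk N).
Local Notation O := (cochain_operad bc).
Local Notation pl := (opl O).
Implicit Types (us : seq U) (f g h : T).

(** Signs act through [U] in the formulas for cochains and through [k] in the operad. *)
Lemma sign_scale n (x : M) : ((-1) ^+ n : U) *: (x : N) = signk k n *: x.
Proof.
rewrite -[RHS]/(((-1) ^+ n)%:A *: (x : N)); congr (_ *: _).
by rewrite -[RHS]/(in_alg U _) rmorph_sign.
Qed.

Lemma oE q i f g : o_part O q i f g = part Y q i f g. Proof. by []. Qed.
Lemma muE : o_mu O = mu Y. Proof. by []. Qed.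


Lemma cobd_del p (f : precochain B N p) us : cochain f -> size us = p.+1 ->
  cobd f us = odel O p (trunc f) us.
Proof.
move=> fc us_p; have tc := trunc_coch fc; have [Fm _] := tc.
have E c (x y z : T) : (x - y + c *: z) us = x us - y us + c *: z us by [].
rewrite /odel E !oE !muE.
have -> : part Y p 1 (mu Y) (trunc f) us = act us`_0 (trunc f (behead us)).
  case: us us_p {E} => // u us [us_p].
  by rewrite -[u :: us]/([:: u] ++ us) -[us in LHS]cats0 part_cat // (ins_mu_r _ _ Fm).
case: p f us_p fc tc Fm => [|p] f us_p fc tc Fm {E}.
  case: us us_p => [|u [|]] //= _; rewrite /pl lsum0 subr0.
  have -> : part Y 0 0 (mu Y) (trunc f) [:: u] = act (t (eps B u)) (trunc f [::]).
    by rewrite -[[:: u]]/([::] ++ [::] ++ [:: u]) part_cat // ins_mu_l0.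
  rewrite /signk expr1 scaleN1r !trunc_ev //.
case/lastP: us us_p => [|us' v]; first by [].
rewrite size_rcons => -[]; case/lastP: us' => [|us u]; first by [].
rewrite size_rcons => -[us_p].
have -> : part Y p.+1 0 (mu Y) (trunc f) (rcons (rcons us u) v) =
    trunc f (rcons us (u * t (eps B v))).
  rewrite -(cats1 _ v) -[rcons us u ++ _]cat0s part_cat ?size_rcons ?us_p //.
  by rewrite (@ins_mu_l _ _ _ _ _ Y _ p.+1) // us_p.
set vs := rcons (rcons us u) v.
have vs_p : size vs = p.+2 by rewrite !size_rcons us_p.
have -> : pl p.+1 2 (trunc f) (mu Y) vs =
    \sum_(i < p.+1) signk k i *: trunc f (take i vs ++ vs`_i * vs`_i.+1 :: drop i.+2 vs).
  rewrite /opl /osum fct_sumE; apply: eq_bigr => i _.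
  rewrite -[LHS]/(signk k (3 * i) *: part Y 2 i (trunc f) (mu Y) vs); congr (_ *: _).
    (* The sign belongs to [|mu| * i]; as [|mu|] is the arity 2 minus 1, it is encoded by the 3 of
       the same parity. *)
    by apply: sg_odd; rewrite oddM.
  have ip := ltn_ord i.
  rewrite -[X in part _ _ _ _ _ X](cat_take_drop i vs) (drop_nth 0) ?vs_p; last by lia.
  rewrite (drop_nth 0) ?vs_p; last by lia.
  rewrite -[_ :: _ :: drop _ _]/([:: vs`_i; vs`_i.+1] ++ drop i.+2 vs) part_cat //; last first.
    by rewrite size_takel // vs_p; lia.
  by rewrite (@ins_mu _ _ _ _ _ Y _ p.+1) // size_takel ?size_drop vs_p; lia.
rewrite /cobd !trunc_ev ?size_behead ?vs_p ?size_rcons ?us_p //.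
congr (_ + _); last first.
  rewrite [LHS]sign_scale; congr (_ *: ev f _).
  rewrite /vs -!cats1 -!catA /= take_cat us_p ltnn subnn cats0 nth_cat us_p ltnn subnn /=.
  by rewrite nth_cat us_p ltnNge leqnSn /= subSnn cats1.
congr (_ + _); rewrite -[RHS]/(- (_ : M)) -sumrN; apply: eq_bigr => i _.
rewrite [LHS]sign_scale sgS scaleNr trunc_ev //.
by have ip := ltn_ord i; rewrite size_cat /= size_takel ?size_drop ?vs_p; lia.
Qed.

Lemma ins_ext p q f f' g g' a b e : size b = q -> (size a + size e).+1 = p ->
  (forall us, size us = p -> f us = f' us) -> (forall us, size us = q -> g us = g' us) ->
  ins Y f g a b e = ins Y f' g' a b e.
Proof.
move=> bq ae ff' gg'; apply: eq_Dsum => [b1 b1s|m n]; first by rewrite gg' // b1s.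
by apply: eq_ssum => a1 w a1s; rewrite ff' // size_cat /= a1s addnS.
Qed.

Lemma cup_trunc p q (f : precochain B N p) (g : precochain B N q) us :
  cochain f -> cochain g -> size us = (p + q)%N ->
  Defs.cup Y f g us = ocup O p q (trunc f) (trunc g) us.
Proof.
move=> fc gc us_pq; have [Fm _] := trunc_coch fc; have [Gm _] := trunc_coch gc.
have ap : size (take p us) = p by rewrite size_takel // us_pq leq_addr.
have bq : size (drop p us) = q by rewrite size_drop us_pq addKn.
rewrite -[us in RHS](cat_take_drop p) /ocup !oE -[drop p us in RHS]cats0 part_cat //.
rewrite (ins_cup Fm Gm ap bq).
  by rewrite /Defs.cup /rcup; apply: (@eq_ssum k A U B M) => us1 w us1s; rewrite !trunc_ev // us1s ap.
by move=> a1 v a1s; rewrite -[a1 ++ _]cat0s part_cat.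
Qed.

Lemma circ_trunc p q r j (f : precochain B N p) (g : precochain B N q) us :
  cochain f -> cochain g -> (j < p)%N -> r.+1 = (p + q)%N -> size us = r ->
  circ Y f j g us = part Y q j (trunc f) (trunc g) us.
Proof.
move=> fc gc jp rpq us_r.
have aj : size (take j us) = j by rewrite size_takel //; lia.
have bq : size (take q (drop j us)) = q by rewrite size_takel // size_drop; lia.
have ae : (size (take j us) + size (drop (j + q) us)).+1 = p by rewrite aj size_drop; lia.
rewrite /part; case: leqP => [_|]; last by lia.
rewrite (@ins_ext p q _ (ev f) _ (ev g)) //; try exact: trunc_ev.
have Fb := Phi_balanced Y (multi_ev fc) ae.
rewrite /circ ssum_tsum.
rewrite -[LHS]/(tens_sum _ (Phi Y (ev f) (take j us) (drop (j + q) us))).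
rewrite /Dmap (lin_ssum _ _ _ (tsum_linear Fb)) insE DsumE; apply: (@eq_ssum k A U B M) => us1 w _.
rewrite (lin_tsum _ _ (tsum_linear Fb)); apply: eq_tsum => m n.
by rewrite tsum_tensor.
Qed.

Lemma barcirc_trunc p q r (f : precochain B N p) (g : precochain B N q) us :
  cochain f -> cochain g -> r.+1 = (p + q)%N -> size us = r ->
  barcirc Y f g us = (okap k p q *: pl p q (trunc f) (trunc g)) us.
Proof.
move=> fc gc rpq us_r; rewrite -[RHS]/(okap k p q *: (pl p q (trunc f) (trunc g) us)).
rewrite /barcirc [LHS]sign_scale; congr (_ *: _).
rewrite /opl /osum fct_sumE; apply: eq_bigr => i _.
rewrite [LHS]sign_scale -[RHS]/(_ *: part Y q i (trunc f) (trunc g) us).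
by rewrite (circ_trunc fc gc _ rpq us_r).
Qed.

Lemma bracket_trunc p q r (f : precochain B N p) (g : precochain B N q) us :
  cochain f -> cochain g -> r.+1 = (p + q)%N -> size us = r ->
  bracket Y f g us = obr O p q (trunc f) (trunc g) us.
Proof.
move=> fc gc rpq us_r; rewrite /bracket (barcirc_trunc fc gc rpq us_r).
have rqp : r.+1 = (q + p)%N by rewrite addnC.
rewrite (barcirc_trunc gc fc rqp us_r) [X in _ - X]sign_scale.
rewrite -[RHS]/((okap k p q *: pl p q (trunc f) (trunc g)) us - pl q p (trunc g) (trunc f) us).
congr (_ - _); rewrite -[LHS]/(_ *: (_ *: _)) scalerA.
by rewrite /okap mulnC sg_sq scale1r.
Qed.
End Comparison.

(** * Gerstenhaber structure on homology *)

Section DirectSumLinear.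
Variables (k : comNzRingType) (V : nat -> lmodType k).

Lemma dinj_linear p : linear (@dinj k V p).
Proof.
move=> c x y; apply: dsumP => n; rewrite -[RHS]/(c *: dinj_fun x n + dinj_fun y n) /=.
rewrite /dinj_fun; case: eqP => [e|_]; last by rewrite scaler0 addr0.
by move: x y; case: _ / e.
Qed.

Lemma dinj0 p : dinj (0 : V p) = 0.
Proof. exact: (@lin0 k (V p) (dsum V) _ (@dinj_linear p)). Qed.

Lemma dsum_decomp (x : dsum V) n : (forall p, (n <= p)%N -> sval x p = 0) ->
  x = \sum_(p < n) dinj (sval x p).
Proof.
have ev_sum q m (F : 'I_m -> dsum V) : sval (\sum_(p < m) F p) q = \sum_(p < m) sval (F p) q.
  by apply: (big_morph (fun y : dsum V => sval y q)).
move=> xn; apply: dsumP => q; rewrite ev_sum /=.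
case: (ltnP q n) => [qn|qn].
  rewrite (bigD1 (Ordinal qn)) //= dinj_funE big1 ?addr0 // => i iq.
  by rewrite dinj_fun0 // => e; case/eqP: iq; apply: val_inj.
by rewrite xn // big1 // => i _; rewrite dinj_fun0 // => e; move: qn; rewrite leqNgt -e ltn_ord.
Qed.

Lemma dsum_lin_ext (W : lmodType k) (F G : dsum V -> W) : linear F -> linear G ->
  (forall p (v : V p), F (dinj v) = G (dinj v)) -> F =1 G.
Proof.
move=> Fl Gl FG x; case: (svalP x) => n xn.
rewrite (dsum_decomp xn) (lin_sum _ _ Fl) (lin_sum _ _ Gl).
by apply: eq_bigr => i _; apply: FG.
Qed.

(* The bilinear operation on [dsum V] of degree - e with components
   b p q n : V p -> V q -> V n for n + e = p + q. *)
Section GradedOperation.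
Variables (e : nat) (b : forall p q n, V p -> V q -> V n).

Definition gop_fun (x y : dsum V) n : V n :=
  \sum_(p < (n + e).+1) \sum_(q < (n + e).+1 | (p + q == n + e)%N) b n (sval x p) (sval y q).

Hypothesis bl : forall p q n (y : V q), (n + e)%N = (p + q)%N -> linear (fun x : V p => b n x y).
Hypothesis br : forall p q n (x : V p), (n + e)%N = (p + q)%N -> linear (fun y : V q => b n x y).

Lemma gop_supp x y : exists N, forall n, (N <= n)%N -> gop_fun x y n = 0.
Proof.
case: (svalP x) => n xn; case: (svalP y) => m ym; exists (n + m)%N => i nmi.
rewrite /gop_fun big1 // => p _; rewrite big1 // => q /eqP pq.
case: (leqP n p) => np; first by rewrite xn //; apply: (lin0 (bl (sval y q) _)); rewrite pq.
rewrite (ym q); last by lia.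
by apply: (lin0 (br (sval x p) _)); rewrite pq.
Qed.

Definition gop (x y : dsum V) : dsum V := exist _ (gop_fun x y) (gop_supp x y).

Lemma gop_linl y : linear (gop^~ y).
Proof.
move=> c x x'; apply: dsumP => n; rewrite -[RHS]/(c *: gop_fun x y n + gop_fun x' y n) /=.
rewrite /gop_fun scaler_sumr -big_split; apply: eq_bigr => p _ /=.
rewrite scaler_sumr -big_split; apply: eq_bigr => q /eqP pq /=.
by rewrite (bl (sval y q)).
Qed.

Lemma gop_linr x : linear (gop x).
Proof.
move=> c y y'; apply: dsumP => n; rewrite -[RHS]/(c *: gop_fun x y n + gop_fun x y' n) /=.
rewrite /gop_fun scaler_sumr -big_split; apply: eq_bigr => p _ /=.
rewrite scaler_sumr -big_split; apply: eq_bigr => q /eqP pq /=.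
by rewrite (br (sval x p)).
Qed.

Lemma gop_dinj_val p q (x : V p) (y : V q) n :
  sval (gop (dinj x) (dinj y)) n = if (n + e == p + q)%N then b n x y else 0.
Proof.
rewrite /= /gop_fun.
have z1 p' q' : (n + e)%N = (p' + q')%N -> (p' != p) || (q' != q) ->
    b n (sval (dinj x) p') (sval (dinj y) q') = 0.
  move=> ne; case/orP => /eqP /nesym E.
    by rewrite [sval (dinj x) p']dinj_fun0 //; apply: (lin0 (bl _ ne)).
  by rewrite [sval (dinj y) q']dinj_fun0 //; apply: (lin0 (br _ ne)).
case: eqP => [ne|ne]; last first.
  rewrite big1 // => p' _; rewrite big1 // => q' /eqP ne'.
  apply: z1; rewrite ?ne' // -negb_and; apply/negP => /andP[/eqP E1 /eqP E2].
  by case: ne; rewrite -ne' E1 E2.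
have pn : (p < (n + e).+1)%N by lia.
have qn : (q < (n + e).+1)%N by lia.
rewrite (bigD1 (Ordinal pn)) //= (bigD1 (Ordinal qn)) /=; last by rewrite ne.
rewrite [X in _ + X + _]big1 => [|q' /andP[/eqP ne' qq']]; last first.
  apply: (z1 p q'); rewrite ?ne' //.
  by rewrite -(inj_eq val_inj) in qq'; rewrite qq' orbT.
rewrite [X in _ + X]big1 => [|p' pp']; last first.
  rewrite big1 // => q' /eqP ne'; apply: z1; rewrite ?ne' //.
  by rewrite -(inj_eq val_inj) in pp'; rewrite pp'.
by rewrite !addr0 !dinj_funE.
Qed.

Lemma gop_dinj p q n (x : V p) (y : V q) : (n + e)%N = (p + q)%N ->
  gop (dinj x) (dinj y) = dinj (b n x y).
Proof.
move=> ne; apply: dsumP => m; rewrite gop_dinj_val [RHS]/=.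
have [mn|mn] := eqVneq n m; first by subst m; rewrite ne eqxx dinj_funE.
rewrite dinj_fun0; last exact/eqP.
by case: eqP => // me; case/eqP: mn; lia.
Qed.

Lemma gop_dinj0 p q (x : V p) (y : V q) : (p + q < e)%N -> gop (dinj x) (dinj y) = 0.
Proof.
by move=> pqe; apply: dsumP => n; rewrite gop_dinj_val; case: eqP => // ne; lia.
Qed.
End GradedOperation.
End DirectSumLinear.

Section Homology.
Variables (k : comNzRingType) (T : lmodType k) (O : mult_operad T).
Local Notation C := (o_dom O).
Local Notation kap := (okap k).
Local Notation pl := (opl O).
Local Notation br := (obr O).
Local Notation cup := (ocup O).
Local Notation del := (odel O).
Implicit Types (p q r n : nat) (f g h : T).

Definition Zc p f := C p f /\ del p f = 0.
Definition Bd p f := if p is q.+1 then exists2 g, C q g & f = del q g else f = 0.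

Lemma ZcC p f : Zc p f -> C p f. Proof. by case. Qed.
Lemma Zc_lin p c f g : Zc p f -> Zc p g -> Zc p (c *: f + g).
Proof.
move=> [Cf df] [Cg dg]; split; first exact: o_dom_lin.
by rewrite del_lin // df dg scaler0 addr0.
Qed.
Lemma Bd0 p : Bd p 0.
Proof.
case: p => [//|p]; exists 0; first exact: o_dom0.
have := del_lin (-1) (o_dom0 O p) (o_dom0 O p).
by rewrite scaler0 addr0 scaleN1r addNr.
Qed.
Lemma Bd_lin p c f g : Bd p f -> Bd p g -> Bd p (c *: f + g).
Proof.
case: p => [-> ->|p [f' Cf ->] [g' Cg ->]]; first by rewrite scaler0 addr0.
by exists (c *: f' + g'); [apply: o_dom_lin|rewrite del_lin].
Qed.
Lemma BdD p f g : Bd p f -> Bd p g -> Bd p (f + g).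
Proof. by move=> Bf; rewrite -[f]scale1r; apply: Bd_lin. Qed.
Lemma BdZ p c f : Bd p f -> Bd p (c *: f).
Proof. by move=> Bf; rewrite -[_ *: _]addr0; apply/Bd_lin/Bd0. Qed.
Lemma Bd_del p n f : n = p.+1 -> C p f -> Bd n (del p f).
Proof. by move=> -> Cf; exists f. Qed.

Lemma Bd_ocup p q f g : Zc p f -> Zc q g -> Bd p f \/ Bd q g -> Bd (p + q) (cup p q f g).
Proof.
move=> [Cf df] [Cg dg] [].
  case: p Cf df => [|p] Cf df /=.
    by move=> ->; rewrite /ocup (o0r _ (o_dom_mu O)) // (o0l 1) //; apply: Bd0.
  case=> f' Cf' ->; have := del_cup Cf' Cg; rewrite dg.
  have -> : cup p q.+1 f' 0 = 0 by rewrite /ocup (o0r _ (mu0_dom Cf')).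
  by rewrite scaler0 addr0 => <-; exists (cup p q f' g) => //; apply: cup_dom.
case: q Cg dg => [|q] Cg dg /=.
  by move=> ->; rewrite /ocup (o0r _ (mu0_dom Cf)) //; apply: Bd0.
case=> g' Cg' ->; have := del_cup Cf Cg'; rewrite df.
have -> : cup p.+1 q 0 g' = 0 by rewrite /ocup (o0r _ (o_dom_mu O)) // (o0l p.+2).
rewrite add0r => E; rewrite -[cup _ _ _ _]scale1r -(sg_sq k p) -scalerA -E.
by apply: BdZ; apply: Bd_del; [rewrite addnS|apply: cup_dom].
Qed.

Lemma Zc_ocup p q f g : Zc p f -> Zc q g -> Zc (p + q) (cup p q f g).
Proof.
move=> [Cf df] [Cg dg]; split; first exact: cup_dom.
rewrite del_cup // df dg.
rewrite /ocup (o0r _ (o_dom_mu O)) // (o0l p.+2) // add0r (o0r _ (mu0_dom Cf)) //.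
by rewrite scaler0.
Qed.

Lemma br0r p q f : C p f -> br p q f 0 = 0.
Proof.
move=> Cf; have := br_linr (-1) Cf (o_dom0 O q) (o_dom0 O q).
by rewrite scaler0 addr0 scaleN1r addNr.
Qed.
Lemma br0l p q g : C q g -> br p q 0 g = 0.
Proof.
move=> Cg; have := br_linl (-1) (o_dom0 O p) (o_dom0 O p) Cg.
by rewrite scaler0 addr0 scaleN1r addNr.
Qed.

Lemma Zc_br p q n f g : Zc p f -> Zc q g -> (n + 1)%N = (p + q)%N -> Zc n (br p q f g).
Proof.
move=> [Cf df] [Cg dg]; rewrite addn1 => e; split; first exact: br_dom e.
by rewrite (del_br_der Cf Cg e) df dg br0r // br0l // scaler0 addr0.
Qed.

(** If [f] is the bracket of [mu] with [f'], and that of [mu] with [g] is 0, the Jacobi identity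
    makes the bracket of [f] and [g] the differential of that of [f'] and [g]. *)
Lemma Bd_br_l p q n f g : Zc p f -> Zc q g -> (n + 1)%N = (p + q)%N -> Bd p f -> Bd n (br p q f g).
Proof.
move=> [Cf df] [Cg dg] npq; case: p Cf df npq => [|p] Cf df npq /=.
  by move=> ->; rewrite br0l //; apply: Bd0.
case=> f' Cf' ->; have := br_jacobi (o_dom_mu O) Cf' Cg.
rewrite -!del_br dg br0r // scaler0 addr0 => <-.
(* For [p = q = 0] the arity of the bracket of [f'] and [g] is truncated, but this bracket is 0. *)
case: (posnP (p + q)) => [pq0|pq_gt0].
  have [-> ->] : p = 0%N /\ q = 0%N by lia.
  by rewrite br00 del_br br0r; [apply: Bd0|apply: o_dom_mu].
apply: Bd_del; first by lia.
by apply: br_dom'.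
Qed.

Lemma Bd_br_r p q n f g : Zc p f -> Zc q g -> (n + 1)%N = (p + q)%N -> Bd q g -> Bd n (br p q f g).
Proof.
move=> Zf Zg e Bg; rewrite brC -scaleNr; apply: BdZ.
by apply: (Bd_br_l Zg Zf) => //; rewrite e addnC.
Qed.

(** An interface to any model of cocycles modulo coboundaries. [h_cl] is total on [T], but its
    values matter on cocycles only. *)
Record homology (V : nat -> lmodType k) := Homology {
  h_cl : forall p, T -> V p;
  h_rep : forall p, V p -> T;
  h_repZ : forall p v, Zc p (@h_rep p v);
  h_repK : forall p v, h_cl p (@h_rep p v) = v;
  h_lin : forall p c f g, Zc p f -> Zc p g -> h_cl p (c *: f + g) = c *: h_cl p f + h_cl p g;
  h_eq : forall p f g, Zc p f -> Zc p g -> (h_cl p f = h_cl p g <-> Bd p (f - g)) }.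

Section Induced.
Variables (V : nat -> lmodType k) (H : homology V).
Local Notation cl := (h_cl H).
Local Notation rep := (h_rep H).

Lemma rep_cl p f : Zc p f -> Bd p (rep (cl p f) - f).
Proof. by move=> Zf; apply/(h_eq H (h_repZ H _) Zf); rewrite h_repK. Qed.

Lemma h_ind p (P : V p -> Prop) : (forall f, Zc p f -> P (cl p f)) -> forall v, P v.
Proof. by move=> HP v; rewrite -(h_repK H v); apply/HP/h_repZ. Qed.

Section Operation.
Variables (e : nat) (m : nat -> nat -> T -> T -> T).
Hypotheses
  (m_linl : forall p q c f f' g, C p f -> C p f' -> C q g ->
     m p q (c *: f + f') g = c *: m p q f g + m p q f' g)
  (m_linr : forall p q c f g g', C p f -> C q g -> C q g' ->
     m p q f (c *: g + g') = c *: m p q f g + m p q f g')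
  (m_Z : forall p q n f g, Zc p f -> Zc q g -> (n + e)%N = (p + q)%N -> Zc n (m p q f g))
  (m_Bl : forall p q n f g, Zc p f -> Zc q g -> (n + e)%N = (p + q)%N -> Bd p f -> Bd n (m p q f g))
  (m_Br : forall p q n f g, Zc p f -> Zc q g -> (n + e)%N = (p + q)%N -> Bd q g -> Bd n (m p q f g)).

Definition h_op p q n (x : V p) (y : V q) : V n := cl n (m p q (rep x) (rep y)).

Lemma Zc_sub p f g : Zc p f -> Zc p g -> Zc p (f - g).
Proof. by move=> Zf Zg; rewrite addrC -scaleN1r; apply: Zc_lin. Qed.

(** Representatives are changed one at a time, [g] first and then [f]; either change alters the
    value by a coboundary. *)
Lemma h_op_cl p q n f g : Zc p f -> Zc q g -> (n + e)%N = (p + q)%N ->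
  h_op n (cl p f) (cl q g) = cl n (m p q f g).
Proof.
move=> Zf Zg ne; apply/h_eq; [by apply: m_Z ne; apply: h_repZ|exact: m_Z ne|].
set f' := rep _; set g' := rep _.
have Zf' : Zc p f' by apply: h_repZ.
have Zg' : Zc q g' by apply: h_repZ.
have -> : m p q f' g' - m p q f g = m p q f' (g' - g) + m p q (f' - f) g.
  rewrite [g' - g]addrC [f' - f]addrC -!scaleN1r.
  rewrite m_linr ?m_linl //; try exact: ZcC.
  by modring.
apply: BdD.
  by apply: m_Br ne _ => //; [apply: Zc_sub|apply: rep_cl].
by apply: m_Bl ne _ => //; [apply: Zc_sub|apply: rep_cl].
Qed.

Lemma h_op_linl p q n (y : V q) : (n + e)%N = (p + q)%N -> linear (fun x : V p => h_op n x y).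
Proof.
move=> ne c x x'; elim/h_ind: x => f Zf; elim/h_ind: x' => f' Zf'; elim/h_ind: y => g Zg.
rewrite -h_lin // !h_op_cl //; last exact: Zc_lin.
by rewrite m_linl ?h_lin //; try exact: ZcC; apply: m_Z ne.
Qed.

Lemma h_op_linr p q n (x : V p) : (n + e)%N = (p + q)%N -> linear (fun y : V q => h_op n x y).
Proof.
move=> ne c y y'; elim/h_ind: x => f Zf; elim/h_ind: y => g Zg; elim/h_ind: y' => g' Zg'.
rewrite -h_lin // !h_op_cl //; last exact: Zc_lin.
by rewrite m_linr ?h_lin //; try exact: ZcC; apply: m_Z ne.
Qed.

Definition h_gop := gop h_op_linl h_op_linr.

Lemma h_gop_cl p q n f g : Zc p f -> Zc q g -> (n + e)%N = (p + q)%N ->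
  h_gop (dinj (cl p f)) (dinj (cl q g)) = dinj (cl n (m p q f g)).
Proof. by move=> Zf Zg ne; rewrite /h_gop (gop_dinj _ _ _ _ ne) h_op_cl. Qed.

Lemma h_gop_cl0 p q (x : V p) (y : V q) : (p + q < e)%N -> h_gop (dinj x) (dinj y) = 0.
Proof. exact: gop_dinj0. Qed.
End Operation.

Variables (one : T) (one_Z : Zc 0 one).
Hypotheses (one_l : forall q f, C q f -> cup 0 q one f = f)
  (one_r : forall p f, C p f -> cup p 0 f one = f).

Lemma ocup_Z p q n f g : Zc p f -> Zc q g -> (n + 0)%N = (p + q)%N -> Zc n (cup p q f g).
Proof. by rewrite addn0 => Zf Zg ->; apply: Zc_ocup. Qed.
Lemma ocup_Bl p q n f g : Zc p f -> Zc q g -> (n + 0)%N = (p + q)%N -> Bd p f -> Bd n (cup p q f g).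
Proof. by rewrite addn0 => Zf Zg -> Bf; apply: Bd_ocup => //; left. Qed.
Lemma ocup_Br p q n f g : Zc p f -> Zc q g -> (n + 0)%N = (p + q)%N -> Bd q g -> Bd n (cup p q f g).
Proof. by rewrite addn0 => Zf Zg -> Bg; apply: Bd_ocup => //; right. Qed.

Definition h_cup := h_gop (@cup_linl _ _ O) (@cup_linr _ _ O) ocup_Z ocup_Bl ocup_Br.
Definition h_br := h_gop (@br_linl _ _ O) (@br_linr _ _ O) Zc_br Bd_br_l Bd_br_r.

Lemma h_cup_cl p q f g : Zc p f -> Zc q g ->
  h_cup (dinj (cl p f)) (dinj (cl q g)) = dinj (cl (p + q) (cup p q f g)).
Proof. by move=> Zf Zg; apply: h_gop_cl => //; rewrite addn0. Qed.

Lemma h_br_cl p q n f g : Zc p f -> Zc q g -> n.+1 = (p + q)%N ->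
  h_br (dinj (cl p f)) (dinj (cl q g)) = dinj (cl n (br p q f g)).
Proof. by move=> Zf Zg e; apply: h_gop_cl => //; rewrite addn1. Qed.

Lemma h_br00 (x y : V 0) : h_br (dinj x) (dinj y) = 0.
Proof. exact: h_gop_cl0. Qed.

Lemma h_cup_linl y : linear (h_cup^~ y). Proof. exact: gop_linl. Qed.
Lemma h_cup_linr x : linear (h_cup x). Proof. exact: gop_linr. Qed.
Lemma h_br_linl y : linear (h_br^~ y). Proof. exact: gop_linl. Qed.
Lemma h_br_linr x : linear (h_br x). Proof. exact: gop_linr. Qed.

Lemma dinj_cl n n' f : n = n' -> dinj (cl n f) = dinj (cl n' f).
Proof. by move=> ->. Qed.

Lemma dinjZ p c (v : V p) : c *: dinj v = dinj (c *: v).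
Proof. by rewrite (linZ (@dinj_linear k V p)). Qed.
Lemma dinjD p (v w : V p) : dinj v + dinj w = dinj (v + w).
Proof. by rewrite (linD (@dinj_linear k V p)). Qed.

Lemma clZ p c f : Zc p f -> cl p (c *: f) = c *: cl p f.
Proof.
have Z0 : Zc p 0 by split; [apply: o_dom0|rewrite del_br br0r //; apply: o_dom_mu].
have cl0 : cl p 0 = 0.
  by have := h_lin H (-1) Z0 Z0; rewrite scaler0 addr0 scaleN1r addNr.
by move=> Zf; have := h_lin H c Zf Z0; rewrite cl0 !addr0.
Qed.
Lemma clD p f g : Zc p f -> Zc p g -> cl p (f + g) = cl p f + cl p g.
Proof. by move=> Zf Zg; have := h_lin H 1 Zf Zg; rewrite !scale1r. Qed.
Lemma ZcZ p c f : Zc p f -> Zc p (c *: f).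
Proof.
have Z0 : Zc p 0 by split; [apply: o_dom0|rewrite del_br br0r //; apply: o_dom_mu].
by move=> Zf; have := Zc_lin c Zf Z0; rewrite addr0.
Qed.
Lemma ZcD p f g : Zc p f -> Zc p g -> Zc p (f + g).
Proof. by move=> Zf Zg; have := Zc_lin 1 Zf Zg; rewrite scale1r. Qed.

Lemma h_cup_deg p q (x : V p) (y : V q) :
  exists z : V (p + q)%N, h_cup (dinj x) (dinj y) = dinj z.
Proof.
elim/h_ind: x => f Zf; elim/h_ind: y => g Zg.
by rewrite h_cup_cl //; eexists.
Qed.

(** Both sides are linear in each variable, so [dsum_lin_ext] reduces them in turn to homogeneous
    elements. *)
Lemma h_cupA : associative h_cup.
Proof.
move=> x y z.
apply: (@dsum_lin_ext _ _ _ (fun x => h_cup x (h_cup y z)) (fun x => h_cup (h_cup x y) z)).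
- exact: h_cup_linl.
- by apply: (lin_comp (@h_cup_linl z)); apply: h_cup_linl.
move=> p v; move: y; apply: (@dsum_lin_ext _ _ _ (fun y => h_cup (dinj v) (h_cup y z))
  (fun y => h_cup (h_cup (dinj v) y) z)).
- by apply: (lin_comp (@h_cup_linr _)); apply: h_cup_linl.
- by apply: (lin_comp (@h_cup_linl z)); apply: h_cup_linr.
move=> q w; move: z; apply: (@dsum_lin_ext _ _ _ (fun z => h_cup (dinj v) (h_cup (dinj w) z))
  (h_cup (h_cup (dinj v) (dinj w)))).
- by apply: (lin_comp (@h_cup_linr _)); apply: h_cup_linr.
- exact: h_cup_linr.
move=> r u; elim/h_ind: v => f Zf; elim/h_ind: w => g Zg; elim/h_ind: u => h Zh.
have Zfg := Zc_ocup Zf Zg; have Zgh := Zc_ocup Zg Zh.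
rewrite !h_cup_cl // cupA; try exact: ZcC.
by apply: dinj_cl; rewrite addnA.
Qed.

Lemma h_cup1l : left_id (dinj (cl 0 one)) h_cup.
Proof.
apply: (@dsum_lin_ext _ _ _ (h_cup (dinj (cl 0 one))) id) => [||q v]; [exact: h_cup_linr|by []|].
by elim/h_ind: v => f Zf; rewrite h_cup_cl // one_l //; apply: ZcC.
Qed.

Lemma h_cup1r : right_id (dinj (cl 0 one)) h_cup.
Proof.
apply: (@dsum_lin_ext _ _ _ (h_cup^~ (dinj (cl 0 one))) id) => [||q v]; [exact: h_cup_linl|by []|].
elim/h_ind: v => f Zf; rewrite h_cup_cl // one_r //; last exact: ZcC.
by apply: dinj_cl; rewrite addn0.
Qed.

Lemma h_cupC p q (x : V p) (y : V q) :
  h_cup (dinj x) (dinj y) = (-1) ^+ (p * q) *: h_cup (dinj y) (dinj x).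
Proof.
elim/h_ind: x => f Zf; elim/h_ind: y => g Zg; have [[Cf df] [Cg dg]] := (Zf, Zg).
rewrite !h_cup_cl // (dinj_cl _ (addnC q p)) dinjZ.
have Zgf := Zc_ocup Zg Zf; rewrite addnC in Zgf.
have Zfg := Zc_ocup Zf Zg.
rewrite -clZ //; congr (dinj _); apply/(h_eq H Zfg); first exact: ZcZ.
rewrite (cup_comm Cf Cg df dg) -/(signk k (p * q)) addrC addKr; do 2!apply: BdZ.
case: p {df Zf Zgf Zfg} Cf => [|p] Cf; last by apply: Bd_del; [lia|apply: pl_dom'].
rewrite [pl 0 q f g]lsum0 del_br br0r; [exact: Bd0|exact: o_dom_mu].
Qed.

Lemma h_br_deg p q r (x : V p) (y : V q) : (p + q)%N = r.+1 ->
  exists z : V r, h_br (dinj x) (dinj y) = dinj z.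
Proof.
move=> e; elim/h_ind: x => f Zf; elim/h_ind: y => g Zg.
by rewrite (h_br_cl Zf Zg (esym e)); eexists.
Qed.

Lemma h_brC p q (x : V p) (y : V q) :
  h_br (dinj x) (dinj y) = - ((-1) ^+ (p.+1 * q.+1) *: h_br (dinj y) (dinj x)).
Proof.
elim/h_ind: x => f Zf; elim/h_ind: y => g Zg.
case: (posnP (p + q)) => [pq0|pq_gt0].
  have [p0 q0] : p = 0%N /\ q = 0%N by lia.
  by subst p q; rewrite !h_br00 scaler0 oppr0.
have e : (p + q).-1.+1 = (p + q)%N by lia.
have e' : (p + q).-1.+1 = (q + p)%N by lia.
rewrite (h_br_cl Zf Zg e) (h_br_cl Zg Zf e') brC -/(kap p q) -!scaleNr dinjZ -clZ //.
by apply: (Zc_br Zg Zf); rewrite addn1.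
Qed.

Lemma cl0 p : cl p 0 = 0.
Proof.
have Z0 : Zc p 0 by split; [apply: o_dom0|rewrite del_br br0r //; apply: o_dom_mu].
by have := h_lin H (-1) Z0 Z0; rewrite scaler0 addr0 scaleN1r addNr.
Qed.

Lemma Zc0 p : Zc p 0.
Proof. by split; [apply: o_dom0|rewrite del_br br0r //; apply: o_dom_mu]. Qed.

Lemma Zc_br' p q f g : Zc p f -> Zc q g -> Zc (p + q).-1 (br p q f g).
Proof.
move=> Zf Zg; case: (posnP (p + q)) => [pq0|pq_gt0]; last by apply: Zc_br => //; lia.
have [-> ->] : p = 0%N /\ q = 0%N by lia.
by rewrite br00; apply: Zc0.
Qed.

(** A form uniform in all degrees: for [p = q = 0] the truncated degree is 0 and both sides
    vanish. *)
Lemma h_br_cl' p q f g : Zc p f -> Zc q g ->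
  h_br (dinj (cl p f)) (dinj (cl q g)) = dinj (cl (p + q).-1 (br p q f g)).
Proof.
move=> Zf Zg; case: (posnP (p + q)) => [pq0|pq_gt0]; last by apply: h_br_cl => //; lia.
have [p0 q0] : p = 0%N /\ q = 0%N by lia.
by subst p q; rewrite h_br00 br00 cl0 dinj0.
Qed.

(* The degrees on the two sides can only differ if f = 0. *)
Lemma dinj_cl_shift n n' f : Zc n f -> n = n' \/ f = 0 -> Zc n' f /\ dinj (cl n f) = dinj (cl n' f).
Proof. by move=> Zf [<-|->] //; rewrite !cl0 !dinj0; split; first exact: Zc0. Qed.

Lemma br_eq0 p q f g : (p + q)%N = 0%N -> br p q f g = 0.
Proof. by move/eqP; rewrite addn_eq0 => /andP[/eqP -> /eqP ->]; rewrite br00. Qed.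

Lemma h_br_brr p q r f g h : Zc p f -> Zc q g -> Zc r h ->
  Zc (p + q + r).-2 (br p (q + r).-1 f (br q r g h)) /\
  h_br (dinj (cl p f)) (h_br (dinj (cl q g)) (dinj (cl r h))) =
  dinj (cl (p + q + r).-2 (br p (q + r).-1 f (br q r g h))).
Proof.
move=> Zf Zg Zh; have Zgh := Zc_br' Zg Zh; rewrite !h_br_cl' //.
apply: dinj_cl_shift; first exact: Zc_br'.
case: (posnP (q + r)) => [qr|qr]; [right|left; lia].
by rewrite (br_eq0 g h qr) br0r //; apply: ZcC.
Qed.

Lemma h_br_brl p q r f g h : Zc p f -> Zc q g -> Zc r h ->
  Zc (p + q + r).-2 (br (p + q).-1 r (br p q f g) h) /\
  h_br (h_br (dinj (cl p f)) (dinj (cl q g))) (dinj (cl r h)) =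
  dinj (cl (p + q + r).-2 (br (p + q).-1 r (br p q f g) h)).
Proof.
move=> Zf Zg Zh; have Zgh := Zc_br' Zf Zg; rewrite !h_br_cl' //.
apply: dinj_cl_shift; first exact: Zc_br'.
case: (posnP (p + q)) => [pq|pq]; [right|left; lia].
by rewrite (br_eq0 f g pq) br0l //; apply: ZcC.
Qed.

Lemma h_jacobi p q r (x : V p) (y : V q) (z : V r) :
  h_br (dinj x) (h_br (dinj y) (dinj z)) =
  h_br (h_br (dinj x) (dinj y)) (dinj z) +
  (-1) ^+ (p.+1 * q.+1) *: h_br (dinj y) (h_br (dinj x) (dinj z)).
Proof.
elim/h_ind: x => f Zf; elim/h_ind: y => g Zg; elim/h_ind: z => h Zh.
have [Z1 ->] := h_br_brr Zf Zg Zh; have [Z2 ->] := h_br_brl Zf Zg Zh.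
have := h_br_brr Zg Zf Zh; rewrite (addnC q p) => -[Z3 ->].
rewrite dinjZ dinjD -clZ // -clD //; last exact: ZcZ.
by rewrite br_jacobi //; apply: ZcC.
Qed.

Lemma h_leibniz p q r (c : V p) (a : V q) (b : V r) :
  h_br (dinj c) (h_cup (dinj a) (dinj b)) =
  h_cup (h_br (dinj c) (dinj a)) (dinj b) +
  (-1) ^+ (p.+1 * q) *: h_cup (dinj a) (h_br (dinj c) (dinj b)).
Proof.
elim/h_ind: c => h Zh; elim/h_ind: a => f Zf; elim/h_ind: b => g Zg.
have Zfg := Zc_ocup Zf Zg; have Zhf := Zc_br' Zh Zf; have Zhg := Zc_br' Zh Zg.
have [[Ch dh] [[Cf df] [Cg dg]]] := (Zh, (Zf, Zg)).
rewrite !(h_cup_cl, h_br_cl') //.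
set n := (p + q + r).-1.
have [|Z1 ->] := @dinj_cl_shift _ n _ (Zc_br' Zh Zfg); first by left; rewrite /n addnA.
have [|Z2 ->] := @dinj_cl_shift _ n _ (Zc_ocup Zhf Zg).
  case: (posnP (p + q)) => [pq|pq]; [right|by left; rewrite /n; lia].
  by rewrite (br_eq0 h f pq) /ocup (o0r _ (o_dom_mu O)) // (o0l 1).
have [|Z3 ->] := @dinj_cl_shift _ n _ (Zc_ocup Zf Zhg).
  case: (posnP (p + r)) => [pr|pr]; [right|by left; rewrite /n; lia].
  by rewrite (br_eq0 h g pr) /ocup (o0r _ (mu0_dom Cf)).
rewrite dinjZ dinjD -clZ // -clD //; last exact: ZcZ.
congr (dinj _); apply/(h_eq H Z1); first by apply: ZcD; last exact: ZcZ.
rewrite (br_cup Cf Cg df dg Ch dh) -/(signk k (p.+1 * q)) addrC addKr; apply: BdZ.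
(* With fewer than two slots the brace is 0; otherwise its arity [(p + q + r).-2] is exactly one
   below [n]. *)
case: (ltnP p 2) => [p1|p1].
  rewrite psum_small // del_br br0r; [exact: Bd0|exact: o_dom_mu].
by apply: Bd_del; [rewrite /n; lia|apply: (psum_dom Cf Cg Ch); lia].
Qed.

Definition h_gerstenhaber : gerstenhaber V := Gerstenhaber
  h_cup_linl h_cup_linr h_cup_deg h_cupA h_cup1l h_cup1r h_cupC
  h_br_linl h_br_linr h_br_deg h_br00 h_brC h_jacobi h_leibniz.
End Induced.
End Homology.

Section CochainCohomology.
Variables (k : comNzRingType) (A U : algType k) (B : left_bialgebroid A U).
Variables (N : lmodType U) (Y : yd_algebra B N) (bc : braided_commutative Y).
Local Notation M := (resk N).
Local Notation T := (seq U -> resk N).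
Local Notation O := (cochain_operad bc).
Local Notation HUN := (HUN B N).
Implicit Types (us : seq U) (F G : T).

Lemma trunc0 p : trunc (0 : precochain B N p) = 0.
Proof. by apply/funext => us; rewrite /trunc; case: ifP. Qed.

Lemma Zc_trunc p (f : precochain B N p) : is_cocycle f -> Zc O p (trunc f).
Proof.
move=> [fc f0]; have tc := trunc_coch fc; split=> //.
apply: (coch_ext (del_dom (O := O) tc) (coch0 B N _)) => us us_p.
by rewrite -cobd_del // f0.
Qed.

Lemma is_cocycle_of_seq p F : Zc O p F -> is_cocycle (@of_seq _ _ _ B N p F).
Proof.
move=> [Fc F0]; have [Fm _] := Fc; have fc := cochain_of_seq Fm; split=> // us us_p.
by rewrite (cobd_del bc) // trunc_of_seq // F0.
Qed.

Lemma of_seq_trunc p (f : precochain B N p) : cochain f -> of_seq (trunc f) = f.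
Proof.
move=> fc; have tc := trunc_coch fc; have [tm _] := tc.
by apply: trunc_inj (cochain_of_seq tm) fc _; rewrite trunc_of_seq.
Qed.

Lemma is_coboundary_Bd p (f : precochain B N p) : cochain f ->
  is_coboundary f <-> Bd O p (trunc f).
Proof.
case: p f => [|p] f fc /=.
  split=> [->|f0]; first exact: trunc0.
  by apply: trunc_inj fc (cochain0 _ _ _) _; rewrite trunc0.
split=> [[_ [g [gc fg]]]|[G Gc fG]].
  exists (trunc g); first exact: trunc_coch.
  apply: (coch_ext (trunc_coch fc) (del_dom (O := O) (trunc_coch gc))) => us us_p.
  by rewrite trunc_ev // fg // (cobd_del bc).
have [Gm _] := Gc; split=> //; exists (of_seq G); split; first exact: cochain_of_seq.
move=> us us_p; rewrite (cobd_del bc) //; last exact: cochain_of_seq.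
by rewrite trunc_of_seq // -fG trunc_ev.
Qed.

(** Functions that do not give a cocycle get the default class 0, since [homology] asks for a total
    map. *)
Definition HUN_cl p F : HUN p :=
  if pselect (is_cocycle (@of_seq _ _ _ B N p F)) is left hF then HUN_class hF else 0.

Lemma HUN_clE p F (hF : is_cocycle (@of_seq _ _ _ B N p F)) : HUN_cl p F = HUN_class hF.
Proof.
rewrite /HUN_cl; case: pselect => [hF'|//].
exact: sq_class_eq.
Qed.

Lemma HUN_class_trunc p (f : precochain B N p) (hf : is_cocycle f) :
  HUN_class hf = HUN_cl p (trunc f).
Proof.
rewrite (HUN_clE (is_cocycle_of_seq (Zc_trunc hf))); apply: sq_class_eq.
by rewrite of_seq_trunc //; case: hf.
Qed.

Lemma HUN_rep_Z p (v : HUN p) : Zc O p (trunc (sq_rep v : precochain B N p)).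
Proof. exact/Zc_trunc/(sq_repZ v). Qed.

Lemma HUN_rep_K p (v : HUN p) : HUN_cl p (trunc (sq_rep v : precochain B N p)) = v.
Proof. by rewrite -(HUN_class_trunc (sq_repZ v)) [LHS]sq_repK. Qed.

Lemma of_seq_lin p c F G : coch B p F -> coch B p G ->
  @of_seq _ _ _ B N p (c *: F + G) = c *: of_seq F + of_seq G.
Proof.
move=> Fc Gc; have Hc := coch_lin c Fc Gc.
have [[Fm _] [[Gm _] [Hm _]]] := (Fc, (Gc, Hc)).
apply: trunc_inj; first exact: cochain_of_seq.
  by apply: cochain_lin; apply: cochain_of_seq.
by rewrite trunc_lin !trunc_of_seq.
Qed.

Lemma HUN_cl_lin p c F G : Zc O p F -> Zc O p G ->
  HUN_cl p (c *: F + G) = c *: HUN_cl p F + HUN_cl p G.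
Proof.
move=> ZF ZG; have ZH := Zc_lin c ZF ZG.
rewrite (HUN_clE (is_cocycle_of_seq ZF)) (HUN_clE (is_cocycle_of_seq ZG)).
rewrite (HUN_clE (is_cocycle_of_seq ZH)).
rewrite -[RHS]/(sq_add (sq_scale c _) _) [sq_scale c _]sq_scaleE sq_addE; apply: sq_class_eq.
by apply: of_seq_lin; [case: ZF|case: ZG].
Qed.

Lemma HUN_cl_eq p F G : Zc O p F -> Zc O p G ->
  HUN_cl p F = HUN_cl p G <-> Bd O p (F - G).
Proof.
move=> ZF ZG; have [[Fc _] [Gc _]] := (ZF, ZG).
rewrite (HUN_clE (is_cocycle_of_seq ZF)) (HUN_clE (is_cocycle_of_seq ZG)).
apply: (iff_trans (@sq_classP k (precochain B N p) (cocycles B N p) (coboundaries B N p) _ _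
  (is_cocycle_of_seq ZF) (is_cocycle_of_seq ZG))).
have E : of_seq F - of_seq G = (-1) *: of_seq G + of_seq F :> precochain B N p.
  by rewrite scaleN1r addrC.
rewrite E; apply: (iff_trans (is_coboundary_Bd _)).
  by apply: cochain_lin; apply: cochain_of_seq; [case: Gc|case: Fc].
by rewrite trunc_lin !trunc_of_seq // scaleN1r addrC.
Qed.

Definition HUN_homology : homology O HUN :=
  Homology HUN_rep_Z HUN_rep_K HUN_cl_lin HUN_cl_eq.

Definition unit_seq : T := fun us => if us is [::] then (ydone Y : M) else 0.

Lemma coch_unit : coch B 0 unit_seq.
Proof. by split; [split|case]. Qed.

Lemma Zc_unit : Zc O 0 unit_seq.
Proof.
split; first exact: coch_unit.
apply: (coch_ext (del_dom (O := O) coch_unit) (coch0 B N _)) => -[|u [|]] //= _.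
have [um _] := coch_unit; have uc := @cochain_of_seq _ _ _ B N 0 unit_seq um.
have E := cobd_del bc uc (erefl : size [:: u] = 1%N).
rewrite trunc_of_seq ?coch_unit // in E.
  rewrite -E /= !ev_of_seq //.
  by rewrite /unit_seq yd_act1r subrr.
exact: coch_unit.
Qed.

Lemma ocup_unitl q F : coch B q F -> ocup O 0 q unit_seq F = F.
Proof.
move=> Fc; have [[um _] [Fm _]] := (coch_unit, Fc).
apply: (coch_ext (cup_dom (O := O) coch_unit Fc) Fc) => us us_q.
rewrite /ocup !oE -[us in LHS]cat0s -[us in LHS]cats0 part_cat //.
rewrite (ins_cup um Fm) //; first by rewrite /rcup ssum_nil /= ydm1l act1.
by move=> [|] // v _; rewrite -[[::] ++ _]/([::] ++ [::] ++ [:: v]) part_cat.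
Qed.

Lemma ocup_unitr p F : coch B p F -> ocup O p 0 F unit_seq = F.
Proof.
move=> Fc; have [[um _] [Fm _]] := (coch_unit, Fc).
have FE := cup_dom (O := O) Fc coch_unit; rewrite addn0 in FE.
apply: (coch_ext FE Fc) => us us_p.
rewrite /ocup !oE -[us in LHS]cats0 -[us ++ [::] in LHS]cats0 -catA part_cat //.
rewrite (ins_cup Fm um) //; first exact: (@rcup1r _ _ _ _ _ Y p).
by move=> a v a_p; rewrite -[a ++ _]cat0s part_cat.
Qed.

Definition HUN_gerstenhaber : gerstenhaber HUN :=
  h_gerstenhaber HUN_homology Zc_unit ocup_unitl ocup_unitr.

Lemma HUN_induced_by_cup : induced_by_cup Y HUN_gerstenhaber.
Proof.
move=> p q f g hf hg; have [Zf Zg] := (Zc_trunc hf, Zc_trunc hg).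
have Zfg := Zc_ocup Zf Zg.
exists (of_seq (ocup O p q (trunc f) (trunc g))), (is_cocycle_of_seq Zfg); split.
  move=> us us_pq; have [[fgm _] _] := Zfg; rewrite ev_of_seq //.
  by rewrite (cup_trunc bc) //; [case: hf|case: hg].
rewrite !HUN_class_trunc (trunc_of_seq (ZcC Zfg)).
exact: (h_cup_cl HUN_homology).
Qed.

Lemma HUN_induced_by_bracket : induced_by_bracket Y HUN_gerstenhaber.
Proof.
move=> p q r f g hf hg e; have [Zf Zg] := (Zc_trunc hf, Zc_trunc hg).
have Zfg : Zc O r (obr O p q (trunc f) (trunc g)) by apply: (Zc_br Zf Zg); rewrite addn1.
exists (of_seq (obr O p q (trunc f) (trunc g))), (is_cocycle_of_seq Zfg); split.
  move=> us us_r; have [[fgm _] _] := Zfg; rewrite ev_of_seq //.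
  by rewrite (bracket_trunc bc _ _ (esym e)) //; [case: hf|case: hg].
rewrite !HUN_class_trunc (trunc_of_seq (ZcC Zfg)).
exact: (h_br_cl HUN_homology).
Qed.
End CochainCohomology.

(** * The bar resolution *)

Definition mklin (R : pzRingType) (M N : lmodType R) (f : M -> N) (fl : linear f) :
  {linear M -> N} := HB.pack f (GRing.isLinear.Build R M N *:%R f fl).

Lemma mod_linZ (R : pzRingType) (M N : lmodType R) (f : M -> N) : linear f ->
  forall a x, f (a *: x) = a *: f x.
Proof. by move=> fl a x; apply: (linearZZ (mklin fl)). Qed.

Lemma mod_linB (R : pzRingType) (M N : lmodType R) (f : M -> N) : linear f ->
  {morph f : x y / x - y}.
Proof. by move=> fl x y; apply: (linearB (mklin fl)). Qed.

Lemma lin_subf (k : comNzRingType) (V W : lmodType k) (f g : V -> W) :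
  linear f -> linear g -> linear (fun x => f x - g x).
Proof. by move=> fl gl c x y; rewrite fl gl scalerBr opprD addrACA. Qed.

Section BarDifferential.
Variables (k : comNzRingType) (A U : algType k) (B : left_bialgebroid A U).
Local Notation t := (tgt B).
Local Notation mbal := (mbal B).
Implicit Types (V W : lmodType k) (u v : U) (us l r : seq U).

Lemma mbal_cons V n (F : seq U -> V) :
  (forall u, mbal n (fun us => F (u :: us))) ->
  (forall us, size us = n -> linear (fun u => F (u :: us))) ->
  (forall u a v us, (size us).+1 = n -> F (u * t a :: v :: us) = F (u :: t a * v :: us)) ->
  mbal n.+1 F.
Proof.
move=> F1 F2 F3; split=> [[|x l] r [e]|[|x l] u a v r [e]].
- exact: F2.
- by case: (F1 x) => F4 _; apply: F4.
- exact: F3.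
- by case: (F1 x) => _ F4; apply: F4.
Qed.

Lemma mbal_behead V n (F : seq U -> V) u : mbal n.+1 F -> mbal n (fun us => F (u :: us)).
Proof.
by move=> [F1 F2]; split=> [l r e|l x a v r e];
  [apply: (F1 (u :: l)) => /=|apply: (F2 (u :: l)) => /=]; rewrite addSn e.
Qed.

Lemma mbal_lmul V n (F : seq U -> V) u : mbal n.+1 F ->
  mbal n.+1 (fun us => F (u * head 0 us :: behead us)).
Proof.
move=> Fb; have [F1 F2] := Fb; apply: mbal_cons => [x|us e|x a v us e] /=.
- exact: mbal_behead.
- by apply: (lin_comp (F1 [::] us _)); [rewrite /= e|lin].
- by rewrite mulrA (F2 [::]) //= e.
Qed.

Lemma mbal_sub V n (F G : seq U -> V) : mbal n F -> mbal n G -> mbal n (fun us => F us - G us).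
Proof.
move=> [F1 F2] [G1 G2]; split=> [l r e c x y|l u a v r e]; last by rewrite F2 ?G2.
by rewrite F1 // G1 // scalerBr opprD addrACA.
Qed.

(* The differential of the bar resolution evaluated at u ⊗ us, the values of
   F standing for those of the tensors; it alternates the products of
   neighbours and ends with u t(eps v) instead of u ⊗ v. *)
Fixpoint bdl V (F : seq U -> V) u us : V :=
  if us is v :: us' then
    F (u * v :: us') -
    (if us' is [::] then F [:: u * t (eps B v)] else bdl (fun ws => F (u :: ws)) v us')
  else 0.

Lemma eq_bdl V (F G : seq U -> V) u us :
  (forall ws, size ws = size us -> F ws = G ws) -> bdl F u us = bdl G u us.
Proof.
elim: us u F G => //= v us IHus u F G FG; rewrite FG //.
case: us IHus FG => [|w us] IHus FG; first by rewrite FG.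
by congr (_ - _); apply: IHus => ws e; apply: FG; rewrite /= e.
Qed.

Lemma bdl_mul V (F : seq U -> V) x u us :
  bdl F (x * u) us = bdl (fun ws => F (x * head 0 ws :: behead ws)) u us.
Proof. by case: us => //= v us; rewrite !mulrA; case: us => //= w us; rewrite mulrA. Qed.

Lemma lin_bdl V W (h : V -> W) (F : seq U -> V) u us :
  linear h -> h (bdl F u us) = bdl (fun ws => h (F ws)) u us.
Proof.
move=> hl; have hB x y : h (x - y) = h x - h y.
  by rewrite addrC -scaleN1r hl scaleN1r addrC.
elim: us u F => [|v us IHus] u F /=; first exact: lin0.
by case: us IHus => [|w us] IHus; rewrite hB // IHus.
Qed.

Lemma bdl_family V W (F : V -> seq U -> W) u us :
  (forall ws, size ws = size us -> linear (F^~ ws)) -> linear (fun x => bdl (F x) u us).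
Proof.
elim: us u F => [|v us IHus] u F Fl c x y /=; first by rewrite scaler0 addr0.
rewrite (Fl (_ :: _)) //; case: us IHus Fl => [|w us] IHus Fl.
  by rewrite Fl // scalerBr opprD addrACA.
have Fl' ws : size ws = size (w :: us) -> linear (fun x => F x (u :: ws)).
  by move=> e; apply: Fl; rewrite /= e.
have -> := IHus v (fun x ws => F x (u :: ws)) Fl' c x y.
by rewrite scalerBr opprD addrACA.
Qed.

(** In the induction the first product is handled by [mbal_lmul], while the rest keeps [u] as a
    parameter. Balancing between [u] and [v] is associativity, except in lowest degree, where it
    also needs [t (eps (t(a) v)) = t(a) t (eps v)]. *)
Lemma bdl_mbal V n (F : seq U -> V) : mbal n.+1 F ->
  mbal n.+2 (fun us => bdl F (head 0 us) (behead us)).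
Proof.
elim: n F => [|n IHn] F Fb; have [F1 F2] := Fb.
  have F3 (W : lmodType k) (G : W -> U) : linear G -> linear (fun x => F [:: G x]).
    by move=> Gl; apply: (lin_comp (F1 [::] [::] _) Gl).
  apply: mbal_cons => [u|[|v []] // _ c x y|u a v [] //= _] /=.
  - split=> [[|? ?] // [|? ?] // _ c x y|[] //] /=.
    rewrite (F3 _ (fun x => u * x)) ?(F3 _ (fun x => u * t (eps B x))); [|by lin|by lin].
    by rewrite scalerBr opprD addrACA.
  - rewrite (F3 _ (fun x => x * v)) ?(F3 _ (fun x => x * t (eps B v))); [|by lin|by lin].
    by rewrite scalerBr opprD addrACA.
  - by rewrite eps_t tgtM !mulrA.
apply: mbal_cons => [u|[|v [|w us]] // e|u a v [|w us] //= [e]] /=.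
- apply: (@mbal_ext _ _ _ _ _ _ (fun us => F (u * head 0 us :: behead us) -
    bdl (fun ws => F (u :: ws)) (head 0 us) (behead us))); first by case=> [|v [|w us]].
  by apply: mbal_sub; [apply: mbal_lmul|apply: IHn; apply: mbal_behead].
- case: e => e.
  have Fl ws : size ws = size (w :: us) -> linear (fun x => F (x :: ws)).
    by move=> e'; apply: (F1 [::]); rewrite add0n e' /= e.
  have Gl : linear (fun x => F (x * v :: w :: us)).
    by apply: (lin_comp (Fl (w :: us) erefl)); lin.
  exact: (lin_subf Gl (bdl_family v Fl)).
- rewrite mulrA; congr (_ - _).
  apply: esym; apply: etrans (bdl_mul (fun ws => F (u :: ws)) (t a) v (w :: us)) _.
  by apply: (@eq_bdl _ _ (fun ws => F (u * t a :: ws)) v (w :: us)) => -[|x ws] //= [e']; rewrite (F2 [::]) //= e' e.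
Qed.
End BarDifferential.

Section TensorPowerMaps.
Variables (k : comNzRingType) (A U : algType k) (B : left_bialgebroid A U).
Local Notation mbal := (mbal B).
Implicit Types (V W : lmodType k) (u v : U) (us : seq U).

Definition tgen p us : tpow B p := pm_gen (@tpow_rel _ _ _ B p) (tup p us).

Lemma mbal_tgen p : mbal p (@tgen p).
Proof. by split=> [l r|l u a v r] e; [apply: tpow_gen_lin|apply: tpow_gen_bal]. Qed.

Definition tlift p V (F : seq U -> V) (x : tpow B p) : V :=
  pm_sum (fun v : p.-tuple U => F v) x.

Lemma tlift_lin p V (F : seq U -> V) : mbal p F -> linear (tlift F : tpow B p -> V).
Proof. by move=> Fb; apply: pm_sum_linear; apply: tpow_respect. Qed.

Lemma tlift_gen p V (F : seq U -> V) us : mbal p F -> size us = p ->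
  tlift F (tgen p us) = F us.
Proof. by move=> Fb e; rewrite /tlift /tgen pm_sum_gen ?tupE //; apply: tpow_respect. Qed.

Lemma tpow_ext p V (F G : tpow B p -> V) : linear F -> linear G ->
  (forall us, size us = p -> F (tgen p us) = G (tgen p us)) -> F =1 G.
Proof.
move=> Fl Gl FG; apply: presmod_lin_ext => // v.
by have := FG v (size_tuple v); rewrite /tgen tup_tuple.
Qed.
End TensorPowerMaps.

Section BarModule.
Variables (k : comNzRingType) (A U : algType k) (B : left_bialgebroid A U) (p : nat).
Local Notation mbal := (mbal B).
Local Notation P := (tpow B p.+1).
Implicit Types (u v : U) (us : seq U).

(* U ⊗ U^{⊗ p} (tensor products over A^op), with U acting on the first factor *)
Definition barmod : Type := tpow B p.+1.
HB.instance Definition _ := GRing.Zmodule.copy barmod (tpow B p.+1).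

Definition bar_scale u : barmod -> barmod :=
  tlift (fun us => tgen B p.+1 (u * head 0 us :: behead us)).

Let bar_mbal u : mbal p.+1 (fun us => tgen B p.+1 (u * head 0 us :: behead us)).
Proof. exact/mbal_lmul/mbal_tgen. Qed.

Lemma bar_scale_lin u : linear (bar_scale u : P -> P).
Proof. exact: tlift_lin. Qed.

Lemma bar_scale_gen u v us : size us = p ->
  bar_scale u (tgen B p.+1 (v :: us)) = tgen B p.+1 (u * v :: us).
Proof. by move=> e; rewrite /bar_scale tlift_gen //= e. Qed.

Lemma bar_ext (V : lmodType k) (F G : P -> V) : linear F -> linear G ->
  (forall u us, size us = p -> F (tgen B p.+1 (u :: us)) = G (tgen B p.+1 (u :: us))) -> F =1 G.
Proof. by move=> Fl Gl FG; apply: tpow_ext => // -[|u us] // [e]; apply: FG. Qed.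

Lemma bar_scaleA u v (x : barmod) : bar_scale u (bar_scale v x) = bar_scale (u * v) x.
Proof.
apply: (bar_ext (lin_comp (bar_scale_lin u) (bar_scale_lin v)) (bar_scale_lin _)) => w us e.
by rewrite !bar_scale_gen // mulrA.
Qed.

Lemma bar_scale1 : left_id 1 bar_scale.
Proof.
apply: (bar_ext (bar_scale_lin 1) (@lin_id _ _)) => w us e.
by rewrite bar_scale_gen // mul1r.
Qed.

Lemma bar_scaleDr : right_distributive bar_scale +%R.
Proof. by move=> u; apply: (linD (bar_scale_lin u)). Qed.

Lemma bar_scale_linl (x : P) : linear (bar_scale^~ x : U -> P).
Proof.
apply: (@fsum_family k) => us.
have [F1 _] := mbal_tgen B p.+1; case: us => -[//|w us] /=; rewrite eqSS => /eqP e.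
by apply: (lin_comp (F1 [::] us _)); [rewrite /= e|lin].
Qed.

Lemma bar_scaleDl x : {morph bar_scale^~ x : u v / u + v}.
Proof. exact: (linD (bar_scale_linl x)). Qed.

HB.instance Definition _ := GRing.Zmodule_isLmodule.Build U barmod
  bar_scaleA bar_scale1 bar_scaleDr bar_scaleDl.

Lemma bar_scale_k (c : k) (x : P) : bar_scale c%:A x = c *: x.
Proof. by rewrite (linZ (bar_scale_linl x)) bar_scale1. Qed.

Variable N : lmodType U.

Lemma bar_klin (f : barmod -> N) : linear f -> linear (f : P -> resk N).
Proof. by move=> fl c x y; rewrite -bar_scale_k; apply: fl. Qed.

Lemma bar_lin (f : barmod -> N) : linear (f : P -> resk N) ->
  (forall u v us, size us = p ->
     f (tgen B p.+1 (u * v :: us)) = u *: f (tgen B p.+1 (v :: us))) ->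
  linear f.
Proof.
move=> fl fu; have E u (x : P) : f (bar_scale u x) = @act k U N u (f x).
  apply: (bar_ext (lin_comp fl (bar_scale_lin u)) (lin_actr u fl)) => v us e.
  by rewrite bar_scale_gen // fu.
by move=> u x y; rewrite [LHS](linD fl) -[X in f X + _]/(bar_scale u x) E.
Qed.

Lemma bar_genE u us : size us = p ->
  tgen B p.+1 (u :: us) = u *: (tgen B p.+1 (1 :: us) : barmod).
Proof. by move=> e; rewrite -[RHS]/(bar_scale _ _) bar_scale_gen // mulr1. Qed.

Lemma bar_Uext (f g : barmod -> N) : linear f -> linear g ->
  (forall us, size us = p -> f (tgen B p.+1 (1 :: us)) = g (tgen B p.+1 (1 :: us))) -> f =1 g.
Proof.
move=> fl gl fg; apply: (bar_ext (bar_klin fl) (bar_klin gl)) => u us e.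
by rewrite bar_genE // !mod_linZ // fg.
Qed.

(** [bar_res] and [bar_ind] are the two directions of the adjunction between [U]-linear maps on
    [U ⊗ U^{⊗ p}] and cochains; the [A^op]-linearity of cochains reflects
    [1 ⊗ t(a) u = t(a) ⊗ u]. *)
Definition bar_res (f : barmod -> N) : seq U -> resk N := fun us => f (tgen B p.+1 (1 :: us)).
Definition bar_ind (F : seq U -> resk N) : barmod -> N :=
  tlift (fun us => @act k U N (head 0 us) (F (behead us))).

Lemma multi_bar_res f : linear f -> multi B p (bar_res f).
Proof.
move=> fl; have Gb : mbal p (tgen B p.+1 \o cons 1) by apply: mbal_behead (mbal_tgen _ _).
split=> [|a u us e]; first exact: (mbal_lin (bar_klin fl) Gb).
have [_ G2] := mbal_tgen B p.+1.
rewrite /act /bar_res -(mod_linZ fl) -[X in f X = _]/(tgen B p.+1 ([::] ++ 1 :: tgt B a * u :: us)).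
rewrite -G2 ?e //= mul1r; congr f.
by rewrite -[RHS]/(bar_scale _ _) bar_scale_gen //= ?mulr1.
Qed.

Lemma bar_ind_mbal F : multi B p F -> mbal p.+1 (fun us => @act k U N (head 0 us) (F (behead us))).
Proof.
move=> [Fb Fh]; apply: mbal_cons => [u|us e|u a v us e] /=.
- by apply: mbal_lin Fb; apply: lin_actr; lin.
- by lin.
- by rewrite Fh // actM.
Qed.

Lemma bar_ind_gen F u us : multi B p F -> size us = p ->
  bar_ind F (tgen B p.+1 (u :: us)) = @act k U N u (F us).
Proof. by move=> /bar_ind_mbal Fb e; rewrite /bar_ind tlift_gen //= e. Qed.

Lemma bar_ind_lin F : multi B p F -> linear (bar_ind F).
Proof.
move=> Fm; apply: bar_lin (tlift_lin (bar_ind_mbal Fm)) _ => u v us e.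
by rewrite [LHS](bar_ind_gen _ Fm e) actM; congr act; rewrite [RHS](bar_ind_gen v Fm e).
Qed.

Lemma bar_indK F us : multi B p F -> size us = p -> bar_res (bar_ind F) us = F us.
Proof. by move=> Fm e; rewrite /bar_res bar_ind_gen // act1. Qed.
End BarModule.

Section BarResolution.
Variables (k : comNzRingType) (A U : algType k) (B : left_bialgebroid A U).
Local Notation t := (tgt B).
Local Notation s := (src B).
Local Notation mbal := (mbal B).
Local Notation barmod := (barmod B).
Local Notation tgen := (tgen B).
Implicit Types (u v : U) (us : seq U).

Lemma lin_to_bar (V : lmodType k) p (f : V -> tpow B p.+1) :
  linear f -> linear (f : V -> resk (barmod p)).
Proof. by move=> fl c x y; rewrite fl -bar_scale_k. Qed.

Definition bar_d_fun p : tpow B p.+2 -> tpow B p.+1 :=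
  tlift (fun us => bdl B (tgen p.+1) (head 0 us) (behead us)).

Let d_mbal p : mbal p.+2 (fun us => bdl B (tgen p.+1) (head 0 us) (behead us)).
Proof. exact/bdl_mbal/mbal_tgen. Qed.

Lemma bar_d_klin p : linear (@bar_d_fun p).
Proof. exact/tlift_lin/d_mbal. Qed.

Lemma bar_d_gen p u us : size us = p.+1 ->
  bar_d_fun (tgen p.+2 (u :: us)) = bdl B (tgen p.+1) u us.
Proof. by move=> e; rewrite /bar_d_fun tlift_gen //= e. Qed.

Lemma bar_d_lin p : linear (@bar_d_fun p : barmod p.+1 -> barmod p).
Proof.
apply: bar_lin; first exact/lin_to_bar/bar_d_klin.
move=> u v us e; rewrite !bar_d_gen // bdl_mul.
rewrite -[RHS]/(bar_scale u _) (lin_bdl _ _ _ _ (bar_scale_lin u)).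
apply: eq_bdl => -[|x ws] //=; rewrite e => -[] // ews.
by rewrite bar_scale_gen.
Qed.
Definition bar_d p : {linear barmod p.+1 -> barmod p} := mklin (@bar_d_lin p).

Let eps_mbal : mbal 1 (fun us => eps B (head 0 us)).
Proof. by split=> [[|? []] // [|? ?] // _ c x y|[|? []] //] /=; rewrite linearP. Qed.

Definition bar_aug_fun : tpow B 1 -> A := tlift (fun us => eps B (head 0 us)).

Lemma bar_aug_klin : linear bar_aug_fun.
Proof. exact: tlift_lin. Qed.

Lemma bar_aug_gen u : bar_aug_fun (tgen 1 [:: u]) = eps B u.
Proof. by rewrite /bar_aug_fun tlift_gen. Qed.

Lemma bar_aug_lin : linear (bar_aug_fun : barmod 0 -> base_mod B).
Proof.
apply: bar_lin => [c x y|u v [|//] _]; last by rewrite !bar_aug_gen epsMs.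
rewrite [LHS]bar_aug_klin -[X in _ = X + _]/(eps B (c%:A * s (bar_aug_fun x))).
by rewrite -scalerAl mul1r linearZ /= eps_src.
Qed.
Definition bar_aug : {linear barmod 0 -> base_mod B} := mklin bar_aug_lin.

Let h_mbal p : mbal p.+1 (fun us => tgen p.+2 (1 :: us)).
Proof. exact/mbal_behead/mbal_tgen. Qed.

(* contracting homotopy of the bar resolution over k *)
Definition bar_h p : tpow B p.+1 -> tpow B p.+2 := tlift (fun us => tgen p.+2 (1 :: us)).

Lemma bar_h_lin p : linear (@bar_h p).
Proof. exact/tlift_lin/h_mbal. Qed.

Lemma bar_h_gen p us : size us = p.+1 -> bar_h (tgen p.+1 us) = tgen p.+2 (1 :: us).
Proof. by move=> e; rewrite /bar_h tlift_gen. Qed.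

Lemma tgen1_lin : linear (fun u => tgen 1 [:: u]).
Proof. by case: (mbal_tgen B 1) => F _; apply: (F [::] [::]). Qed.

Lemma bar_dh0 x : bar_d_fun (bar_h x) = x - tgen 1 [:: t (bar_aug_fun x)].
Proof.
have el : linear (fun x => tgen 1 [:: t (bar_aug_fun x)]).
  by apply: (lin_comp tgen1_lin); apply: (lin_linear _ bar_aug_klin).
apply: (bar_ext (lin_comp (@bar_d_klin 0) (@bar_h_lin 0)) (lin_subf (@lin_id _ _) el)).
by move=> u [|//] _; rewrite bar_h_gen // bar_d_gen //= bar_aug_gen !mul1r.
Qed.

Lemma bar_dh p x : bar_d_fun (bar_h x) = x - bar_h (bar_d_fun x) :> tpow B p.+2.
Proof.
have hdl := lin_comp (@bar_h_lin p) (@bar_d_klin p).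
apply: (bar_ext (lin_comp (@bar_d_klin _) (@bar_h_lin _)) (lin_subf (@lin_id _ _) hdl)).
move=> u [|v us] // [e]; rewrite bar_h_gen /= ?e // !bar_d_gen /= ?e //.
rewrite mul1r; congr (_ - _).
rewrite -[in RHS]/(bdl B (tgen p.+1) u (v :: us)) (lin_bdl _ _ _ _ (@bar_h_lin p)).
by apply: (@eq_bdl _ _ _ _ _ (fun ws => tgen p.+2 (1 :: ws)) _ u (v :: us)) => ws ews; rewrite bar_h_gen //= ews /= e.
Qed.

Lemma bar_aug_d x : bar_aug (bar_d 0 x) = 0.
Proof.
have dl : linear (fun x => bar_aug_fun (@bar_d_fun 0 x)) by apply: lin_comp bar_aug_klin (@bar_d_klin 0).
have zl : linear (fun _ : tpow B 2 => 0 : A) by move=> c _ _; rewrite scaler0 addr0.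
have E0 := bar_ext dl zl _ x; apply: E0 => u [|v []] //= _.
have E y z : bar_aug_fun (y - z) = bar_aug_fun y - bar_aug_fun z.
  by rewrite addrC -scaleN1r bar_aug_klin scaleN1r addrC.
by rewrite bar_d_gen //= E !bar_aug_gen -epsMt subrr.
Qed.

(** By [U]-linearity it suffices to treat [1 ⊗ us], the image of [us] under the homotopy [h]. There
    [d d h = d - d h d = h d d], which reduces the claim to the previous degree and finally to
    [bar_aug_d]. *)
Lemma bar_dd p x : bar_d p (bar_d p.+1 x) = 0.
Proof.
have dB q y z : @bar_d_fun q (y - z) = bar_d_fun y - bar_d_fun z.
  by rewrite addrC -scaleN1r bar_d_klin scaleN1r addrC.
have hd0 q : bar_h (0 : tpow B q.+1) = 0 by exact: lin0 (@bar_h_lin q).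
have ddl q : linear (fun x => bar_d q (bar_d q.+1 x)) by move=> u y z; rewrite !linearP.
have zl q : linear (fun _ : barmod q.+2 => 0 : barmod q).
  by move=> u y z; rewrite scaler0 addr0.
elim: p x => [|p IHp] x; apply: (bar_Uext (ddl _) (zl _) _ x) => us e;
  rewrite -bar_h_gen // -[LHS]/(bar_d_fun (bar_d_fun _)) bar_dh dB.
  rewrite bar_dh0 -[bar_aug_fun _]/(bar_aug (bar_d 0 _)) bar_aug_d.
  by rewrite linear0 (lin0 tgen1_lin) subr0 subrr.
by rewrite bar_dh -[X in bar_h X]/(bar_d p (bar_d p.+1 _)) IHp [bar_h 0]hd0 subr0 subrr.
Qed.

Lemma bar_exact p x : bar_d p x = 0 <-> exists y, bar_d p.+1 y = x.
Proof.
split=> [x0|[y <-]]; last exact: bar_dd.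
exists (bar_h x : barmod p.+2); rewrite -[LHS]/(bar_d_fun _) bar_dh.
by rewrite -[bar_d_fun x]/(bar_d p x) x0 [bar_h 0](lin0 (@bar_h_lin p)) subr0.
Qed.

Lemma bar_exact0 x : bar_aug x = 0 <-> exists y, bar_d 0 y = x.
Proof.
split=> [x0|[y <-]]; last exact: bar_aug_d.
exists (bar_h x : barmod 1); rewrite -[LHS]/(bar_d_fun _) bar_dh0.
by rewrite -[bar_aug_fun x]/(bar_aug x) x0 linear0 (lin0 tgen1_lin) subr0.
Qed.

Lemma bar_aug_surj y : exists x, bar_aug x = y.
Proof.
exists (tgen 1 [:: s y] : barmod 0).
by rewrite -[LHS]/(bar_aug_fun _) bar_aug_gen eps_src.
Qed.

Definition bar_resolution (Bproj : forall p, projective (barmod p)) :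
    proj_resolution (base_mod B) :=
  ProjResolution Bproj bar_aug_surj bar_exact0 bar_exact.
End BarResolution.

(** * Lifting multilinear maps along surjections *)

Section HomModule.
Variables (k : comNzRingType) (A U : algType k) (B : left_bialgebroid A U).
Variable Q : lmodType A^c.
Local Notation t := (tgt B).
Implicit Types (a b : A) (u v : U).

(* Hom over A^op from U_◁ to Q, with the A^op-action coming from right
   multiplication by t(a) *)
Definition homU : Type := {h : U_tri B -> Q | linear h}.
HB.instance Definition _ := gen_eqMixin homU.
HB.instance Definition _ := gen_choiceMixin homU.
Implicit Types f g h : homU.

Lemma homUP f g : (forall u, sval f u = sval g u) -> f = g.
Proof.
case: f g => [f hf] [g hg] /= /funext e.
by subst g; rewrite (Prop_irrelevance hf hg).
Qed.

Lemma homU_zero_lin : linear (fun _ : U_tri B => 0 : Q).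
Proof. by move=> a x y; rewrite scaler0 addr0. Qed.
Definition homU_zero : homU := exist _ _ homU_zero_lin.

Lemma homU_add_lin f g : linear (fun u : U_tri B => sval f u + sval g u : Q).
Proof. by move=> a x y; rewrite (svalP f) (svalP g) scalerDr addrACA. Qed.
Definition homU_add f g : homU := exist _ _ (homU_add_lin f g).

Lemma homU_opp_lin f : linear (fun u : U_tri B => - sval f u : Q).
Proof. by move=> a x y; rewrite (svalP f) opprD scalerN. Qed.
Definition homU_opp f : homU := exist _ _ (homU_opp_lin f).

Lemma homU_scale_lin (a : A^c) f : linear (fun u : U_tri B => sval f ((u : U) * t (a : A)) : Q).
Proof.
move=> b x y; rewrite -(svalP f); congr (sval f _).
by rewrite [LHS]mulrDl -[X in X + _]mulrA.
Qed.
Definition homU_scale (a : A^c) f : homU := exist _ _ (homU_scale_lin a f).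

Lemma homU_addA : associative homU_add.
Proof. by move=> f g h; apply: homUP => u /=; rewrite addrA. Qed.
Lemma homU_addC : commutative homU_add.
Proof. by move=> f g; apply: homUP => u /=; rewrite addrC. Qed.
Lemma homU_add0 : left_id homU_zero homU_add.
Proof. by move=> f; apply: homUP => u /=; rewrite add0r. Qed.
Lemma homU_addN : left_inverse homU_zero homU_opp homU_add.
Proof. by move=> f; apply: homUP => u /=; rewrite addNr. Qed.
HB.instance Definition _ :=
  GRing.isZmodule.Build homU homU_addA homU_addC homU_add0 homU_addN.

Lemma homU_scaleA a b f : homU_scale a (homU_scale b f) = homU_scale ((a : A^c) * b) f.
Proof. by apply: homUP => u /=; rewrite -mulrA -tgtM. Qed.
Lemma homU_scale1 : left_id 1 homU_scale.
Proof. by move=> f; apply: homUP => u /=; rewrite [t _]tgt1 mulr1. Qed.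
Lemma homU_scaleDr : right_distributive homU_scale +%R.
Proof. by move=> a f g; apply: homUP. Qed.
Lemma homU_scaleDl f : {morph homU_scale^~ f : a b / a + b}.
Proof.
move=> a b; apply: homUP => u /=.
rewrite [t _]linearD mulrDr; have := svalP f 1 ((u : U) * t a) ((u : U) * t b).
by rewrite !scale1r.
Qed.
HB.instance Definition _ := GRing.Zmodule_isLmodule.Build A^c homU
  homU_scaleA homU_scale1 homU_scaleDr homU_scaleDl.
End HomModule.

Section HomFunctor.
Variables (k : comNzRingType) (A U : algType k) (B : left_bialgebroid A U).
Variables (Q Q' : lmodType A^c) (g : {linear Q -> Q'}).

Lemma homU_comp_lin (h : homU B Q) : linear (fun u : U_tri B => g (sval h u)).
Proof. by move=> a x y; rewrite (svalP h) linearP. Qed.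
Definition homU_map (h : homU B Q) : homU B Q' := exist _ _ (homU_comp_lin h).

Lemma homU_map_lin : linear homU_map.
Proof. by move=> a x y; apply: homUP => u /=; rewrite linearD. Qed.

Lemma homU_map_surj : projective (U_tri B) -> (forall y, exists x, g x = y) ->
  forall h', exists h, homU_map h = h'.
Proof.
move=> Up gs h'; have [h hE] := Up _ _ g (mklin (svalP h')) gs.
have hl : linear h by exact: linearP.
by exists (exist _ (h : _ -> _) hl); apply: homUP => u /=; rewrite hE.
Qed.
End HomFunctor.

Section Lifting.
Variables (k : comNzRingType) (A U : algType k) (B : left_bialgebroid A U).
Local Notation t := (tgt B).
Implicit Types (Q : lmodType A^c) (a b : A) (u v : U) (us l r : seq U).

Definition amulti Q p (F : seq U -> Q) :=
  [/\ forall l u v r, (size l + size r).+1 = p ->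
        F (l ++ u + v :: r) = F (l ++ u :: r) + F (l ++ v :: r),
      forall l u a v r, (size l + size r).+2 = p ->
        F (l ++ u * t a :: v :: r) = F (l ++ u :: t a * v :: r) &
      forall a u us, (size us).+1 = p -> F (t a * u :: us) = (a : A^c) *: F (u :: us)].

(** Tensor-hom adjunction: linearity in the first argument puts the values in [homU], and balancing
    between the first two arguments becomes linearity for [homU_scale]. Sending other lengths to 0
    keeps [G us] linear for every [us]. *)
Lemma amulti_curry Q p (F : seq U -> Q) : amulti p.+1 F ->
  exists2 G : seq U -> homU B Q, amulti p G &
    forall u us, size us = p -> sval (G us) u = F (u :: us).
Proof.
move=> [F1 F2 F3].
pose G us (u : U_tri B) : Q := if size us == p then F ((u : U) :: us) else 0.
have Gl us : linear (G us).
  move=> a x y; rewrite /G; case: eqP => [e|_]; last by rewrite scaler0 addr0.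
  have /= -> := F1 [::] (t a * (x : U)) y us; last by rewrite /= e.
  by rewrite F3 ?e.
have GE u us : size us = p -> G us u = F (u :: us) by rewrite /G => ->; rewrite eqxx.
exists (fun us => exist _ (G us) (Gl us)) => [|u us e]; last exact: GE.
split=> [l u v r e|l u a v r e|a u us e]; apply: homUP => w /=;
  rewrite !GE /= ?size_cat /= ?addnS //.
- by rewrite (F1 (w :: l)) //= addSn e.
- by rewrite (F2 (w :: l)) //= addSn e.
- by rewrite (F2 [::]) //= e.
Qed.

Lemma amulti_uncurry Q p (G : seq U -> homU B Q) : amulti p G ->
  amulti p.+1 (fun us => sval (G (behead us)) (head 0 us)).
Proof.
move=> [G1 G2 G3]; split=> [[|w l] u v r [e]|[|w l] u a v r [e]|a u us [e]] /=.
- by have := svalP (G r) 1 u v; rewrite !scale1r.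
- by rewrite G1.
- by rewrite G3.
- by rewrite G2.
- by have := svalP (G us) (a : A^c) u 0; rewrite !addr0 => ->;
    have := svalP (G us) (-1) 0 0; rewrite scaler0 addr0 scaleN1r addNr => ->; rewrite addr0.
Qed.

Lemma amulti_lift Q Q' (g : {linear Q -> Q'}) p (F' : seq U -> Q') :
  projective (U_tri B) -> (forall y, exists x, g x = y) -> amulti p F' ->
  exists2 F, amulti p F & forall us, size us = p -> g (F us) = F' us.
Proof.
move=> Up; elim: p Q Q' g F' => [|p IHp] Q Q' g F' gs F'm.
  have [x xE] := gs (F' [::]).
  by exists (fun _ => x) => [|[]]; first by split.
have [G' G'm G'E] := amulti_curry F'm.
have gs' := homU_map_surj Up gs.
have [G Gm GE] := IHp _ _ (mklin (homU_map_lin (B := B) g)) _ gs' G'm.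
exists (fun us => sval (G (behead us)) (head 0 us)); first exact: amulti_uncurry.
case=> [//|u us] [e] /=; rewrite -G'E // -GE //.
Qed.
End Lifting.

Section RestrictToA.
Variables (k : comNzRingType) (A U : algType k) (B : left_bialgebroid A U) (M : lmodType U).
Local Notation t := (tgt B).

Definition resA (C : left_bialgebroid A U) : Type := M.
HB.instance Definition _ := GRing.Zmodule.copy (resA B) M.
Definition resA_scale (a : A^c) (m : resA B) : resA B := t (a : A) *: (m : M).
Lemma resA_scaleA a b m : resA_scale a (resA_scale b m) = resA_scale (a * b) m.
Proof. by rewrite /resA_scale scalerA -tgtM. Qed.
Lemma resA_scale1 : left_id 1 resA_scale.
Proof. by move=> m; rewrite /resA_scale [t _]tgt1 scale1r. Qed.
Lemma resA_scaleDr : right_distributive resA_scale +%R.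
Proof. by move=> a m n; rewrite /resA_scale -scalerDr. Qed.
Lemma resA_scaleDl m : {morph resA_scale^~ m : a b / a + b}.
Proof. by move=> a b; rewrite /resA_scale [t _]linearD scalerDl. Qed.
HB.instance Definition _ := GRing.Zmodule_isLmodule.Build A^c (resA B)
  resA_scaleA resA_scale1 resA_scaleDr resA_scaleDl.

(** The [k]-linearity of [multi] is recovered from the [A^op]-structure: [c] in [k] acts on [U] as
    [t (c 1)], and balancing moves it slot by slot to the head, where [A^op]-linearity takes it
    out. *)
Lemma multi_amulti p (F : seq U -> resk M) :
  multi B p F <-> amulti B p (F : seq U -> resA B).
Proof.
split=> [[[F1 F2] F3]|[F1 F2 F3]]; first by split=> // l u v r e; apply: (linD (F1 l r e)).
have tc (c : k) : t (c%:A) = c%:A by rewrite linearZ /= tgt1.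
have F4 n l c u r : size l = n -> (size l + size r).+1 = p ->
    F (l ++ c *: u :: r) = c *: F (l ++ u :: r).
  elim: n l u r => [[]|n IHn l u r] //=.
    move=> u r _ e; have := F3 (c%:A) u r e.
    by rewrite tc -scalerAl mul1r => ->; rewrite -[LHS]/(t _ *: (F (u :: r) : M)) tc.
  elim/last_ind: l => // l v _; rewrite size_rcons => -[ln] e.
  have E (x y : U) : F (rcons l x ++ y :: r) = F (l ++ x :: y :: r) by rewrite cat_rcons.
  rewrite !E -[u in LHS]mul1r scalerAl -[c *: 1]tc -F2; last by rewrite -e addSn.
  rewrite tc -scalerAr mulr1 IHn //.
  by rewrite -e /= addnS addSn.
split; last by move=> a u us e; rewrite F3.
split=> [l r e c x y|//]; by rewrite F1 // (F4 (size l)).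
Qed.
End RestrictToA.

Lemma bar_projective (k : comNzRingType) (A U : algType k) (B : left_bialgebroid A U) p :
  projective (U_tri B) -> projective (barmod B p).
Proof.
move=> Up M M' g f gs.
have gl : linear (g : resA M B -> resA M' B) by move=> a x y; apply: linearP.
have fm : amulti B p (bar_res f : seq U -> resA M' B).
  by apply/multi_amulti; apply: multi_bar_res; apply: linearP.
have [F Fm FE] := amulti_lift (g := mklin gl) Up gs fm.
have {}Fm : multi B p (F : seq U -> resk M) by apply/multi_amulti.
exists (mklin (bar_ind_lin Fm)).
have gFl : linear (fun x : barmod B p => g (bar_ind F x : M)).
  by move=> u x y; rewrite (bar_ind_lin Fm) linearP.
apply: (bar_Uext gFl (linearP f)) => us e.
by rewrite -[RHS]/(bar_res f us) -FE //; congr (g _); apply: bar_indK.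
Qed.

(** * Comparison with Ext *)

Section ImageModule.
Variables (R : pzRingType) (X Y : lmodType R) (d : {linear X -> Y}).

Definition im_pred : {pred Y} := fun y => `[< exists x, d x = y >].

Lemma im_submod : submod_closed im_pred.
Proof.
split=> [|a _ _ /asboolP[x <-] /asboolP[y <-]].
  by apply/asboolP; exists 0; rewrite linear0.
by apply/asboolP; exists (a *: x + y); rewrite linearP.
Qed.

Definition im_type : Type := {y | im_pred y}.
HB.instance Definition _ := SubChoice.on im_type.
HB.instance Definition _ := GRing.SubChoice_isSubLmodule.Build R Y im_pred im_type im_submod.

(** [projective] speaks of surjections, so [d] is corestricted to its image, which is why [im_type]
    is given a module structure. *)
Lemma projective_lift (P : lmodType R) (f : {linear P -> Y}) :
  projective P -> (forall x, exists y, d y = f x) ->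
  exists h : {linear P -> X}, forall x, d (h x) = f x.
Proof.
move=> Pp fd; have dI y : im_pred (d y) by apply/asboolP; exists y.
have fI x : im_pred (f x) by apply/asboolP.
pose d' y : im_type := exist _ (d y) (dI y).
pose f' x : im_type := exist _ (f x) (fI x).
have dl : linear d' by move=> a x y; apply: val_inj; rewrite /= linearP.
have fl : linear f' by move=> a x y; apply: val_inj; rewrite /= linearP.
have [|h hE] := Pp _ _ (mklin dl) (mklin fl).
  by case=> y /[dup] /asboolP[x xy] yI; exists x; apply: val_inj.
by exists h => x; have /(congr1 val) := hE x.
Qed.
End ImageModule.

(** Dependent choice in which [I] is the invariant that makes the next choice possible, while [S]
    relates consecutive choices. *)
Lemma dependent_rec (T : nat -> Type) (I : forall n, T n -> Prop)
    (S : forall n, T n -> T n.+1 -> Prop) (x0 : T 0%N) : I 0%N x0 ->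
  (forall n x, I n x -> exists2 y, S n x y & I n.+1 y) ->
  exists2 f : forall n, T n, f 0%N = x0 & forall n, S n (f n) (f n.+1).
Proof.
move=> I0 IS.
have nx n (x : {x : T n | I n x}) : {y : T n.+1 | S n (sval x) y /\ I n.+1 y}.
  by apply: cid; have [y Sy Iy] := IS n _ (svalP x); exists y.
pose g := nat_rect (fun n => {x : T n | I n x}) (exist _ x0 I0)
  (fun n x => exist _ (sval (nx n x)) (proj2 (svalP (nx n x)))).
by exists (fun n => sval (g n)) => // n; case: (svalP (nx n (g n))).
Qed.

Section Comparison.
Variables (R : pzRingType) (M : lmodType R).
Implicit Types P Q S : proj_resolution M.

Definition chain_map P Q (f : forall n, {linear P n -> Q n}) :=
  (forall x, pr_aug Q (f 0%N x) = pr_aug P x) /\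
  (forall n x, pr_d Q n (f n.+1 x) = f n (pr_d P n x)).

Lemma chain_map_exists P Q : exists f : forall n, {linear P n -> Q n}, chain_map f.
Proof.
have [f0 f0E] : exists f0 : {linear P 0%N -> Q 0%N}, forall x, pr_aug Q (f0 x) = pr_aug P x.
  by apply: projective_lift => [|x]; [apply: pr_projective|apply: pr_aug_surj].
(* The invariant says that [f] maps boundaries to boundaries, so the next component can be lifted
   along the differential of [Q]. *)
pose I n (f : {linear P n -> Q n}) := forall x, exists y, pr_d Q n y = f (pr_d P n x).
have I0 : I 0%N f0.
  by move=> x; apply/pr_exact0; rewrite f0E; apply/pr_exact0; exists x.
pose S n (f : {linear P n -> Q n}) (f' : {linear P n.+1 -> Q n.+1}) :=
  forall x, pr_d Q n (f' x) = f (pr_d P n x).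
have IS n f : I n f -> exists2 f', S n f f' & I n.+1 f'.
  move=> If; have [f' f'E] : exists f' : {linear P n.+1 -> Q n.+1},
      forall x, pr_d Q n (f' x) = (f \o pr_d P n) x.
    by apply: projective_lift => //; apply: pr_projective.
  exists f' => // x; apply/pr_exact; rewrite f'E /=.
  have -> : pr_d P n (pr_d P n.+1 x) = 0 by apply/pr_exact; exists x.
  by rewrite linear0.
have [f fE fS] := dependent_rec I0 IS.
by exists f; split=> // x; rewrite fE.
Qed.

Lemma chain_map_id P : chain_map (fun n => idfun : {linear P n -> P n}).
Proof. by []. Qed.

Lemma chain_map_comp P Q S (f : forall n, {linear P n -> Q n})
    (g : forall n, {linear Q n -> S n}) :
  chain_map f -> chain_map g -> chain_map (fun n => g n \o f n : {linear P n -> S n}).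
Proof. by move=> [f0 fS] [g0 gS]; split=> [x|n x] /=; rewrite ?g0 ?f0 // gS fS. Qed.

Lemma chain_homotopy P Q (f g : forall n, {linear P n -> Q n}) :
  chain_map f -> chain_map g ->
  exists s : forall n, {linear P n -> Q n.+1},
    (forall x, f 0%N x - g 0%N x = pr_d Q 0 (s 0%N x)) /\
    (forall n x, f n.+1 x - g n.+1 x = pr_d Q n.+1 (s n.+1 x) + s n (pr_d P n x)).
Proof.
move=> [f0 fS] [g0 gS].
pose h n : {linear P n -> Q n} := f n \- g n.
have hE n x : h n x = f n x - g n x by [].
have h0 x : pr_aug Q (h 0%N x) = 0 by rewrite linearB f0 g0 subrr.
have hS n x : pr_d Q n (h n.+1 x) = h n (pr_d P n x) by rewrite linearB fS gS.
have [s0 s0E] : exists s0 : {linear P 0%N -> Q 1%N}, forall x, pr_d Q 0 (s0 x) = h 0%N x.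
  by apply: projective_lift => [|x]; [apply: pr_projective|apply/pr_exact0].
(* The invariant makes [h - s d] cycle-valued one degree higher, hence boundary-valued by exactness,
   so that it can be lifted. *)
pose I n (s : {linear P n -> Q n.+1}) := forall x, pr_d Q n (s (pr_d P n x)) = h n (pr_d P n x).
have I0 : I 0%N s0 by move=> x; rewrite s0E.
pose S n (s : {linear P n -> Q n.+1}) (s' : {linear P n.+1 -> Q n.+2}) :=
  forall x, pr_d Q n.+1 (s' x) = h n.+1 x - s (pr_d P n x).
have IS n s : I n s -> exists2 s', S n s s' & I n.+1 s'.
  move=> Is; have [s' s'E] : exists s' : {linear P n.+1 -> Q n.+2},
      forall x, pr_d Q n.+1 (s' x) = (h n.+1 \- (s \o pr_d P n)) x.
    apply: projective_lift => [|x]; first exact: pr_projective.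
    by apply/pr_exact; rewrite linearB hS Is subrr.
  exists s' => // x; rewrite s'E /=.
  have -> : pr_d P n (pr_d P n.+1 x) = 0 by apply/pr_exact; exists x.
  by rewrite linear0 subr0.
have [s sE sS] := dependent_rec I0 IS.
exists s; split=> [x|n x]; first by rewrite sE s0E.
by rewrite sS subrK.
Qed.
End Comparison.

Section SubquotientMap.
Variables (k : comNzRingType) (V V' : lmodType k) (Z B : submodule V) (Z' B' : submodule V').
Variables (F : V -> V') (Fl : linear F).
Hypotheses (FZ : forall x, Z x -> Z' (F x)) (FB : forall x, B x -> B' (F x)).

Definition sq_map_fun (h : subquotient Z B) : subquotient Z' B' := sq_class B' (FZ (sq_repZ h)).

Lemma sq_map_class x (hx : Z x) : sq_map_fun (sq_class B hx) = sq_class B' (FZ hx).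
Proof.
apply/sq_classP; have /FB := sq_classK B hx.
by rewrite addrC -scaleN1r Fl scaleN1r addrC.
Qed.

Lemma sq_map_lin : linear sq_map_fun.
Proof.
move=> c x y; elim/sqW: x => x hx; elim/sqW: y => y hy.
rewrite -[c *: _ + _ in LHS]/(sq_add (sq_scale c _) _) sq_scaleE sq_addE.
rewrite -[RHS]/(sq_add (sq_scale c _) _) !sq_map_class sq_scaleE sq_addE.
by apply: sq_class_eq; rewrite Fl.
Qed.

Definition sq_map : {linear subquotient Z B -> subquotient Z' B'} := mklin sq_map_lin.

Lemma sq_map_bij : (forall x, Z x -> B' (F x) -> B x) ->
  (forall y, Z' y -> exists2 x, Z x & B' (F x - y)) -> bijective sq_map.
Proof.
move=> inj surj; have G y : {x | sq_map x = y}.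
  apply: cid; elim/sqW: y => y hy; have [x hx xy] := surj y hy.
  by exists (sq_class B hx); rewrite [LHS]sq_map_class; apply/sq_classP.
exists (fun y => sval (G y)) => [x|y]; last exact: svalP (G y).
have := svalP (G (sq_map x)); move: (sval _) => y; elim/sqW: x => x hx; elim/sqW: y => y hy.
rewrite -[sq_map (sq_class B hx)]/(sq_map_fun _) -[sq_map _]/(sq_map_fun _) !sq_map_class.
move/sq_classP => FB'; apply/sq_classP; apply: inj.
  by rewrite addrC -scaleN1r; apply: sm_lin.
by rewrite addrC -scaleN1r Fl scaleN1r addrC.
Qed.
End SubquotientMap.

Section BarCochains.
Variables (k : comNzRingType) (A U : algType k) (B : left_bialgebroid A U) (N : lmodType U).
Local Notation tgen := (tgen B).
Local Notation barmod := (barmod B).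
Implicit Types us : seq U.

Definition bar_cochain p (f : barmod p -> N) : precochain B N p :=
  fun x => f (tlift (fun us => tgen p.+1 (1 :: us)) x).

Lemma ev_bar_cochain p (f : barmod p -> N) us : size us = p ->
  ev (bar_cochain f) us = bar_res f us.
Proof.
move=> e; rewrite /ev /bar_cochain -/(tgen p us) tlift_gen //.
exact/mbal_behead/mbal_tgen.
Qed.

Lemma bar_cochainP p (f : barmod p -> N) : linear f -> cochain (bar_cochain f).
Proof.
move=> fl; split=> [|a u us e].
  apply: (lin_comp (bar_klin fl)); apply: tlift_lin.
  exact/mbal_behead/mbal_tgen.
by rewrite !ev_bar_cochain //; have [_] := multi_bar_res fl; apply.
Qed.

Lemma bdl_sum (V : lmodType k) (F : seq U -> V) n u us : size us = n.+1 ->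
  bdl B F u us =
  \sum_(i < n.+1) (-1) ^+ i *:
    F (take i (u :: us) ++ (u :: us)`_i * us`_i :: drop i.+1 us) +
  (-1) ^+ n.+1 *: F (rcons (take n (u :: us)) ((u :: us)`_n * tgt B (eps B us`_n))).
Proof.
elim: n u us F => [|n IHn] u [|v us] F //= [e].
  by case: us e => // _; rewrite big_ord1 expr0 expr1 scale1r scaleN1r.
case: us e => [//|w us] e; rewrite (IHn v (w :: us)) // [in RHS]big_ord_recl /=.
rewrite expr0 scale1r opprD -addrA; congr (_ + (_ + _)).
  rewrite -sumrN; apply: eq_bigr => i _ /=.
  by rewrite exprS mulN1r scaleNr.
by rewrite [in RHS]exprS mulN1r scaleNr.
Qed.

(** On [1 ⊗ us] the first term of the bar differential is [us] itself, whose first entry leaves [f]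
    by [U]-linearity and becomes the action term of the coboundary. *)
Lemma cobd_bar p (f : barmod p -> N) us : linear f -> size us = p.+1 ->
  cobd (bar_cochain f) us = f (bar_d B p (tgen p.+2 (1 :: us))).
Proof.
case: us => [//|u us] fl [e].
have fk := bar_klin fl; have fbE ws : size ws = p.+1 ->
    f (tgen p.+1 ws) = head 0 ws *: bar_res f (behead ws) :> N.
  by case: ws => [//|w ws] [ews]; rewrite bar_genE // mod_linZ.
rewrite [RHS](_ : _ = bdl B (fun ws => f (tgen p.+1 ws) : resk N) 1 (u :: us)); last first.
  rewrite -[bar_d _ _ _]/(bar_d_fun _) bar_d_gen; last by rewrite /= e.
  exact: (lin_bdl _ _ _ _ fk).
rewrite /= mul1r fbE /= ?e // /cobd; case: p f fl e fk fbE => [|p] f fl e fk fbE.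
  by case: us e => //= _; rewrite mul1r fbE //= ev_bar_cochain.
rewrite /= -addrA ev_bar_cochain //; congr (_ + _).
case: us e => [//|v us] [e]; rewrite (@bdl_sum (resk N) _ p u (v :: us)) /= ?e //.
rewrite opprD -sumrN; congr (_ + _).
  apply: eq_bigr => i _; rewrite [LHS]sign_scale sgS scaleNr ev_bar_cochain //.
  by have ip := ltn_ord i; rewrite size_cat /= size_takel ?size_drop /= e; lia.
rewrite [LHS]sign_scale sgS scaleNr ev_bar_cochain //.
by rewrite size_rcons size_takel //= e; lia.
Qed.

Lemma bar_cochain_inj p (f g : barmod p -> N) : linear f -> linear g ->
  bar_cochain f = bar_cochain g -> f =1 g.
Proof.
move=> fl gl fg; apply: (bar_Uext fl gl) => us e.
by rewrite -[LHS]/(bar_res f us) -[RHS]/(bar_res g us) -!ev_bar_cochain // fg.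
Qed.

Lemma bar_cochain_ind p (g : precochain B N p) : cochain g ->
  linear (bar_ind (ev g) : barmod p -> N) /\ bar_cochain (bar_ind (ev g)) = g.
Proof.
move=> gc; have gm := multi_ev gc; have gl := bar_ind_lin gm; split=> //.
apply: trunc_inj (bar_cochainP gl) gc _; apply/funext => us; rewrite /trunc.
by case: eqP => // e; rewrite ev_bar_cochain // bar_indK.
Qed.

Lemma bar_cocycleP p (f : barmod p -> N) : linear f ->
  is_cocycle (bar_cochain f) <-> (forall x, f (bar_d B p x) = 0).
Proof.
move=> fl; split=> [[_ f0]|f0]; last first.
  by split=> [|us e]; [apply: bar_cochainP|rewrite cobd_bar].
have fdl : linear (fun x => f (bar_d B p x)) by move=> u x y; rewrite linearP fl.
have zl : linear (fun _ : barmod p.+1 => 0 : N) by move=> u x y; rewrite scaler0 addr0.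
by apply: (bar_Uext fdl zl) => us e; rewrite -cobd_bar // f0.
Qed.

Lemma bar_coboundaryP p (f : barmod p.+1 -> N) : linear f ->
  is_coboundary (bar_cochain f) <->
  exists2 g : barmod p -> N, linear g & forall x, f x = g (bar_d B p x).
Proof.
move=> fl; split=> [[_ [g [gc fg]]]|[g gl fg]].
  have [gl gE] := bar_cochain_ind gc; exists (bar_ind (ev g)) => //.
  apply: (bar_Uext fl) => [u x y|us e]; first by rewrite linearP gl.
  by rewrite -cobd_bar // gE -fg // ev_bar_cochain.
split; first exact: bar_cochainP.
exists (bar_cochain g); split=> [|us e]; first exact: bar_cochainP.
by rewrite cobd_bar // -fg ev_bar_cochain.
Qed.
End BarCochains.

Section ExtComparison.
Variables (k : comNzRingType) (A U : algType k) (B : left_bialgebroid A U) (N : lmodType U).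
Variables (P : proj_resolution (base_mod B)) (Up : projective (U_tri B)).
Local Notation barmod := (barmod B).
Local Notation tgen := (tgen B).

Local Notation BR := (bar_resolution (fun p => bar_projective (p := p) Up)).
Variables (phi : forall n, {linear BR n -> P n}) (psi : forall n, {linear P n -> BR n}).
Hypotheses (phiC : chain_map phi) (psiC : chain_map psi).

Definition comparison p : precochain B (P p) p := bar_cochain (phi p : barmod p -> P p).

Lemma comparison_bar : bar_comparison (@comparison).
Proof.
have phil p : linear (phi p : barmod p -> P p) by exact: linearP.
split=> [p||p us e]; first exact: bar_cochainP.
  rewrite ev_bar_cochain // [LHS](phiC.1 (tgen 1 [:: 1])).
  by rewrite -[LHS]/(bar_aug_fun _) bar_aug_gen eps1.
rewrite cobd_bar // ev_bar_cochain //.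
exact: (phiC.2 p (tgen p.+2 (1 :: us) : barmod p.+1)).
Qed.

Definition pull p (f : prehom N P p) : precochain B N p := fun x => f (comparison x).

Lemma pull_lin p : linear (@pull p).
Proof. by []. Qed.

Lemma Uhom_phi p (f : prehom N P p) : is_Uhom f ->
  linear (fun x : barmod p => f (phi p x) : N).
Proof. by move=> fl u x y; rewrite linearP fl. Qed.

Lemma pull_cocycle p (f : prehom N P p) : ext_cocycle f -> is_cocycle (pull f).
Proof.
move=> [fl f0]; apply/(bar_cocycleP (Uhom_phi fl)) => x.
by rewrite -[bar_d B p x]/(pr_d BR p x) -phiC.2 f0.
Qed.

Lemma pull_coboundary p (f : prehom N P p) : ext_coboundary f -> is_coboundary (pull f).
Proof.
case: p f => [|p] f /= => [-> //|[g [gl fg]]].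
have fl : is_Uhom f by move=> u x y; rewrite !fg linearP gl.
apply/(bar_coboundaryP (Uhom_phi fl)); exists (fun x => g (phi p x)); first exact: Uhom_phi.
by move=> x; rewrite fg phiC.2.
Qed.

Definition ext_comparison p : {linear Ext N P p -> HUN B N p} :=
  @sq_map k (prehom N P p) (precochain B N p) (ext_cocycles N P p) (ext_coboundaries N P p)
    (cocycles B N p) (coboundaries B N p) _ (@pull_lin p) (@pull_cocycle p) (@pull_coboundary p).

Lemma ext_comparison_class p (f : prehom N P p) (hf : ext_cocycle f) :
  ext_comparison p (Ext_class hf) = HUN_class (pull_cocycle hf).
Proof.
exact: (@sq_map_class k (prehom N P p) (precochain B N p) (ext_cocycles N P p)
  (ext_coboundaries N P p) (cocycles B N p) (coboundaries B N p) _
  (@pull_lin p) (@pull_cocycle p) (@pull_coboundary p)).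
Qed.

Lemma ext_comparison_induced : induced_by_comparison ext_comparison.
Proof.
exists (@comparison); split=> [|p f hf]; first exact: comparison_bar.
by exists (pull_cocycle hf); apply: ext_comparison_class.
Qed.

(** With [id - phi psi = d s + s d] on [P], a cocycle [f] of positive degree with [f phi = g d]
    equals [g psi d + f s d]. In degree 0 the same homotopy gives [f = f phi psi = 0]. *)
Lemma ext_comparison_inj p (f : prehom N P p) :
  ext_cocycle f -> is_coboundary (pull f) -> ext_coboundary f.
Proof.
move=> [fl f0] fB.
have [s [s0 sS]] := chain_homotopy (chain_map_id P) (chain_map_comp psiC phiC).
have fE x y : f x - f y = f (x - y) by rewrite (mod_linB (f := f : P p -> N)).
case: p f fl f0 fB fE => [|p] f fl f0 fB fE /=.
  have zl : linear (fun _ : barmod 0 => 0 : N) by move=> u y z; rewrite scaler0 addr0.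
  have H := bar_cochain_inj (Uhom_phi fl) zl fB.
  apply/funext => x; apply/eqP; rewrite -[f x](subrK (f (phi 0 (psi 0 x)))).
  by rewrite fE [x - _]s0 f0 add0r; apply/eqP; apply: H.
have [g gl fg] := (bar_coboundaryP (Uhom_phi fl)).1 fB.
exists (fun x => g (psi p x) + f (s p x)); split=> [u x y|x].
  by rewrite !linearP gl fl scalerDr addrACA.
rewrite -psiC.2 -[pr_d BR p _]/(bar_d B p _) -fg addrC; apply/eqP.
rewrite -subr_eq fE [x - _]sS.
by have := fl 1 (pr_d P p.+1 (s p.+1 x)) (s p (pr_d P p x)); rewrite !scale1r => ->; rewrite f0 add0r.
Qed.

(** A preimage of [g] is [G psi], where [G] is the [U]-linear map on the bar module given by [g]; a
    homotopy from [psi phi] to the identity bounds the difference. *)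
Lemma ext_comparison_surj p (g : precochain B N p) : is_cocycle g ->
  exists2 f : prehom N P p, ext_cocycle f & is_coboundary (pull f - g).
Proof.
move=> gZ; have [gc _] := gZ; have [Gl GE] := bar_cochain_ind gc.
set G := bar_ind _ in Gl GE; have G0 : forall x, G (bar_d B p x) = 0.
  by apply/(bar_cocycleP Gl); rewrite GE.
have [s [s0 sS]] := chain_homotopy (chain_map_comp phiC psiC) (chain_map_id BR).
exists (fun x => G (psi p x)).
  split=> [u x y|x]; first by rewrite linearP Gl.
  by rewrite -psiC.2 [LHS]G0.
have -> : pull (fun x => G (psi p x)) - g = bar_cochain (fun x => G (psi p (phi p x) - x)).
  by rewrite -[in LHS]GE; apply/funext => x; rewrite /bar_cochain (mod_linB Gl).
case: p g gZ gc G Gl GE G0 => [|p] g gZ gc G Gl GE G0.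
  by apply/funext => x; rewrite /bar_cochain [_ - _]s0 -[pr_d BR 0 _]/(bar_d B 0 _) G0.
apply/bar_coboundaryP.
  move=> u x y; rewrite -Gl; congr G; rewrite [phi _ _]linearP [psi _ _]linearP scalerBr.
  by rewrite opprD addrACA.
exists (fun x => G (s p x)) => [u x y|x]; first by rewrite linearP Gl.
have := Gl 1 (pr_d BR p.+1 (s p.+1 x)) (s p (pr_d BR p x)).
by rewrite !scale1r [_ - _]sS => ->; rewrite -[pr_d BR p.+1 _]/(bar_d B p.+1 _) G0 add0r.
Qed.

Lemma ext_comparison_bij p : bijective (ext_comparison p).
Proof. by apply: sq_map_bij => [x|y]; [apply: ext_comparison_inj|apply: ext_comparison_surj]. Qed.
End ExtComparison.

(** * Transport of a Gerstenhaber structure along an isomorphism *)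

Section Transport.
Variables (k : comNzRingType) (V W : nat -> lmodType k) (GW : gerstenhaber W).
Variables (f : forall p, {linear V p -> W p}) (fb : forall p, bijective (f p)).

Lemma inverse_linear p : {g : {linear W p -> V p} | cancel g (f p) & cancel (f p) g}.
Proof.
have [g gfK] : {g : W p -> V p | cancel g (f p)}.
  by apply: cid; have [g ? ?] := fb p; exists g.
have fgK : cancel (f p) g by move=> x; apply: (bij_inj (fb p)); rewrite gfK.
have gl : linear g by move=> c x y; apply: (bij_inj (fb p)); rewrite linearP !gfK.
by exists (mklin gl).
Qed.

Let g p : {linear W p -> V p} := s2val (inverse_linear p).
Let gK p : cancel (g p) (f p). Proof. exact: s2valP (inverse_linear p). Qed.
Let fK p : cancel (f p) (g p). Proof. exact: s2valP' (inverse_linear p). Qed.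

Lemma dsum_map_lin (V' W' : nat -> lmodType k) (h : forall p, {linear V' p -> W' p}) :
  linear (dsum_map h).
Proof. by move=> c x y; apply: dsumP => p; rewrite /= linearP. Qed.

Lemma dsum_map_dinj (V' W' : nat -> lmodType k) (h : forall p, {linear V' p -> W' p}) p
  (x : V' p) : dsum_map h (dinj x) = dinj (h p x).
Proof.
apply: dsumP => q /=; have [e|pq] := eqVneq p q; first by subst q; rewrite !dinj_funE.
by rewrite !dinj_fun0 ?linear0 //; apply/eqP.
Qed.

Let F := dsum_map f.
Let G := dsum_map g.

Lemma dsum_mapK : cancel F G. Proof. by move=> x; apply: dsumP => p; apply: fK. Qed.
Lemma dsum_mapVK : cancel G F. Proof. by move=> x; apply: dsumP => p; apply: gK. Qed.

Let tr (op : dsum W -> dsum W -> dsum W) x y := G (op (F x) (F y)).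

Let tr_linl op : (forall y, linear (op^~ y)) -> forall y, linear (tr op ^~ y).
Proof. by move=> ol y c x x'; rewrite /tr /F /G (dsum_map_lin f) ol (dsum_map_lin g). Qed.

Let tr_linr op : (forall x, linear (op x)) -> forall x, linear (tr op x).
Proof. by move=> ol x c y y'; rewrite /tr /F /G (dsum_map_lin f) ol (dsum_map_lin g). Qed.

Let Gl : linear G := dsum_map_lin g.

(** The operations are conjugated by the isomorphism; ending with [Defined] keeps them visible to
    [transport_iso]. *)
Definition transport_gerstenhaber : gerstenhaber V.
Proof.
refine (@Gerstenhaber k V (tr (g_cup GW)) (g 0 (g_one GW)) (tr (g_br GW))
  (tr_linl (g_cup_linl GW)) (tr_linr (g_cup_linr GW)) _ _ _ _ _
  (tr_linl (g_br_linl GW)) (tr_linr (g_br_linr GW)) _ _ _ _ _).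
- move=> p q x y; rewrite /tr /F !dsum_map_dinj.
  have [z ->] := g_cup_deg GW (f p x) (f q y).
  by exists (g _ z); rewrite /G dsum_map_dinj.
- by move=> x y z; rewrite /tr !dsum_mapVK g_cupA.
- by move=> x; rewrite /tr /F dsum_map_dinj gK g_cup1l dsum_mapK.
- by move=> x; rewrite /tr /F dsum_map_dinj gK g_cup1r dsum_mapK.
- by move=> p q x y; rewrite /tr /F !dsum_map_dinj g_cupC (linZ Gl).
- move=> p q r x y e; rewrite /tr /F !dsum_map_dinj.
  have [z ->] := g_br_deg GW (f p x) (f q y) e.
  by exists (g _ z); rewrite /G dsum_map_dinj.
- by move=> x y; rewrite /tr /F !dsum_map_dinj g_br_deg0 (lin0 Gl).
- by move=> p q x y; rewrite /tr /F !dsum_map_dinj g_brC -scaleNr (linZ Gl) scaleNr.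
- move=> p q r x y z; rewrite /tr !dsum_mapVK /F !dsum_map_dinj g_jacobi.
  by rewrite (linD Gl) (linZ Gl).
- move=> p q r x y z; rewrite /tr !dsum_mapVK /F !dsum_map_dinj g_leibniz.
  by rewrite (linD Gl) (linZ Gl).
Defined.

Lemma transport_iso : gerstenhaber_iso transport_gerstenhaber GW f.
Proof. by split=> [||x y|x y] //=; rewrite ?gK // -/F [LHS]dsum_mapVK. Qed.
End Transport.

Lemma Ext_gerstenhaber (k : comNzRingType) (A U : algType k) (B : left_bialgebroid A U)
    (N : lmodType U) (G : gerstenhaber (HUN B N)) :
  projective (U_tri B) -> forall P : proj_resolution (base_mod B),
  exists (GE : gerstenhaber (Ext N P)) (th : forall p, {linear Ext N P p -> HUN B N p}),
    induced_by_comparison th /\ gerstenhaber_iso GE G th.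
Proof.
move=> Up P; pose BR := bar_resolution (fun p => bar_projective (p := p) Up).
have [phi phiC] := chain_map_exists BR P; have [psi psiC] := chain_map_exists P BR.
exists (transport_gerstenhaber G (ext_comparison_bij N phiC psiC)), (ext_comparison N phiC).
by split; [apply: ext_comparison_induced|apply: transport_iso].
Qed.

Theorem corollary3p3 (k : comNzRingType) (A U : algType k)
    (B : left_bialgebroid A U) (N : lmodType U) (Y : yd_algebra B N)
    (bc : braided_commutative Y) :
  exists G : gerstenhaber (HUN B N),
    [/\ induced_by_cup Y G,
        induced_by_bracket Y G &
        projective (U_tri B) ->
        forall P : proj_resolution (base_mod B),
        exists (GE : gerstenhaber (Ext N P))
               (th : forall p, {linear Ext N P p -> HUN B N p}),
          induced_by_comparison th /\ gerstenhaber_iso GE G th].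
Proof.
exists (HUN_gerstenhaber bc); split.
- exact: HUN_induced_by_cup.
- exact: HUN_induced_by_bracket.
- exact: Ext_gerstenhaber.
Qed.
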